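(* (1) Each of the twelve extremal rational elliptic surfaces $X_{211}, X_{321}, X_{431}, X_{411}, X_{141}, X_{222}, X_{9111}, X_{8211}, X_{5511}, X_{6321}, X_{4422}, X_{3333}$ has an integral model in the strong sense over $\mathbb{Z}$. (2) None of the surfaces $X_{22}$, $X_{33}$, $X_{44}$ has an integral model in the strong sense over $\mathbb{Z}$, but for each of these three surfaces there is a number field $K$ such that the surface has an integral model in the strong sense over the ring of integers of $K$. Consequently, every extremal rational elliptic surface in characteristic zero appearing in the Miranda--Persson classification, other than those of type $X_{11}(j)$, has an integral model with good reduction everywhere (over the ring of integers of some number field).
   Context: An elliptic surface over an algebraically closed field $k$ is a smooth projective surface $X$ with a morphism $f:X\to C$ to a smooth projective curve $C$, all but finitely many of whose fibres are elliptic curves, with a fixed section (the zero section) and no exceptional curves of the first kind in the fibres. It is extremal rational if $X$ is rational (so $C=\mathbb{P}^1$) and the Mordell--Weil group of the generic fibre is finite. Its Weierstrass model is obtained by contracting the components of fibres not meeting the zero section. It is given by a Weierstrass equation $y^2+a_1xy+a_3y=x^3+a_2x^2+a_4x+a_6$ with $a_i\in k[t]$, $\deg a_i\le i$, where $t$ is an affine coordinate on $\mathbb{P}^1$. The $a_i$ are regarded as forms of degree $i$ on $\mathbb{P}^1$, and minimality of the equation is required at every point of $\mathbb{P}^1$, including $t=\infty$. Miranda--Persson classification: in characteristic $0$, over an algebraically closed field, every extremal rational elliptic surface is one of the following, with the indicated Kodaira types of singular fibres: $X_{22}$ (II, II$^*$), $X_{33}$ (III, III$^*$), $X_{44}$ (IV,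 IV$^*$), $X_{211}$ (II$^*$, I$_1$, I$_1$), $X_{321}$ (III$^*$, I$_2$, I$_1$), $X_{431}$ (IV$^*$, I$_3$, I$_1$), $X_{411}$ (I$_4^*$, I$_1$, I$_1$), $X_{141}$ (I$_1^*$, I$_4$, I$_1$), $X_{222}$ (I$_2^*$, I$_2$, I$_2$), $X_{9111}$ (I$_9$, I$_1$, I$_1$, I$_1$), $X_{8211}$ (I$_8$, I$_2$, I$_1$, I$_1$), $X_{5511}$ (I$_5$, I$_5$, I$_1$, I$_1$), $X_{6321}$ (I$_6$, I$_3$, I$_2$, I$_1$), $X_{4422}$ (I$_4$, I$_4$, I$_2$, I$_2$), $X_{3333}$ (I$_3$, I$_3$, I$_3$, I$_3$), and a family $X_{11}(j)$ (I$_0^*$, I$_0^*$), one for each value of the $j$-invariant. Each configuration other than (I$_0^*$, I$_0^*$) determines the surface uniquely up to isomorphism. Let $R$ be an integral domain (here $\mathbb{Z}$ or the ring of integers of a number field). An integral model in the weak sense over $R$ of an extremal rational elliptic surface $S$ in characteristic zero is a diagram $X\xrightarrow{f}\mathbb{P}^1_R\to \operatorname{Spec} R$ with $f$ and the composite $g:X\to\operatorname{Spec} R$ flat and proper, given by a Weierstrass equation with $a_i\in R[t]$, $\deg a_i\le i$, such that the geometric generic fibre of $g$ is the Weierstrass model of $S$. It is an integral model in the strong sense (good reduction everywhere) if moreover all (geometric) fibres of $g$ are Weierstrass models of elliptic surfaces and all the resulting Weierstrass equations (over each residue field of $R$) are minimal. *)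

(* Defs.v *)
From HB Require Import structures.
From mathcomp Require Import all_boot all_order all_algebra all_field.
From mathcomp Require Import boolp.

Set Implicit Arguments.
Unset Strict Implicit.
Unset Printing Implicit Defensive.

Import GRing.Theory.
Local Open Scope ring_scope.

(* y^2 + a1 x y + a3 y = x^3 + a2 x^2 + a4 x + a6 *)
Record weierstrass (A : Type) := Weierstrass {
  a1 : A; a2 : A; a3 : A; a4 : A; a6 : A }.

Definition map_weierstrass (A B : Type) (f : A -> B) (W : weierstrass A) :=
  Weierstrass (f (a1 W)) (f (a2 W)) (f (a3 W)) (f (a4 W)) (f (a6 W)).

Section Invariants.
Variable A : comNzRingType.
Implicit Types W : weierstrass A.

Definition b2 W := a1 W ^+ 2 + 4%:R * a2 W.
Definition b4 W := a1 W * a3 W + 2%:R * a4 W.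
Definition b6 W := a3 W ^+ 2 + 4%:R * a6 W.
Definition b8 W :=
  a1 W ^+ 2 * a6 W - a1 W * a3 W * a4 W + 4%:R * a2 W * a6 W
  + a2 W * a3 W ^+ 2 - a4 W ^+ 2.
Definition c4 W := b2 W ^+ 2 - 24%:R * b4 W.
Definition c6 W := - b2 W ^+ 3 + 36%:R * b2 W * b4 W - 216%:R * b6 W.
Definition disc W :=
  - b2 W ^+ 2 * b8 W - 8%:R * b4 W ^+ 3 - 27%:R * b6 W ^+ 2
  + 9%:R * b2 W * b4 W * b6 W.

Definition on_curve W (x y : A) :=
  y ^+ 2 + a1 W * x * y + a3 W * y
  = x ^+ 3 + a2 W * x ^+ 2 + a4 W * x + a6 W.

(* The substitution x = u^2 x' + r, y = u^3 y' + u^2 s x' + w turns W into W'. *)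
Definition admissible_change (u r s w : A) W W' : Prop :=
  [/\ u * a1 W' = a1 W + 2%:R * s,
      u ^+ 2 * a2 W' = a2 W - s * a1 W + 3%:R * r - s ^+ 2,
      u ^+ 3 * a3 W' = a3 W + r * a1 W + 2%:R * w,
      u ^+ 4 * a4 W' = a4 W - s * a3 W + 2%:R * r * a2 W
                       - (w + r * s) * a1 W + 3%:R * r ^+ 2 - 2%:R * s * w
    & u ^+ 6 * a6 W' = a6 W + r * a4 W + r ^+ 2 * a2 W + r ^+ 3
                       - w * a3 W - w ^+ 2 - r * w * a1 W].

End Invariants.

(* deg a_i <= i, so that a_i can be regarded as a form of degree i on P^1 *)
Definition has_degrees (A : nzRingType) (W : weierstrass {poly A}) : Prop :=
  [/\ (size (a1 W) <= 2)%N, (size (a2 W) <= 3)%N, (size (a3 W) <= 4)%N,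
      (size (a4 W) <= 5)%N & (size (a6 W) <= 7)%N].

Definition base_change (A B : nzRingType) (phi : A -> B)
    (W : weierstrass {poly A}) : weierstrass {poly B} :=
  map_weierstrass (map_poly phi) W.

Section OverAField.
Variable k : fieldType.
Implicit Types W S : weierstrass {poly k}.

(* Pull-back of a form of degree i, given by its dehomogenization p, along
   (X : Y) |-> (al X + be Y : ga X + de Y). *)
Definition pullback_form (al be ga de : k) (i : nat) (p : {poly k}) : {poly k} :=
  \sum_(j < i.+1)
    p`_j *: ((al *: 'X + be%:P) ^+ j * (ga *: 'X + de%:P) ^+ (i - j)).

Definition pullback (al be ga de : k) W : weierstrass {poly k} :=
  Weierstrass (pullback_form al be ga de 1 (a1 W))
              (pullback_form al be ga de 2 (a2 W))
              (pullback_form al be ga de 3 (a3 W))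
              (pullback_form al be ga de 4 (a4 W))
              (pullback_form al be ga de 6 (a6 W)).

(* Points of P^1 are [option k], [None] being t = oo. [chart P W] is the
   equation of W in an affine chart in which P has coordinate [coord P]; at oo
   the local parameter is 1/t and a_i becomes t^(-i) a_i. *)
Definition chart (P : option k) W : weierstrass {poly k} :=
  if P is Some _ then W else pullback 0 1 1 0 W.
Definition coord (P : option k) : k := odflt 0 P.

Definition regular_at (c : k) (f : {fraction {poly k}}) : Prop :=
  exists p q : {poly k}, q.[c] != 0 /\ f = tofrac p / tofrac q.

Definition integral_at (c : k) (E : weierstrass {fraction {poly k}}) : Prop :=
  [/\ regular_at c (a1 E), regular_at c (a2 E), regular_at c (a3 E),
      regular_at c (a4 E) & regular_at c (a6 E)].

Definition generic_fibre W : weierstrass {fraction {poly k}} :=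
  map_weierstrass (@tofrac {poly k}) W.

(* Among the equations over k(t) equivalent to W and integral at t = c, the
   valuation at c of the discriminant is smallest for W. *)
Definition minimal_at_coord (c : k) W : Prop :=
  forall (u r s w : {fraction {poly k}}) (E : weierstrass {fraction {poly k}}),
    u != 0 -> admissible_change u r s w (generic_fibre W) E ->
    integral_at c E -> regular_at c (disc E / disc (generic_fibre W)).

Definition minimal_at (P : option k) W : Prop :=
  minimal_at_coord (coord P) (chart P W).

(* W is the Weierstrass model of an elliptic surface over P^1 (k algebraically
   closed). With deg a_i <= i and minimality everywhere, chi(O) = 1 and the
   surface is automatically rational. The discriminant is nonzero iff all but
   finitely many fibres are smooth, also in characteristics 2 and 3. *)
Definition elliptic_surface W : Prop :=
  [/\ has_degrees W, disc W != 0 & forall P, minimal_at P W].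

(* The Mordell-Weil group consists of these points and the zero section. *)
Definition finite_mordell_weil W : Prop :=
  exists l : seq ({fraction {poly k}} * {fraction {poly k}}),
    forall x y, on_curve (generic_fibre W) x y -> (x, y) \in l.

Definition extremal_rational W : Prop :=
  elliptic_surface W /\ finite_mordell_weil W.

(* Isomorphism of Weierstrass models over an automorphism of P^1: a global
   admissible change of coordinates, with r, s, w forms of degrees 2, 1, 3. *)
Definition isomorphic W S : Prop :=
  exists al be ga de u : k, exists r s w : {poly k},
    [/\ al * de - be * ga != 0, u != 0,
        [/\ (size r <= 3)%N, (size s <= 2)%N & (size w <= 4)%N]
      & admissible_change u%:P r s w (pullback al be ga de W) S].

End OverAField.

Inductive kodaira :=
  | I_ of nat | II | III | IV
  | Istar of nat | IVstar | IIIstar | IIstar.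

Section Fibres.
Variable k : fieldType.
Implicit Types W : weierstrass {poly k}.

(* Zero polynomials have infinite order, whence the use of divisibility. *)
Definition ord_ge (c : k) (n : nat) (p : {poly k}) : bool :=
  ('X - c%:P) ^+ n %| p.
Definition ord_eq (c : k) (n : nat) (p : {poly k}) : bool :=
  ord_ge c n p && ~~ ord_ge c n.+1 p.

(* The outcome of Tate's algorithm for an equation minimal at c, in residue
   characteristic different from 2 and 3; I_ 0 is a smooth fibre. *)
Definition kodaira_at_coord W (c : k) (T : kodaira) : bool :=
  match T with
  | I_ 0 => ord_eq c 0 (disc W)
  | I_ n => ord_eq c 0 (c4 W) && ord_eq c n (disc W)
  | II => [&& ord_ge c 1 (c4 W), ord_eq c 1 (c6 W) & ord_eq c 2 (disc W)]
  | III => [&& ord_eq c 1 (c4 W), ord_ge c 2 (c6 W) & ord_eq c 3 (disc W)]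
  | IV => [&& ord_ge c 2 (c4 W), ord_eq c 2 (c6 W) & ord_eq c 4 (disc W)]
  | Istar 0 => [&& ord_ge c 2 (c4 W), ord_ge c 3 (c6 W) & ord_eq c 6 (disc W)]
  | Istar n =>
      [&& ord_eq c 2 (c4 W), ord_eq c 3 (c6 W) & ord_eq c (6 + n) (disc W)]
  | IVstar => [&& ord_ge c 3 (c4 W), ord_eq c 4 (c6 W) & ord_eq c 8 (disc W)]
  | IIIstar => [&& ord_eq c 3 (c4 W), ord_ge c 5 (c6 W) & ord_eq c 9 (disc W)]
  | IIstar => [&& ord_ge c 4 (c4 W), ord_eq c 5 (c6 W) & ord_eq c 10 (disc W)]
  end.

Definition kodaira_at W (P : option k) (T : kodaira) : bool :=
  kodaira_at_coord (chart P W) (coord P) T.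

Definition singular_fibres W (l : seq kodaira) : Prop :=
  exists ps : seq (option k),
    [/\ uniq ps, all2 (kodaira_at W) ps l
      & forall P, P \notin ps -> kodaira_at W P (I_ 0)].

End Fibres.

(* The Miranda-Persson list; X11 stands for the whole family X11(j). *)
Inductive miranda_persson :=
  | X22 | X33 | X44 | X211 | X321 | X431 | X411 | X141 | X222
  | X9111 | X8211 | X5511 | X6321 | X4422 | X3333 | X11.

Definition configuration (c : miranda_persson) : seq kodaira :=
  match c with
  | X22 => [:: II; IIstar]
  | X33 => [:: III; IIIstar]
  | X44 => [:: IV; IVstar]
  | X211 => [:: IIstar; I_ 1; I_ 1]
  | X321 => [:: IIIstar; I_ 2; I_ 1]
  | X431 => [:: IVstar; I_ 3; I_ 1]
  | X411 => [:: Istar 4; I_ 1; I_ 1]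
  | X141 => [:: Istar 1; I_ 4; I_ 1]
  | X222 => [:: Istar 2; I_ 2; I_ 2]
  | X9111 => [:: I_ 9; I_ 1; I_ 1; I_ 1]
  | X8211 => [:: I_ 8; I_ 2; I_ 1; I_ 1]
  | X5511 => [:: I_ 5; I_ 5; I_ 1; I_ 1]
  | X6321 => [:: I_ 6; I_ 3; I_ 2; I_ 1]
  | X4422 => [:: I_ 4; I_ 4; I_ 2; I_ 2]
  | X3333 => [:: I_ 3; I_ 3; I_ 3; I_ 3]
  | X11 => [:: Istar 0; Istar 0]
  end.

(* S is (the Weierstrass model of) the surface named c over the algebraically
   closed field k of characteristic 0. For c other than X11 this determines S
   up to isomorphism. *)
Definition surface_of_type (k : closedFieldType) (c : miranda_persson)
    (S : weierstrass {poly k}) : Prop :=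
  [/\ [pchar k] =i pred0, extremal_rational S
    & singular_fibres S (configuration c)].

(* Models over R are given by their Weierstrass equations, flatness and
   properness of the associated X -> P^1_R -> Spec R being automatic.
   An injective phi : R -> k, with k algebraically closed, is a geometric
   generic point of Spec R. *)
Definition integral_model (R : comNzRingType) (k : closedFieldType)
    (W : weierstrass {poly R}) (S : weierstrass {poly k}) : Prop :=
  has_degrees W /\
  exists phi : {rmorphism R -> k},
    injective phi /\ isomorphic (base_change phi W) S.

(* Geometric points of Spec R, that is, geometric fibres of X -> Spec R, are
   ring morphisms from R to algebraically closed fields. *)
Definition strong_integral_model (R : comNzRingType) (k : closedFieldType)
    (W : weierstrass {poly R}) (S : weierstrass {poly k}) : Prop :=
  integral_model W S /\
  forall (F : closedFieldType) (psi : {rmorphism R -> F}),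
    elliptic_surface (base_change psi W).

Definition has_strong_model (R : comNzRingType) (k : closedFieldType)
    (S : weierstrass {poly k}) : Prop :=
  exists W : weierstrass {poly R}, strong_integral_model W S.

Section RingOfIntegers.
Variable K : fieldExtType rat.

Definition algebraic_integer : {pred K} :=
  fun x => `[< integralOver (intr : int -> K) x >].

Lemma algebraic_integer_subring : subring_closed algebraic_integer.
Proof.
split=> [|x y /asboolP ix /asboolP iy|x y /asboolP ix /asboolP iy]; apply/asboolP.
- exact: integral1.
- exact: integral_sub.
- exact: integral_mul.
Qed.

HB.instance Definition _ :=
  GRing.isSubringClosed.Build K algebraic_integer algebraic_integer_subring.

Record ring_of_integers := RingOfIntegers {
  int_val :> K; int_valP : int_val \in algebraic_integer }.

HB.instance Definition _ := [isSub for int_val].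
HB.instance Definition _ := [Choice of ring_of_integers by <:].
HB.instance Definition _ := [SubChoice_isSubComNzRing of ring_of_integers by <:].

End RingOfIntegers.

(* Main.v *)
Require Import Defs.
From Stdlib Require List.
From HB Require Import structures.
From mathcomp Require Import all_boot all_order all_algebra all_field.
From mathcomp Require Import boolp.
From mathcomp Require Import ring zify.
Import Defs.

Set Implicit Arguments.
Unset Strict Implicit.
Unset Printing Implicit Defensive.
Import GRing.Theory Num.Theory.
Local Open Scope ring_scope.

(** Why the twelve surfaces with non-constant j-invariant have models over the integers. Each is
given by an explicit equation [model] with integer coefficients. Its discriminant, a form of
degree 12, has a coefficient 1 or -1 at some t^j with 1 <= j <= 11. Over every field the degree
of the discriminant is therefore between 1 and 11, so its order is below 12 at each point of the
line, also at infinity. Equivalent equations have discriminants differing by 12th powers, whence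
an equation whose discriminant has order below 12 is minimal: this gives good reduction
everywhere ([elliptic_surface_of_disc], [elliptic_surface_model]).

That the geometric generic fibre is the given surface S is a matter of invariants. In
characteristic 0 an equation is determined up to admissible changes by the forms c4 and c6, of
degrees 4 and 6 ([isomorphic_of_invariants]). Two singular fibres of S can be placed at infinity
and at 0 ([normalize]); the Kodaira types then become conditions on the orders of c4, c6 and
c4^3 - c6^2 = 1728 disc, and these equations have a single solution up to the affine
substitutions and scalings that remain. This is proved type by type, in the lemmas [unique_X211]
and following. For the configurations (I4, I4, I2, I2) and (I3, I3, I3, I3) the discriminant is
a square or a cube up to constants, so that c4^3 = (c6 - E) (c6 + E), respectively c6^2 = prod_i
(c4 - om^i E), and unique factorization in k[t] replaces elimination.

The remaining three surfaces have constant j-invariant: c4 = 0 for (II, IIstar) and (IV,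
IVstar), c6 = 0 for (III, IIIstar). Over the integers c4 = b2^2 - 24 b4 = 0 forces 3 to divide
b2, b4 and the discriminant, which contradicts good reduction at 3; similarly c6 = 0 contradicts
good reduction at 2 ([c4_neq0_of_elliptic_over_int], [c6_neq0_of_elliptic_over_int]). The
obstruction disappears after adjoining q and c with q^4 = 3 and c^3 = 2, respectively e with e^4
= 4 e^2 - 1: the equations [model22], [model44] and [model33] have as discriminant minus a power
of a linear polynomial that is nonzero modulo every prime. At the primes where it becomes
constant, all the ramification is wild and concentrated in the fibre at infinity, whose
discriminant has order 12; minimality is then checked on the equation itself
([wild2_contradiction], [wild3_contradiction]). The number fields Q(q c) and Q(e) are
constructed inside the given algebraically closed field ([number_ring_embedding]). *)

(** * Certificates for equalities *)

Section Certificates.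
Variable R : nzRingType.
Implicit Types x y c e : R.

(** Polynomial consequences of relations e = 0 are proved by exhibiting multipliers, after
    which only a polynomial identity remains. *)
Lemma eq_lin c e x y : e = 0 -> x - y = c * e -> x = y.
Proof. by move=> ->; rewrite mulr0 => /subr0_eq. Qed.

Lemma eq_lin2 c1 c2 e1 e2 x y : e1 = 0 -> e2 = 0 -> x - y = c1 * e1 + c2 * e2 -> x = y.
Proof. by move=> -> ->; rewrite !mulr0 addr0 => /subr0_eq. Qed.

Lemma eq_lin3 c1 c2 c3 e1 e2 e3 x y : e1 = 0 -> e2 = 0 -> e3 = 0 ->
  x - y = c1 * e1 + c2 * e2 + c3 * e3 -> x = y.
Proof. by move=> -> -> ->; rewrite !mulr0 !addr0 => /subr0_eq. Qed.

Lemma subr_eq0_of x y : x = y -> x - y = 0.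
Proof. by move=> ->; rewrite subrr. Qed.

Lemma eq_of_eq x y x' y' : x' = y' -> x - y = y' - x' -> x = y.
Proof. by move=> ->; rewrite subrr => /subr0_eq. Qed.

Lemma eq_mod_nat n x y c : n%:R = 0 :> R -> x = y + n%:R * c -> x = y.
Proof. by move=> -> ->; rewrite mul0r addr0. Qed.

End Certificates.

(** * Binary forms and linear substitutions *)

(** A form of degree i in two variables is represented by its dehomogenization, a polynomial
    of degree at most i. *)
Definition degle (R : nzRingType) (i : nat) : {pred {poly R}} :=
  fun p => (size p <= i.+1)%N.

Lemma degleE (R : nzRingType) i (p : {poly R}) : (p \in degle i) = (size p <= i.+1)%N.
Proof. by []. Qed.

Section Forms.
Variable R : comNzRingType.
Implicit Types p q u v : {poly R}.

Lemma degleD i p q : p \in degle i -> q \in degle i -> p + q \in degle i.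
Proof.
rewrite !degleE => hp hq; apply: leq_trans (size_polyD _ _) _.
by rewrite geq_max; apply/andP.
Qed.

Lemma degleN i p : p \in degle i -> - p \in degle i.
Proof. by rewrite !degleE size_polyN. Qed.

Lemma degleB i p q : p \in degle i -> q \in degle i -> p - q \in degle i.
Proof. by move=> hp /degleN; apply: degleD. Qed.

Lemma degleM i j p q :
  p \in degle i -> q \in degle j -> p * q \in degle (i + j).
Proof.
rewrite !degleE => hp hq; apply: leq_trans (size_polyMleq _ _) _.
by rewrite -subn1 leq_subLR add1n (leq_trans (leq_add hp hq)) // addSn addnS.
Qed.

Lemma degleMn i n p : p \in degle i -> n%:R * p \in degle i.
Proof.
move=> hp; elim: n => [|n IH]; first by rewrite mul0r degleE size_poly0.
by rewrite mulrS mulrDl mul1r degleD.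
Qed.

Lemma degleX i n p : p \in degle i -> p ^+ n \in degle (i * n).
Proof.
move=> hp; elim: n => [|n IH]; first by rewrite muln0 degleE size_poly1.
by rewrite exprS mulnS degleM.
Qed.

Lemma degleZ i c p : p \in degle i -> c *: p \in degle i.
Proof. by rewrite !degleE; apply: leq_trans (size_scale_leq _ _). Qed.

(** The value at (u : v) of the form of degree i that p represents. *)
Definition homog (i : nat) (p u v : {poly R}) : {poly R} :=
  \sum_(j < i.+1) p`_j *: (u ^+ j * v ^+ (i - j)).

Lemma homog_is_linear i u v : linear (fun p => homog i p u v).
Proof.
move=> c p q; rewrite /homog scaler_sumr -big_split /=.
by apply: eq_bigr => j _; rewrite coefD coefZ scalerDl scalerA.
Qed.

Lemma homogD i p q u v : homog i (p + q) u v = homog i p u v + homog i q u v.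
Proof. by have := homog_is_linear i u v 1 p q; rewrite !scale1r. Qed.

Lemma homog0 i u v : homog i 0 u v = 0.
Proof. by rewrite /homog big1 // => j _; rewrite coef0 scale0r. Qed.

Lemma homogZ i c p u v : homog i (c *: p) u v = c *: homog i p u v.
Proof. by have := homog_is_linear i u v c p 0; rewrite !addr0 homog0 addr0. Qed.

Lemma homogN i p u v : homog i (- p) u v = - homog i p u v.
Proof. by rewrite -scaleN1r homogZ scaleN1r. Qed.

Lemma homogB i p q u v : homog i (p - q) u v = homog i p u v - homog i q u v.
Proof. by rewrite homogD homogN. Qed.

Lemma homogMn i n p u v : homog i (n%:R * p) u v = n%:R * homog i p u v.
Proof. by rewrite -!scaler_nat !mulr_algl homogZ. Qed.

Lemma homog_sum i (I : finType) (F : I -> {poly R}) u v :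
  homog i (\sum_j F j) u v = \sum_j homog i (F j) u v.
Proof.
by elim/big_rec2: _ => [|j x y _ <-]; rewrite ?homog0 ?homogD.
Qed.

Lemma homogXn i j u v : (j <= i)%N -> homog i 'X^j u v = u ^+ j * v ^+ (i - j).
Proof.
move=> le_ji; rewrite /homog (bigD1 (Ordinal (le_ji : (j < i.+1)%N))) //=.
rewrite coefXn eqxx scale1r big1 ?addr0 // => m; rewrite -val_eqE /= => ne.
by rewrite coefXn (negPf ne) scale0r.
Qed.

Lemma degle_sum i p : p \in degle i -> p = \sum_(j < i.+1) p`_j *: 'X^j.
Proof.
move=> hp; apply/polyP=> m; rewrite coef_sum.
have [lt_mi | le_im] := ltnP m i.+1.
  rewrite (bigD1 (Ordinal lt_mi)) //= coefZ coefXn eqxx mulr1 big1 ?addr0 //.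
  by move=> l; rewrite -val_eqE /= => ne; rewrite coefZ coefXn eq_sym (negPf ne) mulr0.
rewrite nth_default ?(leq_trans hp) // big1 // => l _.
by rewrite coefZ coefXn gtn_eqF ?mulr0 // (leq_trans (ltn_ord l)).
Qed.

Lemma homogM i j p q u v : p \in degle i -> q \in degle j ->
  homog (i + j) (p * q) u v = homog i p u v * homog j q u v.
Proof.
move=> hp hq; rewrite {1}(degle_sum hp) {1}(degle_sum hq) mulr_suml homog_sum.
rewrite [homog i p u v]/homog mulr_suml; apply: eq_bigr => a _.
rewrite mulr_sumr homog_sum /homog mulr_sumr; apply: eq_bigr => b _.
rewrite -!scalerAl -!scalerAr -/(homog (i + j) _ u v) homogZ homogZ -exprD homogXn; last first.
  by rewrite leq_add -1?ltnS ?ltn_ord.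
congr (_ *: (_ *: _)).
have -> : (i + j - (a + b) = (i - a) + (j - b))%N.
  by rewrite subnDA -addnBAC -?addnBA // -ltnS.
by rewrite !exprD; ring.
Qed.

Lemma homogX i n p u v : p \in degle i ->
  homog (i * n) (p ^+ n) u v = homog i p u v ^+ n.
Proof.
move=> hp; elim: n => [|n IH]; first by rewrite muln0 (homogXn (j := 0)) // mul1r.
by rewrite mulnS exprS homogM ?degleX // IH exprS.
Qed.

Lemma degle_homog i p u v : u \in degle 1 -> v \in degle 1 -> homog i p u v \in degle i.
Proof.
move=> hu hv; rewrite /homog; elim/big_ind: _ => [|x y|j _].
- by rewrite degleE size_poly0.
- exact: degleD.
apply: degleZ; have le_ji: (j <= i)%N by rewrite -ltnS.
by have := degleM (degleX j hu) (degleX (i - j) hv); rewrite !mul1n subnKC.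
Qed.

Definition lin (a b : R) : {poly R} := a *: 'X + b%:P.

Lemma degle_lin a b : lin a b \in degle 1.
Proof.
rewrite /lin degleD ?degleZ //; first by rewrite degleE size_polyX.
by rewrite degleE (leq_trans (size_polyC_leq1 _)).
Qed.

Lemma homog_lin a b u v : homog 1 (lin a b) u v = a *: u + b *: v.
Proof.
rewrite /lin homogD homogZ -(expr1 'X) homogXn // -[b%:P]alg_polyC homogZ.
by rewrite -(expr0 'X) homogXn // !expr1 mulr1 mul1r.
Qed.

Lemma homog_comp i p a b c d u v :
  homog i (homog i p (lin a b) (lin c d)) u v = homog i p (a *: u + b *: v) (c *: u + d *: v).
Proof.
rewrite {2}/homog homog_sum /homog -/(homog _ _ _ _); apply: eq_bigr => j _.
rewrite -/(homog i _ u v) homogZ; congr (_ *: _); have le_ji: (j <= i)%N by rewrite -ltnS.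
have -> : homog i (lin a b ^+ j * lin c d ^+ (i - j)) u v =
  homog (1 * j + 1 * (i - j)) (lin a b ^+ j * lin c d ^+ (i - j)) u v.
  by rewrite !mul1n subnKC.
by rewrite homogM ?degleX ?degle_lin // !homogX ?degle_lin // !homog_lin.
Qed.

Lemma homog_scale i p c u v : homog i p (c *: u) (c *: v) = c ^+ i *: homog i p u v.
Proof.
rewrite /homog scaler_sumr; apply: eq_bigr => j _.
rewrite !exprZn -scalerAl -scalerAr !scalerA; congr (_ *: _).
by rewrite -mulrA -exprD subnKC -1?ltnS // mulrC.
Qed.

Lemma homog_affine i p u : p \in degle i -> homog i p u 1 = p \Po u.
Proof.
move=> hp; rewrite /homog {2}(degle_sum hp) [in RHS]linear_sum.
by apply: eq_bigr => j _; rewrite expr1n mulr1 /= comp_polyZ comp_Xn_poly.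
Qed.

End Forms.

(** * Changes of coordinates and invariants *)

Section Change.
Variable A : comNzRingType.
Implicit Types W : weierstrass A.

(** An admissible change of coordinates from W to W' says that the shift of W is the rescaling
    of W'; the invariants ignore shifts and are homogeneous under rescaling. *)
Definition rescale (u : A) W :=
  Weierstrass (u * a1 W) (u ^+ 2 * a2 W) (u ^+ 3 * a3 W) (u ^+ 4 * a4 W) (u ^+ 6 * a6 W).

Definition shift (r s w : A) W :=
  Weierstrass (a1 W + 2%:R * s) (a2 W - s * a1 W + 3%:R * r - s ^+ 2)
    (a3 W + r * a1 W + 2%:R * w)
    (a4 W - s * a3 W + 2%:R * r * a2 W - (w + r * s) * a1 W + 3%:R * r ^+ 2 - 2%:R * s * w)
    (a6 W + r * a4 W + r ^+ 2 * a2 W + r ^+ 3 - w * a3 W - w ^+ 2 - r * w * a1 W).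

Lemma admissible_changeP u r s w W W' :
  admissible_change u r s w W W' <-> rescale u W' = shift r s w W.
Proof.
split=> [[e1 e2 e3 e4 e6]|[e1 e2 e3 e4 e6]]; last by split.
by rewrite /rescale /shift e1 e2 e3 e4 e6.
Qed.

Lemma c4_rescale u W : c4 (rescale u W) = u ^+ 4 * c4 W.
Proof. by rewrite /c4 /b2 /b4 /=; ring. Qed.
Lemma c6_rescale u W : c6 (rescale u W) = u ^+ 6 * c6 W.
Proof. by rewrite /c6 /b2 /b4 /b6 /=; ring. Qed.
Lemma disc_rescale u W : disc (rescale u W) = u ^+ 12 * disc W.
Proof. by rewrite /disc /b8 /b2 /b4 /b6 /=; ring. Qed.
Lemma c4_shift r s w W : c4 (shift r s w W) = c4 W.
Proof. by rewrite /c4 /b2 /b4 /=; ring. Qed.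
Lemma c6_shift r s w W : c6 (shift r s w W) = c6 W.
Proof. by rewrite /c6 /b2 /b4 /b6 /=; ring. Qed.
Lemma disc_shift r s w W : disc (shift r s w W) = disc W.
Proof. by rewrite /disc /b8 /b2 /b4 /b6 /=; ring. Qed.

Lemma c4_c6_disc W : c4 W ^+ 3 - c6 W ^+ 2 = (12%:R ^+ 3) * disc W.
Proof. by rewrite /disc /c4 /c6 /b8 /b2 /b4 /b6 /=; ring. Qed.

End Change.

Lemma map_disc (A B : comNzRingType) (f : {rmorphism A -> B}) W :
  disc (map_weierstrass f W) = f (disc W).
Proof. by rewrite /disc /b2 /b4 /b6 /b8 /=; ring. Qed.
Lemma map_c4 (A B : comNzRingType) (f : {rmorphism A -> B}) W :
  c4 (map_weierstrass f W) = f (c4 W).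
Proof. by rewrite /c4 /b2 /b4 /=; ring. Qed.
Lemma map_c6 (A B : comNzRingType) (f : {rmorphism A -> B}) W :
  c6 (map_weierstrass f W) = f (c6 W).
Proof. by rewrite /c6 /b2 /b4 /b6 /=; ring. Qed.

Section FormInvariants.
Variable R : comNzRingType.
Implicit Types W : weierstrass {poly R}.

Lemma has_degreesP W : has_degrees W <->
  [/\ a1 W \in degle 1, a2 W \in degle 2, a3 W \in degle 3, a4 W \in degle 4 & a6 W \in degle 6].
Proof. by []. Qed.

(** The invariants of an equation are forms, so that they commute with the substitution of
    polynomials for the two variables. *)
Definition homog_weierstrass W u v : weierstrass {poly R} :=
  Weierstrass (homog 1 (a1 W) u v) (homog 2 (a2 W) u v) (homog 3 (a3 W) u v)
    (homog 4 (a4 W) u v) (homog 6 (a6 W) u v).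

Section Degrees.
Variables (W : weierstrass {poly R}) (dW : has_degrees W).

Let f1 : a1 W \in degle 1. Proof. by case: dW. Qed.
Let f2 : a2 W \in degle 2. Proof. by case: dW. Qed.
Let f3 : a3 W \in degle 3. Proof. by case: dW. Qed.
Let f4 : a4 W \in degle 4. Proof. by case: dW. Qed.
Let f6 : a6 W \in degle 6. Proof. by case: dW. Qed.

Lemma degle_b2 : b2 W \in degle 2.
Proof. by rewrite degleD ?degleMn ?(degleX 2 f1). Qed.
Lemma degle_b4 : b4 W \in degle 4.
Proof. by rewrite degleD ?degleMn ?(degleM f1 f3). Qed.
Lemma degle_b6 : b6 W \in degle 6.
Proof. by rewrite degleD ?degleMn ?(degleX 2 f3). Qed.
Lemma degle_b8 : b8 W \in degle 8.
Proof.
exact: degleB (degleD (degleD (degleB (degleM (degleX 2 f1) f6) (degleM (degleM f1 f3) f4))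
  (degleM (degleMn 4 f2) f6)) (degleM f2 (degleX 2 f3))) (degleX 2 f4).
Qed.
Lemma degle_c4 : c4 W \in degle 4.
Proof. by rewrite degleB ?degleMn ?degle_b4 ?(degleX 2 degle_b2). Qed.
Lemma degle_c6 : c6 W \in degle 6.
Proof.
exact: degleB (degleD (degleN (degleX 3 degle_b2))
  (degleM (degleMn 36 degle_b2) degle_b4)) (degleMn 216 degle_b6).
Qed.
Lemma degle_disc : disc W \in degle 12.
Proof.
exact: degleD (degleB (degleB (degleM (degleN (degleX 2 degle_b2)) degle_b8)
  (degleMn 8 (degleX 3 degle_b4))) (degleMn 27 (degleX 2 degle_b6)))
  (degleM (degleM (degleMn 9 degle_b2) degle_b4) degle_b6).
Qed.

Lemma homog_b2 u v : b2 (homog_weierstrass W u v) = homog 2 (b2 W) u v.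
Proof.
by rewrite /b2 /= homogD homogMn -(homogX 2 _ _ f1).
Qed.
Lemma homog_b4 u v : b4 (homog_weierstrass W u v) = homog 4 (b4 W) u v.
Proof.
by rewrite /b4 /= homogD homogMn -(homogM _ _ f1 f3).
Qed.
Lemma homog_b6 u v : b6 (homog_weierstrass W u v) = homog 6 (b6 W) u v.
Proof.
by rewrite /b6 /= homogD homogMn -(homogX 2 _ _ f3).
Qed.
Lemma homog_b8 u v : b8 (homog_weierstrass W u v) = homog 8 (b8 W) u v.
Proof.
rewrite /b8 !(homogB, homogD).
rewrite [homog 8 (a1 W ^+ 2 * _) _ _](homogM _ _ (degleX 2 f1) f6) (homogX 2 _ _ f1).
rewrite [homog 8 (a1 W * _ * _) _ _](homogM _ _ (degleM f1 f3) f4) (homogM _ _ f1 f3).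
rewrite [homog 8 (4%:R * _ * _) _ _](homogM _ _ (degleMn 4 f2) f6) homogMn.
rewrite [homog 8 (a2 W * _) _ _](homogM _ _ f2 (degleX 2 f3)) (homogX 2 _ _ f3).
by rewrite [homog 8 _ _ _](homogX 2 _ _ f4).
Qed.
Lemma homog_c4 u v : c4 (homog_weierstrass W u v) = homog 4 (c4 W) u v.
Proof.
by rewrite /c4 homogB homogMn [homog 4 (_ ^+ 2) _ _](homogX 2 _ _ degle_b2) homog_b2 homog_b4.
Qed.
Lemma homog_c6 u v : c6 (homog_weierstrass W u v) = homog 6 (c6 W) u v.
Proof.
rewrite /c6 homog_b2 homog_b4 homog_b6.
move: (b2 W) (b4 W) (b6 W) degle_b2 degle_b4 degle_b6 => x2 x4 x6 g2 g4 g6.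
rewrite !(homogB, homogD, homogN, homogMn) [homog 6 (_ ^+ 3) _ _](homogX 3 _ _ g2).
by rewrite [homog 6 (_ * _) _ _](homogM _ _ (degleMn 36 g2) g4) homogMn.
Qed.
Lemma homog_disc u v : disc (homog_weierstrass W u v) = homog 12 (disc W) u v.
Proof.
rewrite /disc homog_b2 homog_b4 homog_b6 homog_b8.
move: (b2 W) (b4 W) (b6 W) (b8 W) degle_b2 degle_b4 degle_b6 degle_b8.
move=> x2 x4 x6 x8 g2 g4 g6 g8; rewrite !(mulNr, homogB, homogD, homogN, homogMn).
rewrite [homog 12 (x2 ^+ 2 * _) _ _](homogM _ _ (degleX 2 g2) g8) (homogX 2 _ _ g2).
rewrite [homog 12 (_ * x6) _ _](homogM _ _ (degleM (degleMn 9 g2) g4) g6).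
rewrite (homogM _ _ (degleMn 9 g2) g4) homogMn.
by rewrite [homog 12 (x6 ^+ 2) _ _](homogX 2 _ _ g6) [homog 12 (x4 ^+ 3) _ _](homogX 3 _ _ g4).
Qed.

Lemma has_degrees_homog u v : u \in degle 1 -> v \in degle 1 -> has_degrees (homog_weierstrass W u v).
Proof. by move=> hu hv; split; apply: degle_homog. Qed.
End Degrees.
End FormInvariants.

(** * Recovering an equation from its invariants *)

Section Isomorphism.
Variable k : fieldType.
Implicit Types W S : weierstrass {poly k}.
Hypotheses (nz2 : 2%:R != 0 :> k) (nz3 : 3%:R != 0 :> k).

Lemma pullbackE a b c d W : pullback a b c d W = homog_weierstrass W (lin a b) (lin c d).
Proof. by []. Qed.

Let nzC (x : k) (p q : {poly k}) : x != 0 -> x%:P * p = x%:P * q -> p = q.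
Proof. by move=> nz /mulfI; apply; rewrite polyC_eq0. Qed.

Lemma polyC_nat (n : nat) : (n%:R : k)%:P = n%:R.
Proof. by rewrite rmorph_nat. Qed.

(** As 2 and 3 are invertible, s, r and w can be chosen in turn so as to match a1, a2 and a3;
    equality of c4 and c6 then matches a4 and a6, which occur in them with the coefficients
    -48 and -864. *)
Lemma admissible_of_invariants (u : k) W W' :
  has_degrees W -> has_degrees W' ->
  u ^+ 4 *: c4 W' = c4 W -> u ^+ 6 *: c6 W' = c6 W ->
  exists r s w : {poly k}, [/\ (size r <= 3)%N, (size s <= 2)%N & (size w <= 4)%N] /\
    admissible_change u%:P r s w W W'.
Proof.
move=> dW dW' e4 e6; have [f1 f2 f3 f4 f6] := dW; have [g1 g2 g3 g4 g6] := dW'.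
pose s := 2%:R^-1 *: (u *: a1 W' - a1 W).
have fs : s \in degle 1 by rewrite degleZ ?degleB ?degleZ.
pose r := 3%:R^-1 *: (u ^+ 2 *: a2 W' - a2 W + s * a1 W + s ^+ 2).
have fr : r \in degle 2.
  by rewrite degleZ ?degleD ?degleN ?degleZ ?(degleM fs f1) ?(degleX 2 fs).
pose w := 2%:R^-1 *: (u ^+ 3 *: a3 W' - a3 W - r * a1 W).
have fw : w \in degle 3 by rewrite degleZ ?degleB ?degleZ ?(degleM fr f1).
exists r, s, w; split=> //; apply/admissible_changeP.
have es : 2%:R * s = u%:P * a1 W' - a1 W.
  by rewrite mulr_natl -scaler_nat scalerA divff // scale1r mul_polyC.
have er : 3%:R * r = u%:P ^+ 2 * a2 W' - a2 W + s * a1 W + s ^+ 2.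
  by rewrite mulr_natl -scaler_nat scalerA divff // scale1r -rmorphXn mul_polyC.
have ew : 2%:R * w = u%:P ^+ 3 * a3 W' - a3 W - r * a1 W.
  by rewrite mulr_natl -scaler_nat scalerA divff // scale1r -rmorphXn mul_polyC.
have {}e4 : c4 (rescale u%:P W') = c4 (shift r s w W).
  by rewrite c4_rescale c4_shift -e4 -rmorphXn mul_polyC.
have {}e6 : c6 (rescale u%:P W') = c6 (shift r s w W).
  by rewrite c6_rescale c6_shift -e6 -rmorphXn mul_polyC.
have E1 : a1 (rescale u%:P W') = a1 (shift r s w W) by rewrite /= es; ring.
have E2 : a2 (rescale u%:P W') = a2 (shift r s w W) by rewrite /= er; ring.
have E3 : a3 (rescale u%:P W') = a3 (shift r s w W) by rewrite /= ew; ring.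
move: (rescale _ _) (shift _ _ _ _) e4 e6 E1 E2 E3.
case=> x1 x2 x3 x4 x6 [y1 y2 y3 y4 y6] /=; rewrite /c4 /c6 /b2 /b4 /b6 /=.
move=> + + e1 e2 e3; rewrite {}e1 {}e2 {}e3 => e4 e6.
have nz48 : 48%:R != 0 :> k.
  by rewrite (_ : 48 = 2 * 2 * 2 * 2 * 3)%N // !natrM !mulf_neq0.
have nz864 : 864%:R != 0 :> k.
  by rewrite (_ : 864 = 2 * 2 * 2 * 2 * 2 * 3 * 3 * 3)%N // !natrM !mulf_neq0.
have E4 : x4 = y4.
  apply: (nzC nz48); rewrite !polyC_nat; apply/eqP; rewrite -subr_eq0; apply/eqP.
  move/eqP: e4; rewrite -subr_eq0 => /eqP e4; rewrite -oppr0 -e4; ring.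
rewrite {}E4 in e6 *; congr Weierstrass.
apply: (nzC nz864); rewrite !polyC_nat; apply/eqP; rewrite -subr_eq0; apply/eqP.
by move/eqP: e6; rewrite -subr_eq0 => /eqP e6; rewrite -oppr0 -e6; ring.
Qed.

Lemma homog_id i (p : {poly k}) : p \in degle i -> homog i p (lin 1 0) (lin 0 1) = p.
Proof.
move=> hp; rewrite /lin scale1r scale0r polyC0 addr0 add0r polyC1.
by rewrite homog_affine // comp_polyXr.
Qed.

Lemma lin_lin (x y a b c d : k) :
  x *: lin a b + y *: lin c d = lin (x * a + y * c) (x * b + y * d).
Proof.
rewrite /lin -!mul_polyC !(rmorphD, rmorphM) /=; ring.
Qed.

(** The adjugate matrix inverts a linear substitution up to the determinant. *)
Lemma homog_adj i (p : {poly k}) a b c d : p \in degle i ->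
  homog i (homog i p (lin a b) (lin c d)) (lin d (- b)) (lin (- c) a)
  = (a * d - b * c) ^+ i *: p.
Proof.
move=> hp; rewrite homog_comp !lin_lin -[p in RHS](homog_id hp) -homog_scale.
by congr (homog i p _ _); rewrite /lin -!mul_polyC !(rmorphD, rmorphM, rmorphB, rmorphN) /=; ring.
Qed.

(** Equivalence of pairs (c4, c6) under substitutions and scalings. The exponents 2 and 3,
    instead of 4 and 6, allow for quadratic twists by constants, which are trivial over an
    algebraically closed field. *)
Definition equivalent_invariants (A B A' B' : {poly k}) : Prop :=
  exists a b c d lam : k, [/\ a * d - b * c != 0, lam != 0,
    homog 4 A (lin a b) (lin c d) = lam ^+ 2 *: A' &
    homog 6 B (lin a b) (lin c d) = lam ^+ 3 *: B'].

End Isomorphism.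

Lemma closed_root (k : closedFieldType) (n : nat) (x : k) :
  (0 < n)%N -> exists y, y ^+ n = x.
Proof.
move=> n_gt0; have /closed_rootP[y] : size ('X^n - x%:P) != 1.
  by rewrite size_XnsubC // eqSS -lt0n.
by rewrite /root !hornerE subr_eq0 => /eqP; exists y.
Qed.

(** With D the determinant and v^2 = lam, the adjugate substitution multiplies c4 and c6 by
    (D / v)^4 and (D / v)^6, so that an admissible change with u = D / v exists. *)
Lemma isomorphic_of_invariants (k : closedFieldType) (W S : weierstrass {poly k}) :
  2%:R != 0 :> k -> 3%:R != 0 :> k ->
  has_degrees W -> has_degrees S ->
  equivalent_invariants (c4 S) (c6 S) (c4 W) (c6 W) -> isomorphic W S.
Proof.
move=> nz2 nz3 dW dS [a [b [c [d [lam [nzd nzl E4 E6]]]]]].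
have [v Dv] := closed_root lam (isT : 0 < 2)%N.
pose D := a * d - b * c.
have nzv : v != 0 by apply: contraNneq nzl => v0; rewrite -Dv v0 expr0n.
exists d, (- b), (- c), a, (D / v).
have dP : has_degrees (pullback d (- b) (- c) a W).
  by apply: has_degrees_homog; rewrite ?degle_lin.
have [|| r [s [w [szs adm]]]] :=
  @admissible_of_invariants k nz2 nz3 (D / v) (pullback d (- b) (- c) a W) S dP dS.
- rewrite pullbackE homog_c4 //; have := homog_adj a b c d (degle_c4 dS).
  rewrite E4 homogZ -/D => /(congr1 (fun q => (lam ^+ 2)^-1 *: q)).
  rewrite scalerA mulVf ?expf_neq0 // scale1r scalerA => ->.
  by rewrite -Dv -exprM mulrC -exprVn -exprMn.
- rewrite pullbackE homog_c6 //; have := homog_adj a b c d (degle_c6 dS).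
  rewrite E6 homogZ -/D => /(congr1 (fun q => (lam ^+ 3)^-1 *: q)).
  rewrite scalerA mulVf ?expf_neq0 // scale1r scalerA => ->.
  by rewrite -Dv -exprM mulrC -exprVn -exprMn.
exists r, s, w; split=> //.
  by rewrite mulrNN mulrC.
by rewrite mulf_neq0 ?invr_eq0.
Qed.

(** * Orders of vanishing under projectivities *)

Section Points.
Variable k : fieldType.
Implicit Types (p q : {poly k}) (W : weierstrass {poly k}) (P : option k).

Lemma dvdp_comp p q r : p %| q -> p \Po r %| q \Po r.
Proof. by case/dvdpP=> t ->; rewrite comp_polyM dvdp_mull. Qed.

(** Orders at a point c are read off at the origin after a translation. *)
Lemma ord_ge_translate (c : k) n p : ord_ge c n p = ('X^n %| p \Po ('X + c%:P)).
Proof.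
apply/idP/idP=> /dvdp_comp.
  by move/(_ ('X + c%:P)); rewrite rmorphXn /= comp_polyB comp_polyX comp_polyC addrK.
move/(_ ('X - c%:P)); rewrite rmorphXn /= comp_polyX -comp_polyA.
by rewrite comp_polyD comp_polyX comp_polyC subrK comp_polyXr.
Qed.

Lemma dvdXnP n p : reflect (forall j, (j < n)%N -> p`_j = 0) ('X^n %| p).
Proof.
apply: (iffP idP) => [/dvdpP[q ->] j lt_jn|e0]; first by rewrite coefMXn lt_jn.
rewrite -(poly_take_drop n p) [take_poly n p](_ : _ = 0) ?add0r ?dvdp_mull //.
by apply/polyP=> j; rewrite coef_take_poly coef0; case: ifP => // /e0.
Qed.

Definition chart_form P i p := if P is Some _ then p else homog i p (lin 0 1) (lin 1 0).

Lemma ord_ge_chart P n i p : p \in degle i ->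
  ord_ge (coord P) n (chart_form P i p) =
  ('X^n %| if P is Some t then homog i p (lin 1 t) (lin 0 1) else homog i p (lin 0 1) (lin 1 0)).
Proof.
case: P => [t|] hp; rewrite ord_ge_translate /=.
  by rewrite {2}/lin scale0r add0r polyC1 homog_affine // /lin scale1r.
by rewrite addr0 comp_polyXr.
Qed.

(** Lower triangular matrices fix the origin, hence do not lower orders of vanishing there. *)
Lemma dvdXn_lower_sub n i p (l1 l2 l3 : k) : p \in degle i ->
  'X^n %| p -> 'X^n %| homog i p (lin l1 0) (lin l2 l3).
Proof.
rewrite degleE => hp /dvdpP[q Dp]; have [->|nzp] := eqVneq p 0.
  by rewrite homog0 dvdp0.
have nzq : q != 0 by apply: contraNneq nzp => q0; rewrite Dp q0 mul0r.
have szp : size p = (size q + n)%N by rewrite Dp size_mulXn // addnC.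
have szq : (0 < size q)%N by rewrite size_poly_gt0.
have le_ni : (n <= i)%N by rewrite -ltnS (leq_trans _ hp) // szp -[n.+1]add1n leq_add2r.
have hq : q \in degle (i - n).
  by rewrite degleE -subSn // leq_subRL 1?addnC -?szp // ltnW.
rewrite Dp -{1}(subnK le_ni) homogM //; last by rewrite degleE size_polyXn.
rewrite dvdp_mull // homogXn // subnn expr0 mulr1 /lin polyC0 addr0 exprZn.
by rewrite -mul_polyC dvdp_mull.
Qed.

Lemma dvdXn_lower n i p (l1 l2 l3 : k) : p \in degle i -> l1 != 0 -> l3 != 0 ->
  ('X^n %| homog i p (lin l1 0) (lin l2 l3)) = ('X^n %| p).
Proof.
move=> hp nz1 nz3; apply/idP/idP; last exact: dvdXn_lower_sub.
move/(dvdXn_lower_sub l3 (- l2) l1 (degle_homog i p (degle_lin l1 0) (degle_lin l2 l3))).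
have -> : lin l3 0 = lin l3 (- 0) by rewrite oppr0.
rewrite homog_adj // mul0r subr0 dvdpZr //.
by rewrite expf_neq0 // mulf_neq0.
Qed.

(** The action of a matrix on the points of the line, infinity being [None]. *)
Definition act (a b c d : k) P : option k :=
  let: (x, y) := if P is Some t then (a * t + b, c * t + d) else (a, c) in
  if y == 0 then None else Some (x / y).

(** The order of a form at a point is the order at the origin of its pull-back by any matrix
    sending the origin to that point, since two such matrices differ by a lower triangular one. *)
Lemma ord_ge_act (a b c d : k) P n i p : p \in degle i -> a * d - b * c != 0 ->
  ord_ge (coord P) n (chart_form P i (homog i p (lin a b) (lin c d))) =
  ord_ge (coord (act a b c d P)) n (chart_form (act a b c d P) i p).
Proof.
move=> hp nzd; rewrite !ord_ge_chart ?degle_homog ?degle_lin //.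
have main x1 x2 y1 y2 : x1 * y2 - x2 * y1 != 0 ->
  ('X^n %| homog i p (lin x1 x2) (lin y1 y2)) =
  ('X^n %| if (if y2 == 0 then None else Some (x2 / y2)) is Some t
           then homog i p (lin 1 t) (lin 0 1) else homog i p (lin 0 1) (lin 1 0)).
  case: (eqVneq y2 0) => [-> | nzy] nz.
    rewrite -[RHS](@dvdXn_lower n i _ y1 x1 x2) ?degle_homog ?degle_lin //.
    - by rewrite homog_comp !lin_lin !mul1r !mul0r !addr0 !add0r.
    - by apply: contraNneq nz => ->; rewrite !mulr0 subr0.
    - by apply: contraNneq nz => ->; rewrite mulr0 mul0r subr0.
  rewrite -[RHS](@dvdXn_lower n i _ (x1 - x2 / y2 * y1) y1 y2) ?degle_homog ?degle_lin //.
    rewrite homog_comp !lin_lin !mul1r !mul0r !add0r subrK.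
    by rewrite -mulrA mulVf // mulr1.
  apply: contraNneq nz => e0; have -> : x1 * y2 - x2 * y1 = y2 * (x1 - x2 / y2 * y1) by field.
  by rewrite e0 mulr0.
case: P => [t|]; rewrite /act homog_comp !lin_lin ?mulr0 ?mulr1 ?add0r ?addr0;
  rewrite main //.
- by rewrite (_ : _ - _ = a * d - b * c) //; ring.
- by rewrite -oppr_eq0 (_ : - _ = a * d - b * c) //; ring.
Qed.

Lemma c4_chart P W : has_degrees W -> c4 (chart P W) = chart_form P 4 (c4 W).
Proof. by case: P => [t|] dW //=; rewrite pullbackE homog_c4. Qed.
Lemma c6_chart P W : has_degrees W -> c6 (chart P W) = chart_form P 6 (c6 W).
Proof. by case: P => [t|] dW //=; rewrite pullbackE homog_c6. Qed.
Lemma disc_chart P W : has_degrees W -> disc (chart P W) = chart_form P 12 (disc W).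
Proof. by case: P => [t|] dW //=; rewrite pullbackE homog_disc. Qed.

Lemma kodaira_at_act (a b c d : k) P T W : has_degrees W -> a * d - b * c != 0 ->
  kodaira_at (pullback a b c d W) P T = kodaira_at W (act a b c d P) T.
Proof.
move=> dW nzd; rewrite /kodaira_at; set W' := pullback _ _ _ _ _; set Q := act _ _ _ _ _.
have dW' : has_degrees W' by apply: has_degrees_homog; apply: degle_lin.
have e4 n : ord_ge (coord P) n (c4 (chart P W')) = ord_ge (coord Q) n (c4 (chart Q W)).
  by rewrite !c4_chart // {1}/W' pullbackE homog_c4 // ord_ge_act // degle_c4.
have e6 n : ord_ge (coord P) n (c6 (chart P W')) = ord_ge (coord Q) n (c6 (chart Q W)).
  by rewrite !c6_chart // {1}/W' pullbackE homog_c6 // ord_ge_act // degle_c6.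
have eD n : ord_ge (coord P) n (disc (chart P W')) = ord_ge (coord Q) n (disc (chart Q W)).
  by rewrite !disc_chart // {1}/W' pullbackE homog_disc // ord_ge_act // degle_disc.
rewrite /kodaira_at_coord /ord_eq.
by case: T => [[|n]|||| [|n] |||]; rewrite ?e4 ?e6 ?eD.
Qed.

Lemma act_adj (a b c d : k) : a * d - b * c != 0 ->
  cancel (act a b c d) (act d (- b) (- c) a).
Proof.
move=> nz; case => [t|] /=; rewrite /act.
  have [e0|nz0] := eqVneq (c * t + d) 0.
    rewrite oppr_eq0; have nzc : c != 0.
      by apply: contraNneq nz => c0; move: e0; rewrite c0 mul0r add0r => ->; rewrite !mulr0 subrr.
    rewrite (negPf nzc); congr Some; move/eqP: e0; rewrite addr_eq0 => /eqP e0.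
    have -> : d = - (c * t) by rewrite e0 opprK.
    by rewrite invrN mulrNN mulrC mulKf.
  have D1 : - c * ((a * t + b) / (c * t + d)) + a = (a * d - b * c) / (c * t + d) by field.
  rewrite D1 mulf_eq0 invr_eq0 (negPf nz) (negPf nz0) /=; congr Some.
  by field; rewrite nz0.
have [c0|nzc] := eqVneq c 0; first by rewrite c0 oppr0 eqxx.
have -> : - c * (a / c) + a = 0 by field.
by rewrite eqxx.
Qed.

(** PGL_2 is doubly transitive on the line. *)
Lemma exists_projectivity P1 P2 : P1 != P2 -> exists a b c d, [/\ a * d - b * c != 0,
  act a b c d None = P1 & act a b c d (Some 0) = P2].
Proof.
case: P1 P2 => [t1|] [t2|] //.
- rewrite (inj_eq (@Some_inj _)) => ne; exists t1, t2, 1, 1.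
  have nz : t1 * 1 - t2 * 1 != 0 by rewrite !mulr1 subr_eq0.
  by split=> //; [rewrite /act oner_eq0 divr1 | rewrite /act mulr0 add0r oner_eq0 mulr0 add0r divr1].
- move=> _; exists t1, 1, 1, 0.
  have nz : t1 * 0 - 1 * 1 != 0 :> k by rewrite mulr0 mulr1 add0r oppr_eq0 oner_eq0.
  by split=> //; [rewrite /act oner_eq0 divr1 | rewrite /act mulr0 add0r eqxx].
- move=> _; exists 1, t2, 0, 1.
  have nz : 1 * 1 - t2 * 0 != 0 by rewrite mulr0 mulr1 subr0 oner_eq0.
  by split=> //; [rewrite /act eqxx | rewrite /act mulr0 add0r oner_eq0 mulr0 add0r divr1].
Qed.

(** The order at infinity of a form of degree i is i minus the degree of its
    dehomogenization. *)
Lemma ord_ge_oo n i p : p \in degle i -> (n <= i.+1)%N ->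
  ord_ge 0 n (homog i p (lin 0 1) (lin 1 0)) = (size p <= i.+1 - n)%N.
Proof.
move=> hp le_ni; rewrite /ord_ge subr0.
have E : homog i p (lin 0 1) (lin 1 0) = \poly_(j < i.+1) p`_(i - j).
  rewrite /lin scale0r scale1r add0r polyC0 addr0 polyC1 /homog poly_def.
  rewrite (reindex_inj rev_ord_inj) /=; apply: eq_bigr => j _.
  by rewrite expr1n mul1r subSS subKn // -ltnS.
rewrite {}E; apply/dvdXnP/idP=> [e0|szp j lt_jn]; last first.
  by rewrite coef_poly; case: ifP => // _; rewrite nth_default // (leq_trans szp) //; lia.
apply/leq_sizeP=> j le_j; have [lt_ij|le_ji] := ltnP i j.
  by rewrite nth_default // (leq_trans hp).
have := e0 (i - j)%N; rewrite coef_poly ltnS leq_subr subKn //; apply; lia.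
Qed.

End Points.

(** * Local rings of the line and minimality *)

Lemma fractionP (R : idomainType) (x : {fraction R}) :
  exists p q : R, q != 0 /\ x = tofrac p / tofrac q.
Proof.
elim/quotW: x => r; exists \n_r, \d_r; have nzd := denom_ratioP r.
split=> //; apply: (canRL (mulfK _)); first by rewrite tofrac_eq0.
change (FracField.mul (\pi_(FracField.type R)%qT r) (FracField.tofrac \d_r) = FracField.tofrac \n_r).
rewrite !piE; apply/eqmodP; rewrite /= FracField.equivfE /FracField.mulf.
by rewrite !numden_Ratio ?mulr1 ?oner_eq0 ?mulf_neq0 ?oner_eq0 // mulrC.
Qed.

Lemma mulf_div_expr (K : fieldType) (a b t : K) m n : t != 0 -> (n <= m)%N ->
  a * t ^+ m / (b * t ^+ n) = a * t ^+ (m - n) / b.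
Proof.
move=> nzt le_nm; rewrite -{1}(subnK le_nm) exprD mulrA -mulf_div.
by rewrite [t ^+ n / _]divff ?expf_neq0 // mulr1.
Qed.

Section LocalRing.
Variables (k : fieldType) (c : k).
Local Notation F := {fraction {poly k}}.
Local Notation tf := (@tofrac {poly k}).
Local Notation regular := (regular_at c).
Implicit Types (x y g h : F) (p q : {poly k}).

(** The local ring at c consists of the fractions that are [regular_at] c. *)
Definition uniformizer : F := tf ('X - c%:P).
Local Notation z := uniformizer.

Lemma uniformizer_neq0 : z != 0.
Proof. by rewrite tofrac_eq0 polyXsubC_eq0. Qed.

Lemma tofrac_unit q : q.[c] != 0 -> tf q != 0.
Proof. by rewrite tofrac_eq0; apply: contraNneq => ->; rewrite horner0. Qed.

Lemma regular_poly p : regular (tf p).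
Proof. by exists p, 1; rewrite hornerC oner_eq0 rmorph1 divr1. Qed.

Lemma regular0 : regular 0.
Proof. by rewrite -(rmorph0 tf); apply: regular_poly. Qed.

Lemma regular1 : regular 1.
Proof. by rewrite -(rmorph1 tf); apply: regular_poly. Qed.

Lemma regularD x y : regular x -> regular y -> regular (x + y).
Proof.
move=> [p [q [nq ->]]] [p' [q' [nq' ->]]]; exists (p * q' + p' * q), (q * q').
split; first by rewrite hornerM mulf_neq0.
by rewrite addf_div ?tofrac_unit // rmorphD !rmorphM.
Qed.

Lemma regularM x y : regular x -> regular y -> regular (x * y).
Proof.
move=> [p [q [nq ->]]] [p' [q' [nq' ->]]]; exists (p * p'), (q * q').
split; first by rewrite hornerM mulf_neq0.
by rewrite mulf_div !rmorphM.
Qed.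

Lemma regularN x : regular x -> regular (- x).
Proof. by move=> [p [q [nq ->]]]; exists (- p), q; rewrite rmorphN mulNr. Qed.

Lemma regularB x y : regular x -> regular y -> regular (x - y).
Proof. by move=> rx ry; apply: regularD (regularN ry). Qed.

Lemma regularX n x : regular x -> regular (x ^+ n).
Proof.
move=> rx; elim: n => [|n IH]; first exact: regular1.
by rewrite exprS; apply: regularM.
Qed.

Lemma regular_nat n : regular n%:R.
Proof. by rewrite -(rmorph_nat tf); apply: regular_poly. Qed.

Lemma regular_uniformizer : regular z.
Proof. exact: regular_poly. Qed.

Lemma uniformizer_nonunit g : regular g -> z * g != 1.
Proof.
move=> [p [q [nq ->]]]; apply/eqP => e1.
have: tf (('X - c%:P) * p) = tf q.
  by rewrite tofracM -[RHS]mul1r -e1 -mulrA mulfVK // tofrac_unit.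
move/eqP; rewrite tofrac_eq => /eqP e2; case/negP: nq.
by rewrite -e2 !hornerE subrr mul0r.
Qed.

(** The local ring is a valuation ring. *)
Lemma regular_or_inv x : regular x \/ exists2 g, regular g & x^-1 = z * g.
Proof.
have [->|nzx] := eqVneq x 0; first by left; apply: regular0.
have [p [q [nzq Dx]]] := fractionP x.
have nzp : p != 0 by apply: contraNneq nzx => p0; rewrite Dx p0 tofrac0 mul0r.
have [m [p1 np1 Dp]] := multiplicity_XsubC p c; have [n [q1 nq1 Dq]] := multiplicity_XsubC q c.
rewrite nzp nzq /= in np1 nq1.
have {}Dx : x = tf p1 * z ^+ m / (tf q1 * z ^+ n) by rewrite Dx Dp Dq !tofracM !tofracXn.
have [le_nm|lt_mn] := leqP n m.
  left; exists (p1 * ('X - c%:P) ^+ (m - n)), q1; split=> //.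
  by rewrite Dx (mulf_div_expr _ _ uniformizer_neq0 le_nm) tofracM tofracXn.
right; exists (tf (q1 * ('X - c%:P) ^+ (n - m.+1)) / tf p1).
  by exists (q1 * ('X - c%:P) ^+ (n - m.+1)), p1.
rewrite Dx invf_div (mulf_div_expr _ _ uniformizer_neq0 (ltnW lt_mn)).
by rewrite -(subnSK lt_mn) exprS tofracM tofracXn !mulrA [tf q1 * _]mulrC.
Qed.

(** A valuation ring is integrally closed: if x were not regular, dividing the equation by
    x^(n+1) would make 1 a multiple of the uniformizer. *)
Lemma regular_integral n x (a : nat -> F) :
  (forall i, regular (a i)) -> x ^+ n.+1 = \sum_(i < n.+1) a i * x ^+ i -> regular x.
Proof.
move=> ra Dx; have [->|nzx] := eqVneq x 0; first exact: regular0.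
have [//|[g rg Dg]] := regular_or_inv x.
pose h := \sum_(i < n.+1) a i * x^-1 ^+ (n - i).
have rh : regular h.
  apply: (big_ind regular) => [|y y'|i _]; [exact: regular0 | exact: regularD |].
  by rewrite Dg; apply/regularM/regularX/regularM => //; apply: regular_uniformizer.
case/negP: (uniformizer_nonunit (regularM rg rh)).
rewrite mulrA -Dg -(mulfV (expf_neq0 n.+1 nzx)) {1}Dx /h mulr_sumr mulr_suml.
apply/eqP/eq_bigr => i _; have le_in : (i <= n)%N by rewrite -ltnS.
rewrite mulrCA -mulrA -exprS; congr (_ * _); rewrite exprVn.
move: (i : nat) le_in => j le_jn; have -> : n.+1 = (j + (n - j).+1)%N by lia.
by rewrite exprD invfM mulrA divff ?mul1r ?expf_neq0.
Qed.

(** The maximal ideal is radical. *)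
Lemma uniformizer_root n x h : regular h -> x ^+ n.+1 = z * h ->
  exists2 g, regular g & x = z * g.
Proof.
move=> rh Dx; have [->|nzx] := eqVneq x 0; first by exists 0; rewrite ?mulr0 //; apply: regular0.
have [rx|[g rg]] := regular_or_inv x^-1; last by rewrite invrK; exists g.
case/negP: (uniformizer_nonunit (regularM rh (regularX n.+1 rx))).
by rewrite mulrA -Dx -exprMn divff ?expr1n.
Qed.
End LocalRing.

Section Minimality.
Variable k : fieldType.
Implicit Types W : weierstrass {poly k}.
Local Notation F := {fraction {poly k}}.
Local Notation tf := (@tofrac {poly k}).

(** The discriminants of two equivalent equations differ by u^12, so that minimality can only
    fail through a change of coordinates with u in the maximal ideal. *)
Lemma minimal_criterion (c : k) W : disc W != 0 ->
  (forall g r s w E, regular_at c g ->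
     admissible_change (uniformizer c * g) r s w (generic_fibre W) E -> integral_at c E -> False) ->
  minimal_at_coord c W.
Proof.
move=> nzD noE u r s w E nzu adm intE.
have [ru|[g rg Du]] := regular_or_inv c u^-1; last first.
  by case: (noE g r s w E rg) => //; rewrite -Du invrK.
have eD : u ^+ 12 * disc E = disc (generic_fibre W).
  by rewrite -disc_rescale (iffLR (admissible_changeP _ _ _ _ _ _) adm) disc_shift.
have nzDF : disc (generic_fibre W) != 0 by rewrite map_disc tofrac_eq0.
have nzDE : disc E != 0 by apply: contraNneq nzDF => e0; rewrite -eD e0 mulr0.
by rewrite -eD invfM mulrCA divff // mulr1 -exprVn; apply: regularX.
Qed.

Lemma regular_disc (c : k) (E : weierstrass F) : integral_at c E -> regular_at c (disc E).
Proof.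
case=> r1 r2 r3 r4 r6.
have rb2 := regularD (regularX 2 r1) (regularM (regular_nat c 4) r2).
have rb4 := regularD (regularM r1 r3) (regularM (regular_nat c 2) r4).
have rb6 := regularD (regularX 2 r3) (regularM (regular_nat c 4) r6).
have rb8 := regularB (regularD (regularD (regularB (regularM (regularX 2 r1) r6)
  (regularM (regularM r1 r3) r4)) (regularM (regularM (regular_nat c 4) r2) r6))
  (regularM r2 (regularX 2 r3))) (regularX 2 r4).
exact: regularD (regularB (regularB (regularM (regularN (regularX 2 rb2)) rb8)
  (regularM (regular_nat c 8) (regularX 3 rb4))) (regularM (regular_nat c 27) (regularX 2 rb6)))
  (regularM (regularM (regularM (regular_nat c 9) rb2) rb4) rb6).
Qed.

(** A change of coordinates with u in the maximal ideal would make the discriminant divisible by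
    the 12th power of the uniformizer. *)
Lemma minimal_of_disc (c : k) W :
  disc W != 0 -> ~~ ord_ge c 12 (disc W) -> minimal_at_coord c W.
Proof.
move=> nzD ndvd; apply: minimal_criterion => // g r s w E rg adm intE.
case/negP: ndvd; rewrite /ord_ge.
have eD : (uniformizer c * g) ^+ 12 * disc E = disc (generic_fibre W).
  by rewrite -disc_rescale (iffLR (admissible_changeP _ _ _ _ _ _) adm) disc_shift.
have [p [q [nzq Dg]]] := regularM (regularX 12 rg) (regular_disc intE).
have tq := tofrac_unit nzq.
have DD : tf (disc W) = uniformizer c ^+ 12 * (tf p / tf q).
  by rewrite -map_disc -[map_weierstrass _ _]/(generic_fibre W) -eD exprMn -mulrA Dg.
have : tf (disc W * q) = tf (('X - c%:P) ^+ 12 * p).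
  by rewrite tofracM DD -mulrA divfK // [RHS]tofracM tofracXn.
move/eqP; rewrite tofrac_eq => /eqP e.
have: ('X - c%:P) ^+ 12 %| disc W * q by rewrite e dvdp_mulr.
by rewrite Gauss_dvdpl // coprimep_expl // coprimep_sym coprimep_XsubC.
Qed.

(** At a finite point the order of the discriminant is at most its degree, and at infinity it is
    12 minus its degree: both are below 12. *)
Lemma elliptic_surface_of_disc W : has_degrees W ->
  (1 < size (disc W) <= 12)%N -> elliptic_surface W.
Proof.
move=> dW /andP[gt1 le12]; have nzD : disc W != 0 by rewrite -size_poly_gt0 ltnW.
split=> // -[t|].
  apply: minimal_of_disc => //; apply: contraL le12 => /(dvdp_leq nzD).
  by rewrite size_exp_XsubC -ltnNge.
have dWoo : disc (chart None W) = homog 12 (disc W) (lin 0 1) (lin 1 0) by exact: disc_chart.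
have ndvd : ~~ ord_ge 0 12 (disc (chart None W)).
  by rewrite dWoo ord_ge_oo ?degle_disc // -ltnNge.
apply: minimal_of_disc => //; apply: contraNneq ndvd => ->; exact: dvdp0.
Qed.

End Minimality.

(** * Minimality at a fibre of wild ramification in characteristics 2 and 3 *)

Section WildAlgebra.
Variable K : fieldType.
Implicit Types (z t g r s w : K) (E : weierstrass K).

(** The substitution equations, with s = z sigma and w = z^2 omega. They have the form of integral
    equations for sigma and omega over the local ring in which z generates the maximal ideal. *)
Lemma wild2_algebra z t g r s w E : 2%:R = 0 :> K -> z != 0 ->
  admissible_change (z * g) r s w (Weierstrass 0 0 (t * z ^+ 3) 0 (z ^+ 5)) E ->
  (s / z) ^+ 4 = t * (s / z) + (g ^+ 4 * a4 E - (g ^+ 2 * a2 E) ^+ 2) /\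
  (w / z ^+ 2) ^+ 2 = z * (1 + z * (((s / z) ^+ 2 + g ^+ 2 * a2 E) ^+ 3 - g ^+ 6 * a6 E)
                       - t * (w / z ^+ 2)).
Proof.
move=> e2 nzz [/= _ E2 _ E4 E6].
have [sg Ds] : exists sg, s = z * sg by exists (s / z); rewrite mulrC divfK.
have [om Dw] : exists om, w = z ^+ 2 * om by exists (w / z ^+ 2); rewrite mulrC divfK ?expf_neq0.
rewrite {}Ds {}Dw in E2 E4 E6 *; rewrite [z * sg]mulrC mulfK // [z ^+ 2 * om]mulrC mulfK ?expf_neq0 //.
rewrite !exprMn -!(mulrA (z ^+ _)) in E2 E4 E6.
move: (g ^+ 2 * a2 E) (g ^+ 4 * a4 E) (g ^+ 6 * a6 E) E2 E4 E6 => h2 h4 h6 E2 E4 E6.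
have {E2} Dr : r = z ^+ 2 * (sg ^+ 2 + h2).
  by apply: (eq_mod_nat (n := 2) (c := - r) e2); rewrite mulrDr E2; ring.
rewrite Dr in E4 E6; have nz4 : z ^+ 4 != 0 by rewrite expf_neq0.
split; apply: (mulfI nz4).
  apply: (eq_mod_nat (n := 2)
    (c := z ^+ 3 * sg * om - z ^+ 4 * (sg ^+ 4 + 3%:R * sg ^+ 2 * h2 + h2 ^+ 2)) e2).
  by apply: (eq_of_eq E4); ring.
apply: (eq_of_eq (esym E6)); ring.
Qed.

(** The substitution equations with r = z rho give an integral equation for rho. *)
Lemma wild3_algebra z d t g r s w E : 3%:R = 0 :> K -> z != 0 ->
  admissible_change (z * g) r s w (Weierstrass 0 0 0 (d * z ^+ 4) (t * z ^+ 5)) E ->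
  (r / z) ^+ 3 = z ^+ 3 * (g ^+ 6 * a6 E + (g ^+ 3 * a3 E) ^+ 2)
                 - z ^+ 2 * (d * (r / z) + t).
Proof.
move=> e3 nzz [/= _ _ E3 _ E6].
have [ro Dr] : exists ro, r = z * ro by exists (r / z); rewrite mulrC divfK.
rewrite {}Dr in E3 E6 *; rewrite [z * ro]mulrC mulfK //.
rewrite !exprMn -!(mulrA (z ^+ _)) in E3 E6.
move: (g ^+ 3 * a3 E) (g ^+ 6 * a6 E) E3 E6 => h3 h6 E3 E6.
have {E3} Dw : w = - (z ^+ 3 * h3).
  by apply: (eq_mod_nat (n := 3) (c := w) e3); rewrite E3; ring.
have nz3 : z ^+ 3 != 0 by rewrite expf_neq0.
by rewrite Dw in E6; apply: (mulfI nz3); apply: (eq_of_eq E6); ring.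
Qed.
End WildAlgebra.

Section Wild.
Variable k : fieldType.
Local Notation F := {fraction {poly k}}.
Local Notation tf := (@tofrac {poly k}).
Local Notation z := (uniformizer (0 : k)).
Local Notation regular := (regular_at (0 : k)).

Lemma uniformizer0 : tf 'X = z.
Proof. by rewrite /uniformizer polyC0 subr0. Qed.

Lemma nat_frac n : n%:R = 0 :> k -> n%:R = 0 :> F.
Proof. by move=> e; rewrite -tofrac0 -polyC0 -e !rmorph_nat. Qed.

(** By integral closedness sigma = s / z and then omega = w / z^2 are regular. The equation for
    omega puts omega in the maximal ideal, and dividing it by z makes 1 a multiple of z. *)
Lemma wild2_contradiction (t : F) (g r s w : F) E :
  2%:R = 0 :> F -> regular t -> regular g -> integral_at 0 E ->
  admissible_change (z * g) r s w (Weierstrass 0 0 (t * z ^+ 3) 0 (z ^+ 5)) E -> False.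
Proof.
move=> e2 rt rg [_ r2 _ r4 r6] adm; have nzz := uniformizer_neq0 (0 : k).
have [Esg Eom] := wild2_algebra e2 nzz adm.
have rM n x : regular x -> regular (g ^+ n * x) by move=> rx; apply: regularM (regularX _ rg) rx.
move: (s / z) (w / z ^+ 2) (rM 2%N _ r2) (rM 4%N _ r4) (rM 6%N _ r6) Esg Eom => sg om.
move: (g ^+ 2 * _) (g ^+ 4 * _) (g ^+ 6 * _) => h2 h4 h6 rh2 rh4 rh6 Esg Eom.
have rz := regular_uniformizer (0 : k).
have rsg : regular sg.
  apply: (@regular_integral _ _ 3 _ (fun i => if i is 0 then h4 - h2 ^+ 2 else if i is 1 then t else 0)).
    by case=> [|[|i]]; [apply: regularB (regularX _ _) | | apply: regular0].
  by rewrite !big_ord_recl big_ord0 /= Esg expr0 expr1 mulr1 !mul0r !addr0 addrC.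
have rh : regular ((sg ^+ 2 + h2) ^+ 3 - h6).
  by apply/regularB/rh6/regularX/regularD/rh2/regularX.
have rom : regular om.
  apply: (@regular_integral _ _ 1 _ (fun i => if i is 0 then z * (1 + z * ((sg ^+ 2 + h2) ^+ 3 - h6))
     else - (z * t))).
    case=> [|i]; last by apply/regularN/regularM.
    by apply/regularM/regularD/regularM => //; apply: regular1.
  by rewrite !big_ord_recl big_ord0 /= Eom expr0 expr1 mulr1 addr0 mulrBr mulNr mulrA.
have [om' rom' Dom] : exists2 g, regular g & om = z * g.
  apply: uniformizer_root Eom; apply/regularB/regularM => //.
  by apply/regularD/regularM => //; apply: regular1.
have rc : regular (t * om' + om' ^+ 2 - ((sg ^+ 2 + h2) ^+ 3 - h6)).
  by apply/regularB/rh/regularD/regularX/rom'/regularM.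
case/negP: (uniformizer_nonunit rc).
move: Eom; rewrite Dom; move: (_ - h6) => h E0.
apply/eqP/(mulfI nzz)/(eq_of_eq (esym E0)); move: z => u; ring.
Qed.

(** By integral closedness rho = r / z is regular, and it lies in the maximal ideal since its cube
    does. Dividing the equation by z^2 then makes the unit t a multiple of z. *)
Lemma wild3_contradiction (d t : F) (g r s w : F) E :
  3%:R = 0 :> F -> regular d -> regular t^-1 -> t != 0 -> regular t -> regular g -> integral_at 0 E ->
  admissible_change (z * g) r s w (Weierstrass 0 0 0 (d * z ^+ 4) (t * z ^+ 5)) E -> False.
Proof.
move=> e3 rd rti nzt rt rg [_ _ r3 _ r6] adm; have nzz := uniformizer_neq0 (0 : k).
have Ero := wild3_algebra e3 nzz adm.
have rM n x : regular x -> regular (g ^+ n * x) by move=> rx; apply: regularM (regularX _ rg) rx.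
move: (r / z) (rM 3%N _ r3) (rM 6%N _ r6) Ero => ro.
move: (g ^+ 3 * _) (g ^+ 6 * _) => h3 h6 rh3 rh6.
have : regular (h6 + h3 ^+ 2) by apply/regularD/regularX.
move: (h6 + _) => h rh Ero {h3 h6 rh3 rh6}; have rz := regular_uniformizer (0 : k).
have rro : regular ro.
  apply: (@regular_integral _ _ 2 _ (fun i => if i is 0 then z ^+ 3 * h - z ^+ 2 * t
     else if i is 1 then - (z ^+ 2 * d) else 0)).
    case=> [|[|i]]; [|by apply/regularN/regularM/rd/regularX|exact: regular0].
    by apply/regularB; apply/regularM => //; apply: regularX.
  rewrite !big_ord_recl big_ord0 /= Ero /bump /= expr0 expr1; move: z => u; ring.
have [ro' rro' Dro] : exists2 g, regular g & ro = z * g.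
  apply: (@uniformizer_root _ _ 2 _ (z ^+ 2 * h - z * (d * ro + t))).
    apply: regularB; apply: regularM => //; [exact: regularX | apply: regularD rt; exact: regularM].
  rewrite Ero; move: z => u; ring.
have rc : regular ((h - ro' ^+ 3 - d * ro') / t).
  by apply/regularM/rti/regularB/regularM/rro'/rd/regularB/regularX.
case/negP: (uniformizer_nonunit rc); move: Ero; rewrite Dro => E0.
apply/eqP; rewrite mulrA; apply: (canLR (mulfK nzt)).
have nz2 : z ^+ 2 != 0 by rewrite expf_neq0.
by apply: (mulfI nz2); apply: (eq_of_eq E0); move: z => u; ring.
Qed.

(** If the discriminant is a nonzero constant, the only singular fibre is at infinity. Its
    discriminant has order 12 there, too large for a numerical proof of minimality. *)
Lemma elliptic_surface_wild W :
  has_degrees W -> size (disc W) = 1%N ->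
  (forall g r s w E, regular_at (0 : k) g ->
     admissible_change (z * g) r s w (generic_fibre (chart None W)) E -> integral_at 0 E -> False) ->
  elliptic_surface W.
Proof.
move=> dW sz1 noE; have nzD : disc W != 0 by rewrite -size_poly_gt0 sz1.
split=> // -[t|].
  apply: minimal_of_disc => //; apply/negP => /(dvdp_leq nzD).
  by rewrite size_exp_XsubC [X in (_ < X)%N]sz1.
apply: minimal_criterion => //; rewrite disc_chart //=.
apply/eqP => e0; have := @ord_ge_oo k 13 12 (disc W) (degle_disc dW) isT.
by rewrite e0 /ord_ge dvdp0 sz1.
Qed.

Lemma homog_monomial (c : k) i j : (j <= i)%N ->
  homog i (c%:P * 'X^j) (lin 0 1) (lin 1 0) = c%:P * 'X^(i - j).
Proof.
move=> le_ji; rewrite mul_polyC homogZ homogXn // /lin scale0r scale1r add0r polyC0 addr0 polyC1.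
by rewrite expr1n mul1r mul_polyC.
Qed.

Lemma elliptic_surface_wild2 (e : k) : 2%:R = 0 :> k -> e != 0 ->
  elliptic_surface (Weierstrass 0 0 e%:P 0 'X).
Proof.
move=> e2 nze; have dW : has_degrees (Weierstrass 0 0 e%:P 0 'X).
  by split; rewrite /= ?size_poly0 ?size_polyX ?size_polyC ?nze.
apply: elliptic_surface_wild => //.
  have -> : disc (Weierstrass 0 0 e%:P 0 'X) = (- e ^+ 4)%:P; last first.
    by rewrite size_polyC oppr_eq0 expf_neq0.
  have e2P : 2%:R = 0 :> {poly k} by rewrite -polyC_nat e2.
  rewrite /disc /b2 /b4 /b6 /b8 /= rmorphN rmorphXn /=; move: e%:P 'X => a x.
  by apply: (eq_mod_nat (c := - (13%:R * a ^+ 4 + 108%:R * a ^+ 2 * x + 216%:R * x ^+ 2)) e2P); ring.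
move=> g r s w E rg adm intE; apply: (@wild2_contradiction (tf e%:P) g r s w E) => //.
- exact: nat_frac.
- exact: regular_poly.
move: adm; congr (admissible_change _ _ _ _ _ _).
have H0 i : homog i 0 (lin 0 1) (lin 1 0) = 0 :> {poly k} by exact: homog0.
rewrite /generic_fibre /chart pullbackE /homog_weierstrass /map_weierstrass /= !H0 !tofrac0.
have -> : homog 3 e%:P (lin 0 1) (lin 1 0) = e%:P * 'X^3.
  by rewrite -[e%:P in LHS]mulr1 -(expr0 'X) homog_monomial.
have -> : homog 6 'X (lin 0 1) (lin 1 0) = 'X^5 :> {poly k}.
  by rewrite -[X in homog _ X]mul1r -polyC1 -(expr1 'X) homog_monomial // polyC1 mul1r.
by rewrite tofracM !tofracXn uniformizer0.
Qed.

Lemma elliptic_surface_wild3 (d t : k) : 3%:R = 0 :> k -> d != 0 -> t != 0 ->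
  elliptic_surface (Weierstrass 0 0 0 d%:P (t%:P * 'X)).
Proof.
move=> e3 nzd nzt; have dW : has_degrees (Weierstrass 0 0 0 d%:P (t%:P * 'X)).
  split; rewrite /= ?size_poly0 ?size_polyX ?size_polyC ?nzd //.
  by rewrite mul_polyC size_scale // size_polyX.
apply: elliptic_surface_wild => //.
  have -> : disc (Weierstrass 0 0 0 d%:P (t%:P * 'X)) = (- d ^+ 3)%:P; last first.
    by rewrite size_polyC oppr_eq0 expf_neq0.
  have e3P : 3%:R = 0 :> {poly k} by rewrite -polyC_nat e3.
  rewrite /disc /b2 /b4 /b6 /b8 /= rmorphN rmorphXn /=; move: d%:P (_ * 'X) => a x.
  by apply: (eq_mod_nat (c := - (21%:R * a ^+ 3 + 144%:R * x ^+ 2)) e3P); ring.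
move=> g r s w E rg adm intE; apply: (@wild3_contradiction (tf d%:P) (tf t%:P) g r s w E) => //.
- exact: nat_frac.
- exact: regular_poly.
- by exists 1, t%:P; rewrite hornerC tofrac1 mul1r.
- by rewrite tofrac_eq0 polyC_eq0.
- exact: regular_poly.
move: adm; congr (admissible_change _ _ _ _ _ _).
have H0 i : homog i 0 (lin 0 1) (lin 1 0) = 0 :> {poly k} by exact: homog0.
rewrite /generic_fibre /chart pullbackE /homog_weierstrass /map_weierstrass /= !H0 !tofrac0.
have -> : homog 4 d%:P (lin 0 1) (lin 1 0) = d%:P * 'X^4.
  by rewrite -[d%:P in LHS]mulr1 -(expr0 'X) homog_monomial.
have -> : homog 6 (t%:P * 'X) (lin 0 1) (lin 1 0) = t%:P * 'X^5 :> {poly k}.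
  by rewrite -(expr1 'X) homog_monomial.
by rewrite (tofracM d%:P) (tofracM t%:P) !tofracXn uniformizer0.
Qed.

End Wild.

(** * Integral equations for the surfaces with non-constant j-invariant *)

(** Equations with integer coefficients for the twelve surfaces with non-constant
    j-invariant. The first fibre of the configuration lies at infinity, and the second one at 0 except
    for (I9, I1, I1, I1). The coordinate on the line is scaled so that the discriminant is neither zero
    nor a 12th power modulo any prime; the zero equation is a default value. *)
Definition model (c : miranda_persson) (R : comNzRingType) : weierstrass {poly R} :=
  match c with
  | X211 => Weierstrass 1 0 0 0 'X
  | X321 => Weierstrass 1 0 0 'X 0
  | X431 => Weierstrass 1 0 'X 0 0
  | X411 => Weierstrass 1 (16%:R * 'X) 0 (8%:R * 'X) 'X
  | X141 => Weierstrass 1 'X 'X 0 0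
  | X222 => Weierstrass 1 (8%:R * 'X) 0 (16%:R * 'X ^+ 2 + 'X) 0
  | X9111 => Weierstrass 'X 0 1 0 0
  | X8211 => Weierstrass (8%:R * 'X + 1) (- (4%:R * 'X)) (2%:R * 'X) (- 'X) 0
  | X5511 => Weierstrass ('X + 1) 'X 'X 0 0
  | X6321 => Weierstrass ('X - 2%:R * 1) (- 'X) ('X - 'X ^+ 2) 0 0
  | X4422 => Weierstrass 1 (4%:R * 'X ^+ 2) 0 ('X ^+ 2) 0
  | X3333 => Weierstrass (9%:R * 'X + 1) 0 (27%:R * 'X ^+ 3 + 9%:R * 'X ^+ 2 + 'X) 0 0
  | _ => Weierstrass 0 0 0 0 0
  end.

Definition has_model (c : miranda_persson) : bool :=
  match c with X22 | X33 | X44 | X11 => false | _ => true end.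

Definition model_disc (c : miranda_persson) (R : comNzRingType) : seq R :=
  match c with
  | X211 => [:: 0; -1; - 432%:R]
  | X321 => [:: 0; 0; 1; - 64%:R]
  | X431 => [:: 0; 0; 0; 1; - 27%:R]
  | X411 => [:: 0; -1; 16%:R]
  | X141 => [:: 0; 0; 0; 0; 1; - 16%:R]
  | X222 => [:: 0; 0; 1; 32%:R; 256%:R]
  | X9111 => [:: - 27%:R; 0; 0; 1]
  | X8211 => [:: 0; 0; -1; 0; 16%:R]
  | X5511 => [:: 0; 0; 0; 0; 0; 1; - 11%:R; -1]
  | X6321 => [:: 0; 0; 0; 8%:R; - 15%:R; 6%:R; 1]
  | X4422 => [:: 0; 0; 0; 0; 1; 0; - 32%:R; 0; 256%:R]
  | X3333 => [:: 0; 0; 0; 1; 27%:R; 324%:R; 3%:R * 27%:R ^+ 2; 12%:R * 27%:R ^+ 2;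
                27%:R ^+ 3; 27%:R ^+ 3]
  | _ => [::]
  end.

Lemma disc_model c (R : comNzRingType) : has_model c -> disc (model c R) = Poly (model_disc c R).
Proof.
case: c => //= _; rewrite !cons_poly_def /disc /b2 /b4 /b6 /b8 /=; ring.
Qed.

Lemma has_degrees_model c (R : comNzRingType) : has_degrees (model c R).
Proof.
have dX : ('X : {poly R}) \in degle 1 by rewrite degleE size_polyX.
have up i j (p : {poly R}) : p \in degle i -> (i <= j)%N -> p \in degle j.
  by rewrite !degleE => hp le_ij; apply: leq_trans hp _.
have d0 i : (0 : {poly R}) \in degle i by rewrite degleE size_poly0.
have d1 i : (1 : {poly R}) \in degle i by rewrite degleE size_poly1.
have dXi i : (0 < i)%N -> ('X : {poly R}) \in degle i by apply: up.
have dXn i n : (n <= i)%N -> ('X^n : {poly R}) \in degle i by rewrite degleE size_polyXn.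
apply/has_degreesP; case: c; split => //=; do ?[exact: d0 | exact: d1 | exact: dXi | exact: dXn
 | apply: degleD | apply: degleB | apply: degleN | apply: degleMn].
Qed.

Lemma base_change_model c (R R' : comNzRingType) (phi : {rmorphism R -> R'}) :
  base_change phi (model c R) = model c R'.
Proof.
by case: c; rewrite /base_change /map_weierstrass /=;
  rewrite ?(rmorphD, rmorphB, rmorphN, rmorphM, rmorph_nat, rmorph1, rmorph0) /=
    ?map_polyXn ?map_polyX.
Qed.

(** One of the coefficients of the discriminant form, other than the extreme ones, is 1 or -1, so that
    over any field the degree of the discriminant lies between 1 and 11. *)
Lemma elliptic_surface_model c (F : fieldType) : has_model c -> elliptic_surface (model c F).
Proof.
move=> hc; apply: elliptic_surface_of_disc (has_degrees_model c F) _; rewrite disc_model //.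
have le_sz : (size (Poly (model_disc c F)) <= 12)%N.
  by apply: leq_trans (size_Poly _) _; case: c hc.
suff [j j_gt0 nzj] : exists2 j, (0 < j)%N & (Poly (model_disc c F))`_j != 0.
  rewrite le_sz andbT ltnNge; apply: contraNN nzj => le1.
  by rewrite nth_default // (leq_trans le1).
have nz1 : 1 != 0 :> F := oner_neq0 _; have nzN1 : -1 != 0 :> F by rewrite oppr_eq0.
by case: c hc {le_sz} => // _;
  do 6?[first [by exists 1%N; rewrite ?coef_Poly | by exists 2%N; rewrite ?coef_Poly
   | by exists 3%N; rewrite ?coef_Poly | by exists 4%N; rewrite ?coef_Poly
   | by exists 5%N; rewrite ?coef_Poly | by exists 6%N; rewrite ?coef_Poly]].
Qed.

Definition model_c4 (c : miranda_persson) (R : comNzRingType) : seq R :=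
  match c with
  | X211 => [:: 1]
  | X321 => [:: 1; - 48%:R]
  | X431 => [:: 1; - 24%:R]
  | X411 => [:: 1; - 16%:R ^+ 2; 16%:R ^+ 3]
  | X141 => [:: 1; - 16%:R; 16%:R]
  | X222 => [:: 1; 16%:R; 16%:R ^+ 2]
  | X9111 => [:: 0; - 24%:R; 0; 0; 1]
  | X8211 => [:: 1; 0; - 16%:R ^+ 2; 0; 16%:R ^+ 3]
  | X5511 => [:: 1; - 12%:R; 14%:R; 12%:R; 1]
  | X6321 => [:: 16%:R; - 16%:R; 0; 8%:R; 1]
  | X4422 => [:: 1; 0; - 16%:R; 0; 16%:R ^+ 2]
  | X3333 => [:: 1; 12%:R; 54%:R; 12%:R * 27%:R; 27%:R ^+ 2]
  | _ => [::]
  end.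

Definition model_c6 (c : miranda_persson) (R : comNzRingType) : seq R :=
  match c with
  | X211 => [:: -1; - 864%:R]
  | X321 => [:: -1; 72%:R]
  | X431 => [:: -1; 36%:R; - 216%:R]
  | X411 => [:: -1; - 480%:R; 16%:R ^+ 2 * 96%:R; - (64%:R * 16%:R ^+ 3)]
  | X141 => [:: -1; 24%:R; - 120%:R; - 64%:R]
  | X222 => [:: -1; - 24%:R; 384%:R; 16%:R ^+ 3]
  | X9111 => [:: - 216%:R; 0; 0; 36%:R; 0; 0; -1]
  | X8211 => [:: -1; 0; - 480%:R; 0; 16%:R ^+ 2 * 96%:R; 0; - (64%:R * 16%:R ^+ 3)]
  | X5511 => [:: -1; 18%:R; - 75%:R; 0; - 75%:R; - 18%:R; -1]
  | X6321 => [:: - 64%:R; 96%:R; - 24%:R; 56%:R; - 24%:R; - 12%:R; -1]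
  | X4422 => [:: -1; 0; 24%:R; 0; 384%:R; 0; - 16%:R ^+ 3]
  | X3333 => [:: -1; - 18%:R; - 135%:R; 0; 135%:R * 27%:R; 18%:R * 27%:R ^+ 2; 27%:R ^+ 3]
  | _ => [::]
  end.

Lemma c4_model c (R : comNzRingType) : has_model c -> c4 (model c R) = Poly (model_c4 c R).
Proof. by case: c => //= _; rewrite !cons_poly_def /c4 /b2 /b4 /=; ring. Qed.

Lemma c6_model c (R : comNzRingType) : has_model c -> c6 (model c R) = Poly (model_c6 c R).
Proof. by case: c => //= _; rewrite !cons_poly_def /c6 /b2 /b4 /b6 /=; ring. Qed.


(** * Polynomials given by lists of coefficients *)

Section SeqPoly.
Variable R : comNzRingType.
Implicit Types s t : seq R.

(** Identities between polynomials with parametric coefficients become equalities of lists,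
    which are verified entry by entry. *)
Fixpoint addl s t : seq R :=
  match s, t with
  | [::], _ => t
  | _, [::] => s
  | x :: s', y :: t' => (x + y) :: addl s' t'
  end.
Definition scl (c : R) s := [seq c * x | x <- s].
Fixpoint mull s t : seq R :=
  if s is x :: s' then addl (scl x t) (0 :: mull s' t) else [::].

(** Composition with al X + be. *)
Fixpoint affl (al be : R) s : seq R :=
  match s with
  | [::] => [::]
  | x :: s' => if s' is [::] then [:: x] else addl [:: x] (mull [:: be; al] (affl al be s'))
  end.

Lemma Poly_cons x s : Poly (x :: s) = Poly s * 'X + x%:P.
Proof. by rewrite /= cons_poly_def. Qed.

Lemma Poly_addl s t : Poly (addl s t) = Poly s + Poly t.
Proof.
elim: s t => [|x s IH] [|y t]; rewrite ?add0r ?addr0 //.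
rewrite [addl _ _]/= !Poly_cons IH rmorphD /=; ring.
Qed.

Lemma Poly_scl c s : Poly (scl c s) = c%:P * Poly s.
Proof.
elim: s => [|x s IH]; first by rewrite mulr0.
by rewrite [scl _ _]/= !Poly_cons IH rmorphM /=; ring.
Qed.

Lemma Poly_mull s t : Poly (mull s t) = Poly s * Poly t.
Proof.
elim: s => [|x s IH]; first by rewrite mul0r.
by rewrite [mull _ _]/= Poly_addl Poly_scl !Poly_cons IH polyC0; ring.
Qed.

Lemma Poly_affl al be s : Poly (affl al be s) = Poly s \Po (al *: 'X + be%:P).
Proof.
elim: s => [|x [|y s] IH]; first by rewrite comp_poly0.
  by rewrite /= cons_poly_def mul0r add0r comp_polyC.
rewrite -[affl _ _ _]/(addl [:: x] (mull [:: be; al] (affl al be (y :: s))))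
  Poly_addl Poly_mull {}IH; move: (y :: s) => {y}s; rewrite !Poly_cons /= -mul_polyC.
rewrite comp_polyD comp_polyM comp_polyX comp_polyC; ring.
Qed.

Lemma Poly_size n (p : {poly R}) : (size p <= n)%N -> p = Poly (mkseq (fun i => p`_i) n).
Proof.
move=> szp; apply/polyP=> i; rewrite coef_Poly.
have [lt_in|le_ni] := ltnP i n; first by rewrite nth_mkseq.
by rewrite !nth_default ?size_mkseq // (leq_trans szp).
Qed.

End SeqPoly.

(** * Placing two singular fibres at infinity and 0 *)

Section AffineEquivalence.
Variable k : fieldType.
Implicit Types A B : {poly k}.

(** Equivalence of pairs (c4, c6) under the substitutions that fix infinity. *)
Definition affine_equivalent A B A' B' : Prop :=
  exists al be lam : k, [/\ al != 0, lam != 0,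
    A \Po (al *: 'X + be%:P) = lam ^+ 2 *: A' & B \Po (al *: 'X + be%:P) = lam ^+ 3 *: B'].

(** The equivalences with the models are given by explicit al, be and lam, found by comparing
    coefficients. *)
Lemma affine_equivalent_Poly (a b a' b' : seq k) al be lam :
  al != 0 -> lam != 0 ->
  affl al be a = scl (lam ^+ 2) a' -> affl al be b = scl (lam ^+ 3) b' ->
  affine_equivalent (Poly a) (Poly b) (Poly a') (Poly b').
Proof.
move=> nza nzl Ea Eb; exists al, be, lam.
by split; rewrite // -Poly_affl (Ea, Eb) Poly_scl mul_polyC.
Qed.

Lemma affine_equivalent_trans A B A1 B1 A2 B2 :
  affine_equivalent A B A1 B1 -> affine_equivalent A1 B1 A2 B2 ->
  affine_equivalent A B A2 B2.
Proof.
move=> [al [be [lam [nza nzl EA EB]]]] [al1 [be1 [lam1 [nza1 nzl1 EA1 EB1]]]].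
exists (al * al1), (al * be1 + be), (lam * lam1); split; rewrite ?mulf_neq0 //.
all: have -> : (al * al1) *: 'X + (al * be1 + be)%:P =
  (al *: 'X + be%:P) \Po (al1 *: 'X + be1%:P)
  by rewrite comp_polyD comp_polyZ comp_polyX comp_polyC -!mul_polyC !(rmorphD, rmorphM) /=; ring.
all: rewrite comp_polyA ?EA ?EB comp_polyZ ?EA1 ?EB1 scalerA -?exprMn //.
Qed.

(** For invariants A = c4 and B = c6 this is 1728 times the discriminant. *)
Definition jdisc A B : {poly k} := A ^+ 3 - B ^+ 2.

End AffineEquivalence.

Section Reduction.
Variable k : closedFieldType.
Implicit Types W S : weierstrass {poly k}.
Hypothesis char0 : [pchar k] =i pred0.

Lemma nat_neq0 n : n.+1%:R != 0 :> k.
Proof. by have /pcharf0P := char0; move->. Qed.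

Lemma isomorphic_of_affine W S (a b c d : k) :
  has_degrees W -> has_degrees S -> a * d - b * c != 0 ->
  affine_equivalent (c4 (pullback a b c d S)) (c6 (pullback a b c d S)) (c4 W) (c6 W) ->
  isomorphic W S.
Proof.
move=> dW dS nzd [al [be [lam [nza nzl E4 E6]]]].
apply: isomorphic_of_invariants => //; try exact: nat_neq0.
exists (a * al), (a * be + b), (c * al), (c * be + d), lam.
have lin1 : lin 0 1 = 1 :> {poly k} by rewrite /lin scale0r add0r polyC1.
have key i (p : {poly k}) : p \in degle i ->
  homog i p (lin (a * al) (a * be + b)) (lin (c * al) (c * be + d)) =
  homog i p (lin a b) (lin c d) \Po (al *: 'X + be%:P).
  move=> hp; rewrite -(homog_affine _ (degle_homog i p (degle_lin a b) (degle_lin c d))).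
  rewrite -lin1 homog_comp !lin_lin.
  by rewrite !mulr0 !mulr1 !addr0.
split=> //; [|rewrite key ?degle_c4 // -homog_c4 // -E4|rewrite key ?degle_c6 // -homog_c6 // -E6] => //.
have -> : a * al * (c * be + d) - (a * be + b) * (c * al) = (a * d - b * c) * al by ring.
by rewrite mulf_neq0.
Qed.

Definition normalized W (T1 T2 : kodaira) (Ts : seq kodaira) : Prop :=
  [/\ has_degrees W, disc W != 0, kodaira_at W None T1, kodaira_at W (Some 0) T2 &
   exists2 cs : seq k, uniq (0 :: cs) & all2 (kodaira_at_coord W) cs Ts].

Lemma all2_act (a b c d : k) S (ps : seq (option k)) Ts (f : option k -> option k) :
  has_degrees S -> a * d - b * c != 0 -> {in ps, forall P, act a b c d (f P) = P} ->
  all2 (kodaira_at S) ps Ts -> all2 (kodaira_at (pullback a b c d S)) (map f ps) Ts.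
Proof.
move=> dS nzd; elim: ps Ts => [|P ps IH] [|T Ts] //= fK /andP[kP kps].
rewrite kodaira_at_act // fK ?mem_head // kP IH // => Q Qps.
by apply: fK; rewrite inE Qps orbT.
Qed.

(** Any two of the points supporting the fibres can be moved to infinity and 0, so that
    S can be identified by solving for the invariants of a normalized equation. *)
Lemma normalize S T1 T2 Ts : has_degrees S -> disc S != 0 ->
  singular_fibres S (T1 :: T2 :: Ts) ->
  exists2 W, normalized W T1 T2 Ts & forall W0, has_degrees W0 ->
    affine_equivalent (c4 W) (c6 W) (c4 W0) (c6 W0) -> isomorphic W0 S.
Proof.
move=> dS nzD [[|P1 [|P2 ps]] [Ups kall _]] //; first by move: kall; rewrite /= andbF.
move: kall => /and3P[k1 k2 kps].
have neP : P1 != P2 by move: Ups; rewrite /= inE negb_or -andbA => /andP[].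
have [a [b [c [d [nzd aoo a0]]]]] := exists_projectivity neP.
have dW : has_degrees (pullback a b c d S) by apply: has_degrees_homog; apply: degle_lin.
exists (pullback a b c d S); last by move=> W0 dW0; apply: isomorphic_of_affine.
pose f := act d (- b) (- c) a.
have nzd' : d * a - (- b) * (- c) != 0 by rewrite mulrNN [d * a]mulrC.
have fK P : act a b c d (f P) = P by have := act_adj nzd' P; rewrite !opprK.
have finj : injective f by apply: can_inj fK.
have f1 : f P1 = None by apply: (can_inj (act_adj nzd)); rewrite fK.
have f2 : f P2 = Some 0 by apply: (can_inj (act_adj nzd)); rewrite fK.
split=> //.
- rewrite pullbackE homog_disc //; apply: contraNneq nzD => e0.
  have := homog_adj a b c d (degle_disc dS); rewrite e0 homog0 => /esym/eqP.
  by rewrite scaler_eq0 expf_eq0 (negPf nzd).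
- by rewrite kodaira_at_act // aoo.
- by rewrite kodaira_at_act // a0.
have kf : all2 (kodaira_at (pullback a b c d S)) (map f ps) Ts.
  by apply: all2_act => // P _; apply: fK.
have Uf : uniq (None :: Some 0 :: map f ps).
  by rewrite -f1 -f2 -!map_cons map_inj_uniq.
have [cs Dcs] : exists cs, map f ps = map Some cs.
  move: Uf => /= /andP[]; rewrite inE /= => + _; elim: (map f ps) => [|[t|] qs IH] //=.
    by exists [::].
  by rewrite inE /= => /IH[cs ->]; exists (t :: cs).
exists cs.
  move: Uf; rewrite Dcs cons_uniq => /andP[_].
  by rewrite -[Some 0 :: _]/(map Some (0 :: cs)) map_inj_uniq // => x y [].
move: kf; rewrite Dcs; elim: cs Ts {Dcs Uf kps} => [|t cs IH] [|T Ts] //= /andP[kt kcs].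
by rewrite IH // andbT; apply: kt.
Qed.

Local Notation Z W := (jdisc (c4 W) (c6 W)).

Lemma jdisc_disc W : Z W = (12%:R ^+ 3) *: disc W.
Proof. by rewrite /jdisc c4_c6_disc -mul_polyC rmorphXn /= polyC_nat. Qed.

Lemma nz1728 : 12%:R ^+ 3 != 0 :> k.
Proof. by rewrite expf_neq0 // nat_neq0. Qed.

Lemma ord_disc c n W : ord_ge c n (disc W) = ord_ge c n (Z W).
Proof. by rewrite jdisc_disc /ord_ge dvdpZr // nz1728. Qed.

Lemma ord_oo_c4 n W : has_degrees W -> (n <= 5)%N ->
  ord_ge 0 n (c4 (chart None W)) = (size (c4 W) <= 5 - n)%N.
Proof. by move=> dW le_n; rewrite c4_chart // ord_ge_oo // degle_c4. Qed.

Lemma ord_oo_c6 n W : has_degrees W -> (n <= 7)%N ->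
  ord_ge 0 n (c6 (chart None W)) = (size (c6 W) <= 7 - n)%N.
Proof. by move=> dW le_n; rewrite c6_chart // ord_ge_oo // degle_c6. Qed.

Lemma ord_oo_disc n W : has_degrees W -> (n <= 13)%N ->
  ord_ge 0 n (disc (chart None W)) = (size (Z W) <= 13 - n)%N.
Proof.
move=> dW le_n; rewrite disc_chart // ord_ge_oo ?degle_disc //.
by rewrite jdisc_disc size_scale // nz1728.
Qed.

Lemma ord_ge0 n (p : {poly k}) : ord_ge 0 n p = ('X^n %| p).
Proof. by rewrite /ord_ge polyC0 subr0. Qed.

Lemma normalized_sizes W T1 T2 Ts : normalized W T1 T2 Ts ->
  [/\ (size (c4 W) <= 5)%N, (size (c6 W) <= 7)%N & Z W != 0].
Proof.
case=> dW nzD _ _ _; split; [exact: degle_c4 | exact: degle_c6 |].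
by rewrite jdisc_disc scaler_eq0 (negPf nz1728).
Qed.

End Reduction.

Section Coefficients.
Variable k : fieldType.
Implicit Types s a b : seq k.

Definition jdiscl a b : seq k := addl (mull a (mull a a)) (scl (-1) (mull b b)).

Lemma Poly_jdiscl a b : jdisc (Poly a) (Poly b) = Poly (jdiscl a b).
Proof. by rewrite /jdisc Poly_addl Poly_scl !Poly_mull rmorphN /=; ring. Qed.

Lemma Poly_size_le n s : (size (Poly s) <= n)%N -> forall j, (n <= j)%N -> s`_j = 0.
Proof. by move=> sz j le_nj; rewrite -coef_Poly nth_default // (leq_trans sz). Qed.

Lemma Poly_dvdXn n s : 'X^n %| Poly s -> forall j, (j < n)%N -> s`_j = 0.
Proof. by move=> /dvdXnP dvd j lt_jn; rewrite -coef_Poly dvd. Qed.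

Lemma Poly_lead n s : size s = n.+1 -> ~~ (size (Poly s) <= n)%N -> s`_n != 0.
Proof.
move=> szs; apply: contraNneq => e0; apply/leq_sizeP => j; rewrite coef_Poly leq_eqVlt.
by case/predU1P=> [<-//|lt_nj]; rewrite nth_default // szs.
Qed.

Lemma Poly_eq0 s : (forall j, (j < size s)%N -> s`_j = 0) -> Poly s = 0.
Proof.
move=> e0; apply/polyP=> j; rewrite coef_Poly coef0.
by have [/e0//|le] := ltnP j (size s); rewrite nth_default.
Qed.
End Coefficients.

#[local] Arguments Poly : simpl never.

(** * Equations for the surfaces with constant j-invariant 0 or 1728 *)

Section AdditiveModels.
Variable R : comNzRingType.

(** Here b2 = 4 c q^2 and b4 = 2 c^2, so that c4 = b2^2 - 24 b4 vanishes when q^4 = 3; the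
    relation c^3 = 2 turns the constant term of the discriminant into -1. The same holds for
    [model44]. *)
Definition model22 (q c : R) : weierstrass {poly R} :=
  Weierstrass 0 (c * q ^+ 2)%:P q%:P (c ^+ 2)%:P 'X.
Definition model44 (q c : R) : weierstrass {poly R} :=
  Weierstrass 0 (c * q ^+ 2)%:P (q%:P + (q ^+ 3)%:P * 'X) (c ^+ 2)%:P (- 'X).

(** If a^2 = 6 and a e = e^2 + 1, then b2 = 6 and b4 - b6 = 1, whence c6 = 0; eliminating a leaves
    e^4 = 4 e^2 - 1. *)
Definition model33 (a e : R) : weierstrass {poly R} :=
  Weierstrass a%:P 0 e%:P (2%:R * 'X) 'X.

Lemma degle_const (a : R) i : a%:P \in degle i.
Proof. by rewrite degleE (leq_trans (size_polyC_leq1 _)). Qed.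

Lemma degle_X i : (0 < i)%N -> ('X : {poly R}) \in degle i.
Proof. by rewrite degleE size_polyX. Qed.

Lemma degle0 i : (0 : {poly R}) \in degle i.
Proof. by rewrite degleE size_poly0. Qed.

Lemma has_degrees_model22 q c : has_degrees (model22 q c).
Proof. by apply/has_degreesP; split; rewrite /= ?degle_const ?degle_X ?degle0. Qed.

Lemma has_degrees_model44 q c : has_degrees (model44 q c).
Proof.
have up : (q ^+ 3)%:P * 'X \in degle (2 + 1) by rewrite degleM ?degle_const ?degle_X.
by apply/has_degreesP; split; rewrite /= ?degle_const ?degleN ?degle_X ?degleD ?degle_const ?degle0.
Qed.

Lemma has_degrees_model33 a e : has_degrees (model33 a e).
Proof. by apply/has_degreesP; split; rewrite /= ?degle_const ?degleMn ?degle_X ?degle0. Qed.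

End AdditiveModels.

Section AdditiveModelInvariants.
Variable R : comNzRingType.

Lemma base_change_model22 (R' : comNzRingType) (phi : {rmorphism R -> R'}) q c :
  base_change phi (model22 q c) = model22 (phi q) (phi c).
Proof.
by rewrite /base_change /map_weierstrass /model22 /= rmorph0 !map_polyC /= map_polyX rmorphM !rmorphXn.
Qed.

Lemma base_change_model44 (R' : comNzRingType) (phi : {rmorphism R -> R'}) q c :
  base_change phi (model44 q c) = model44 (phi q) (phi c).
Proof.
rewrite /base_change /map_weierstrass /model44 /= rmorph0 rmorphN rmorphD.
by rewrite (rmorphM (map_poly phi) (q ^+ 3)%:P) /= !map_polyC /= map_polyX rmorphM !rmorphXn.
Qed.

Lemma base_change_model33 (R' : comNzRingType) (phi : {rmorphism R -> R'}) a e :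
  base_change phi (model33 a e) = model33 (phi a) (phi e).
Proof.
rewrite /base_change /map_weierstrass /model33 /= rmorph0 rmorphM rmorph_nat /=.
by rewrite !map_polyC /= map_polyX.
Qed.

Section Relations22.
Variables (q c : R).
Hypotheses (q4 : q ^+ 4 = 3%:R) (c3 : c ^+ 3 = 2%:R).
Let Q4 : q%:P ^+ 4 - 3%:R = 0 :> {poly R}.
Proof. by rewrite -rmorphXn /= q4 rmorph_nat subrr. Qed.
Let C3 : c%:P ^+ 3 - 2%:R = 0 :> {poly R}.
Proof. by rewrite -rmorphXn /= c3 rmorph_nat subrr. Qed.

Lemma disc_model22 : disc (model22 q c) = - (1 + 12%:R * q%:P ^+ 2 * 'X) ^+ 2.
Proof.
rewrite /disc /b2 /b4 /b6 /b8 /= !(rmorphM, rmorphXn) /=; move: (q%:P) (c%:P) Q4 C3 => s d e1 e2.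
move: 'X => x; apply: (eq_lin2 (c1 := 144%:R * x ^+ 2 - 64%:R * d ^+ 3 * s ^+ 2 * x
  + (- 16%:R * d ^+ 3 * (s ^+ 4 + 3%:R) + 16%:R * d ^+ 6 - 27%:R + 72%:R * d ^+ 3))
  (c2 := 96%:R * s ^+ 2 * x - 8%:R * (2%:R * d ^+ 3 - 5%:R)) e1 e2); ring.
Qed.

Lemma c4_model22 : c4 (model22 q c) = 0.
Proof.
rewrite /c4 /b2 /b4 /= !(rmorphM, rmorphXn) /=; move: (q%:P) (c%:P) Q4 C3 => s d e1 e2.
apply: (eq_lin (c := 16%:R * d ^+ 2) e1); ring.
Qed.

Lemma c6_model22 : c6 (model22 q c) = Poly [:: - 24%:R * q ^+ 2; - 864%:R].
Proof.
rewrite !Poly_cons /c6 /b2 /b4 /b6 /= !(rmorphM, rmorphXn, rmorphN, rmorph_nat) /=.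
rewrite [Poly [::]](_ : _ = 0) // mul0r add0r; move: (q%:P) (c%:P) Q4 C3 => s d e1 e2.
move: 'X => x; apply: (eq_lin2 (c1 := - 64%:R * d ^+ 3 * s ^+ 2) (c2 := 96%:R * s ^+ 2) e1 e2); ring.
Qed.

Lemma disc_model44 : disc (model44 q c) = - (1 + q%:P ^+ 6 * 'X) ^+ 4.
Proof.
rewrite /disc /b2 /b4 /b6 /b8 /= !(rmorphM, rmorphXn) /=; move: (q%:P) (c%:P) Q4 C3 => t d e1 e2.
move: 'X => x; pose s := t ^+ 2; pose b := (t + t ^+ 3 * x) ^+ 2 - 4%:R * x.
apply: (eq_lin2 (c1 := 21%:R + 144%:R * x ^+ 2 - 8%:R * s * x - 96%:R * s ^+ 2 * x ^+ 2
   - 72%:R * s ^+ 3 * x ^+ 3 + 6%:R * s ^+ 4 * x ^+ 2 + 12%:R * s ^+ 5 * x ^+ 3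
   + 9%:R * s ^+ 6 * x ^+ 4 + 4%:R * s ^+ 7 * x ^+ 3 + 3%:R * s ^+ 8 * x ^+ 4 + s ^+ 10 * x ^+ 4
   + b * s * (- 16%:R * d ^+ 3) + 16%:R * d ^+ 6)
  (c2 := 24%:R * b * s - 16%:R * (d ^+ 3 + 2%:R)) e1 e2); rewrite /b /s; ring.
Qed.

Lemma c4_model44 : c4 (model44 q c) = 0.
Proof.
rewrite /c4 /b2 /b4 /= !(rmorphM, rmorphXn) /=; move: (q%:P) (c%:P) Q4 C3 => s d e1 e2.
apply: (eq_lin (c := 16%:R * d ^+ 2) e1); ring.
Qed.

Lemma c6_model44 : c6 (model44 q c) =
  Poly [:: - 24%:R * q ^+ 2; - 144%:R * q ^+ 4; - 216%:R * q ^+ 6].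
Proof.
rewrite !Poly_cons /c6 /b2 /b4 /b6 /= !(rmorphM, rmorphXn, rmorphN, rmorph_nat) /=.
rewrite [Poly [::]](_ : _ = 0) // mul0r add0r; move: (q%:P) (c%:P) Q4 C3 => s d e1 e2.
move: 'X => x; apply: (eq_lin2 (c1 := - 64%:R * d ^+ 3 * s ^+ 2 - 288%:R * x)
  (c2 := 96%:R * s ^+ 2) e1 e2); ring.
Qed.
End Relations22.

Section Relations33.
Variables (a e : R).
Hypotheses (a2 : a ^+ 2 = 6%:R) (ae : a * e = e ^+ 2 + 1) (e4 : e ^+ 4 = 4%:R * e ^+ 2 - 1).
Let A2 : a%:P ^+ 2 = 6%:R :> {poly R}.
Proof. by rewrite -rmorphXn /= a2 rmorph_nat. Qed.
Let AE : a%:P * e%:P = e%:P ^+ 2 + 1 :> {poly R}.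
Proof. by rewrite -rmorphM /= ae rmorphD rmorphXn rmorph1. Qed.
Let E4 : e%:P ^+ 4 - 4%:R * e%:P ^+ 2 + 1 = 0 :> {poly R}.
Proof.
have := congr1 (@polyC R) e4; rewrite rmorphXn rmorphB rmorphM rmorphXn rmorph_nat rmorph1 => ->.
by rewrite /=; ring.
Qed.

Lemma disc_model33 : disc (model33 a e) = - (2%:R * e%:P ^+ 2 - 1 + 8%:R * 'X) ^+ 3.
Proof.
rewrite /disc /b2 /b4 /b6 /b8 /=; move: (a%:P) (e%:P) A2 AE E4 => u t eu eut et; move: 'X => x.
rewrite (_ : u ^+ 2 * x - u * t * (2%:R * x) + 4%:R * 0 * x + 0 * t ^+ 2 - (2%:R * x) ^+ 2 =
  u ^+ 2 * x - (u * t) * (2%:R * x) - 4%:R * x ^+ 2); last by ring.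
rewrite mulr0 addr0 eu eut.
by apply: (eq_lin (c := - 9%:R) et); ring.
Qed.

Lemma c6_model33 : c6 (model33 a e) = 0.
Proof.
rewrite /c6 /b2 /b4 /b6 /=; move: (a%:P) (e%:P) A2 AE E4 => u t eu eut et; move: 'X => x.
by rewrite mulr0 addr0 eu eut; ring.
Qed.

Lemma c4_model33 : c4 (model33 a e) = Poly [:: 12%:R - 24%:R * e ^+ 2; - 96%:R].
Proof.
rewrite !Poly_cons /c4 /b2 /b4 /= !(rmorphB, rmorphM, rmorphXn, rmorphN, rmorph_nat) /=.
rewrite [Poly [::]](_ : _ = 0) // mul0r add0r.
move: (a%:P) (e%:P) A2 AE E4 => u t eu eut et; move: 'X => x.
by rewrite mulr0 addr0 eu eut; ring.
Qed.
End Relations33.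
End AdditiveModelInvariants.

Section AdditiveSurfaces.
Variable F : fieldType.
Implicit Types q c a e : F.

Lemma size_affine_pow (a b : F) n : b != 0 -> size (- (a%:P + b%:P * 'X) ^+ n) = n.+1.
Proof.
move=> nzb; have sz : size (a%:P + b%:P * 'X) = 2.
  by rewrite addrC size_MXaddC polyC_eq0 (negPf nzb) size_polyC nzb.
have nz0 : (a%:P + b%:P * 'X) ^+ n != 0 by rewrite expf_neq0 // -size_poly_eq0 sz.
rewrite size_polyN; have := size_exp (a%:P + b%:P * 'X) n; rewrite sz mul1n.
by rewrite -size_poly_eq0 in nz0; case: (size _) nz0 => //= m _ ->.
Qed.

Lemma char_not_2_and_3 : 2%:R = 0 :> F -> 3%:R = 0 :> F -> False.
Proof. by move=> n2 /eqP; rewrite (natrD _ 2 1) n2 add0r oner_eq0. Qed.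

(** The discriminant is minus the square of 1 + 12 q^2 t. In characteristics 2 and 3 it is the
    constant -1, while the equation reduces to y^2 + q y = x^3 + t and to y^2 = x^3 + c^2 x + t
    respectively. *)
Lemma elliptic_surface_model22 q c : q ^+ 4 = 3%:R -> c ^+ 3 = 2%:R ->
  elliptic_surface (model22 q c).
Proof.
move=> q4 c3; have [n2|n2] := eqVneq (2%:R : F) 0.
  have n3 : 3%:R != 0 :> F by apply/eqP; apply: char_not_2_and_3.
  have c0 : c = 0 by move/eqP: c3; rewrite n2 expf_eq0 => /eqP.
  have nzq : q != 0 by apply: contraNneq n3 => q0; rewrite -q4 q0 expr0n.
  by rewrite /model22 c0 mul0r expr0n polyC0; apply: elliptic_surface_wild2.
have nzc : c != 0 by apply: contraNneq n2 => c0; rewrite -c3 c0 expr0n.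
have [n3|n3] := eqVneq (3%:R : F) 0.
  have q0 : q = 0 by move/eqP: q4; rewrite n3 expf_eq0 => /eqP.
  rewrite /model22 q0 expr0n mulr0 polyC0 -['X]mul1r -polyC1.
  by apply: elliptic_surface_wild3 => //; rewrite ?expf_neq0 ?oner_neq0.
have nzq : q != 0 by apply: contraNneq n3 => q0; rewrite -q4 q0 expr0n.
apply: elliptic_surface_of_disc; first exact: has_degrees_model22.
have -> : disc (model22 q c) = - (1%:P + (12%:R * q ^+ 2)%:P * 'X) ^+ 2.
  by rewrite disc_model22 // polyCM rmorphXn /= polyC_nat.
have nz12 : 12%:R != 0 :> F by rewrite (natrM _ 2 6) (natrM _ 2 3) !mulf_neq0.
by rewrite size_affine_pow ?(mulf_neq0 nz12) ?expf_neq0.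
Qed.

(** The discriminant is minus the fourth power of 1 + q^6 t, a constant only in characteristic 3,
    where the equation reduces to y^2 = x^3 + c^2 x - t. *)
Lemma elliptic_surface_model44 q c : q ^+ 4 = 3%:R -> c ^+ 3 = 2%:R ->
  elliptic_surface (model44 q c).
Proof.
move=> q4 c3; have [n3|n3] := eqVneq (3%:R : F) 0.
  have n2 : 2%:R != 0 :> F by apply/eqP=> n2; apply: char_not_2_and_3 n2 n3.
  have nzc : c != 0 by apply: contraNneq n2 => c0; rewrite -c3 c0 expr0n.
  have q0 : q = 0 by move/eqP: q4; rewrite n3 expf_eq0 => /eqP.
  rewrite /model44 q0 !expr0n mulr0 polyC0 mul0r addr0 -['X]mul1r -mulNr -polyC1 -polyCN.
  by apply: elliptic_surface_wild3 => //; rewrite ?expf_neq0 ?oppr_eq0 ?oner_neq0.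
have nzq : q != 0 by apply: contraNneq n3 => q0; rewrite -q4 q0 expr0n.
apply: elliptic_surface_of_disc; first exact: has_degrees_model44.
have -> : disc (model44 q c) = - (1%:P + (q ^+ 6)%:P * 'X) ^+ 4.
  by rewrite disc_model44 // rmorphXn.
by rewrite size_affine_pow // expf_neq0.
Qed.

(** The discriminant is minus the cube of 2 e^2 - 1 + 8 t, a constant only in characteristic 2, where
    the equation reduces to y^2 + e y = x^3 + t. *)
Lemma elliptic_surface_model33 a e :
  a ^+ 2 = 6%:R -> a * e = e ^+ 2 + 1 -> e ^+ 4 = 4%:R * e ^+ 2 - 1 ->
  elliptic_surface (model33 a e).
Proof.
move=> a2 ae e4; have [n2|n2] := eqVneq (2%:R : F) 0.
  have a0 : a = 0 by move/eqP: a2; rewrite (natrM _ 2 3) n2 mul0r expf_eq0 => /eqP.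
  have nze : e != 0.
    by apply/eqP=> e0; move/eqP: ae; rewrite e0 expr0n mulr0 add0r eq_sym oner_eq0.
  rewrite /model33 a0 polyC0 -polyC_nat n2 polyC0 mul0r.
  exact: elliptic_surface_wild2.
apply: elliptic_surface_of_disc; first exact: has_degrees_model33.
have -> : disc (model33 a e) = - ((2%:R * e ^+ 2 - 1)%:P + (8%:R)%:P * 'X) ^+ 3.
  by rewrite disc_model33 // polyC_nat polyCB polyCM polyC_nat rmorphXn.
by rewrite size_affine_pow // (natrX _ 2 3) expf_neq0.
Qed.
End AdditiveSurfaces.

#[local] Arguments jdiscl : simpl never.

(** * The configuration of fibres determines the invariants *)

Section Uniqueness.
Variable k : closedFieldType.
Hypothesis char0 : [pchar k] =i pred0.
Implicit Type W : weierstrass {poly k}.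

Let nz n : n.+1%:R != 0 :> k := nat_neq0 char0 n.

Ltac unfold_kodaira dW := rewrite /kodaira_at /kodaira_at_coord /ord_eq /=
  ?(ord_oo_c4 dW) ?(ord_oo_c6 dW) ?(ord_oo_disc char0 dW) ?(ord_disc char0) ?ord_ge0 /= //.
Ltac nonzero := repeat (apply/andP; split);
  first [assumption | by apply: nz | by rewrite ?mulf_neq0 ?invr_eq0 ?oppr_eq0 ?expf_neq0 ?nz].
Ltac seq_field := rewrite /affl /scl /=; repeat (congr (_ :: _)); field; nonzero.
Ltac prelude nW dW nzZ A B := have [_ _ nzZ] := normalized_sizes char0 nW; case: nW => dW _;
  rewrite c4_model // c6_model //; unfold_kodaira dW;
  match goal with |- context [c4 ?W] => move: (c4 W) (c6 W) nzZ => A B nzZ end.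
Ltac from_coef c e := apply: (eq_lin (c := c) e); rewrite /jdiscl /=; field; nonzero.

(** At a multiplicative fibre the values of c4 and c6 lie on the cuspidal cubic away from its
    cusp, and s is their coordinate on it. *)
Lemma nodal0 (a0 b0 : k) : a0 != 0 -> a0 ^+ 3 = b0 ^+ 2 ->
  exists2 s, s != 0 & a0 = s ^+ 2 /\ b0 = s ^+ 3.
Proof.
move=> nza e; have nzb : b0 != 0.
  by apply: contraNneq nza => b00; move/eqP: e; rewrite b00 expr0n /= expf_eq0.
exists (b0 / a0); first by rewrite mulf_neq0 ?invr_eq0.
split; first by rewrite expr_div_n -e; field.
by rewrite expr_div_n e; field; rewrite nzb.
Qed.

Lemma Poly_ndvdX (x : k) s : ~~ ('X^1 %| Poly (x :: s)) -> x != 0.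
Proof.
apply: contraNneq => ->; apply/dvdXnP => -[|j] // _; by rewrite coef_Poly.
Qed.

(** Here c4 is a nonzero constant and c6 is linear. *)
Lemma unique_X211 W : normalized W IIstar (I_ 1) [:: I_ 1] ->
  affine_equivalent (c4 W) (c6 W) (c4 (model X211 k)) (c6 (model X211 k)).
Proof.
move=> nW; prelude nW dW nzZ A B; move=> /and3P[sA /andP[sB nsB] _] /andP[/andP[_ nA] _] _.
have DA := Poly_size sA; have DB := Poly_size sB; rewrite /mkseq /= in DA DB.
move: A`_0 B`_0 B`_1 DA DB => a0 b0 b1 DA DB; subst A B.
have /= {nsB}nzb1 := Poly_lead (erefl : size [:: b0; b1] = 2) nsB.
have nza0 := Poly_ndvdX nA.
have [lam Dlam] := closed_root a0 (isT : 0 < 2)%N; subst a0.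
have nzl : lam != 0 by apply: contraNneq nza0 => ->; rewrite expr0n.
apply: (@affine_equivalent_Poly _ _ _ _ _ (- 864%:R * lam ^+ 3 / b1) ((- lam ^+ 3 - b0) / b1) lam) => //.
- nonzero.
- seq_field.
- seq_field.
Qed.

(** In this proof and the following ones, the vanishing of the first coefficients of c4^3 - c6^2 at 0,
    or of the last ones when the condition is at infinity, expresses the coefficients of c6
    successively through those of c4, as for the expansion of c4^(3/2). *)
Lemma unique_X321 W : normalized W IIIstar (I_ 2) [:: I_ 1] ->
  affine_equivalent (c4 W) (c6 W) (c4 (model X321 k)) (c6 (model X321 k)).
Proof.
move=> nW; prelude nW dW nzZ A B => /and3P[/andP[sA nsA] sB _] /andP[/andP[_ nA] /andP[dZ _]] _.
have DA := Poly_size sA; have DB := Poly_size sB; rewrite /mkseq /= in DA DB.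
move: A`_0 A`_1 B`_0 B`_1 DA DB => a0 a1 b0 b1 DA DB; subst A B.
have /= {nsA}nza1 := Poly_lead (erefl : size [:: a0; a1] = 2) nsA.
have nza0 := Poly_ndvdX nA; rewrite Poly_jdiscl in dZ; have Z_ := Poly_dvdXn dZ.
have [s nzs [Da Db]] : exists2 s, s != 0 & a0 = s ^+ 2 /\ b0 = s ^+ 3.
  by apply: nodal0 nza0 _; from_coef (1 : k) (Z_ 0%N isT).
subst a0 b0.
have Db1 : b1 = 3%:R / 2%:R * s * a1 by from_coef (- 1 / (2%:R * s ^+ 3)) (Z_ 1%N isT).
subst b1.
apply: (@affine_equivalent_Poly _ _ _ _ _ (- 48%:R * s ^+ 2 / a1) 0 (- s)).
- nonzero.
- by rewrite oppr_eq0.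
- seq_field.
- seq_field.
Qed.

Lemma unique_X431 W : normalized W IVstar (I_ 3) [:: I_ 1] ->
  affine_equivalent (c4 W) (c6 W) (c4 (model X431 k)) (c6 (model X431 k)).
Proof.
move=> nW; prelude nW dW nzZ A B => /and3P[sA /andP[sB nsB] _] /andP[/andP[_ nA] /andP[dZ _]] _.
have DA := Poly_size sA; have DB := Poly_size sB; rewrite /mkseq /= in DA DB.
move: A`_0 A`_1 B`_0 B`_1 B`_2 DA DB => a0 a1 b0 b1 b2 DA DB; subst A B.
have /= {nsB}nzb2 := Poly_lead (erefl : size [:: b0; b1; b2] = 3) nsB.
have nza0 := Poly_ndvdX nA; rewrite Poly_jdiscl in dZ; have Z_ := Poly_dvdXn dZ.
have [s nzs [Da Db]] : exists2 s, s != 0 & a0 = s ^+ 2 /\ b0 = s ^+ 3.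
  by apply: nodal0 nza0 _; from_coef (1 : k) (Z_ 0%N isT).
subst a0 b0.
have Db1 : b1 = 3%:R / 2%:R * s * a1 by from_coef (- 1 / (2%:R * s ^+ 3)) (Z_ 1%N isT).
subst b1.
have Db2 : b2 = 3%:R / 8%:R / s * a1 ^+ 2 by from_coef (- 1 / (2%:R * s ^+ 3)) (Z_ 2%N isT).
subst b2; have nza1 : a1 != 0 by apply: contraNneq nzb2 => ->; rewrite expr0n mulr0.
apply: (@affine_equivalent_Poly _ _ _ _ _ (- 24%:R * s ^+ 2 / a1) 0 (- s)).
- nonzero.
- by rewrite oppr_eq0.
- seq_field.
- seq_field.
Qed.

Lemma unique_X411 W : normalized W (Istar 4) (I_ 1) [:: I_ 1] ->
  affine_equivalent (c4 W) (c6 W) (c4 (model X411 k)) (c6 (model X411 k)).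
Proof.
move=> nW; prelude nW dW nzZ A B => /and3P[/andP[sA nsA] /andP[sB _] /andP[sZ _]] _ _.
have DA := Poly_size sA; have DB := Poly_size sB; rewrite /mkseq /= in DA DB.
move: A`_0 A`_1 A`_2 B`_0 B`_1 B`_2 B`_3 DA DB => a0 a1 a2 b0 b1 b2 b3 DA DB; subst A B.
have /= {nsA}nza2 := Poly_lead (erefl : size [:: a0; a1; a2] = 3) nsA.
rewrite Poly_jdiscl in sZ nzZ; have Z_ := Poly_size_le sZ.
have [p nzp [Da Db]] : exists2 p, p != 0 & a2 = p ^+ 2 /\ b3 = p ^+ 3.
  by apply: nodal0 nza2 _; from_coef (1 : k) (Z_ 6%N isT).
subst a2 b3.
have Db2 : b2 = 3%:R / 2%:R * p * a1 by from_coef (- 1 / (2%:R * p ^+ 3)) (Z_ 5%N isT).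
subst b2; pose m := a1 / (2%:R * p); pose n := a0 - m ^+ 2.
have Da1 : a1 = 2%:R * p * m by rewrite /m; field; nonzero.
have Da0 : a0 = m ^+ 2 + n by rewrite /n; ring.
move: m n Da1 Da0 => m n Da1 Da0; subst a1 a0.
have Db1 : b1 = 3%:R * p * m ^+ 2 + 3%:R / 2%:R * p * n.
  by from_coef (- 1 / (2%:R * p ^+ 3)) (Z_ 4%N isT).
subst b1.
have Db0 : b0 = m ^+ 3 + 3%:R / 2%:R * n * m.
  by from_coef (- 1 / (2%:R * p ^+ 3)) (Z_ 3%N isT).
subst b0.
have nzn : n != 0.
  apply: contraNneq nzZ => ->; apply/eqP/Poly_eq0; rewrite /jdiscl /=.
  by do 7?case => //=; move=> _; field; nonzero.
have [nu Dnu] := closed_root (- n / 3%:R) (isT : 0 < 2)%N.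
have Dn : n = - (3%:R * nu ^+ 2) by rewrite Dnu; field; nonzero.
have nznu : nu != 0 by apply: contraNneq nzn => nu0; rewrite Dn nu0 expr0n !mulr0 oppr0.
subst n.
apply: (@affine_equivalent_Poly _ _ _ _ _ (64%:R * nu / p) ((- 2%:R * nu - m) / p) (- nu)).
- nonzero.
- by rewrite oppr_eq0.
- seq_field.
- seq_field.
Qed.

(** The fibre of type I_4 at 0 determines c6 from c4, and the one at infinity leaves a single equation,
    one of whose factors would make the discriminant vanish. *)
Lemma unique_X141 W : normalized W (Istar 1) (I_ 4) [:: I_ 1] ->
  affine_equivalent (c4 W) (c6 W) (c4 (model X141 k)) (c6 (model X141 k)).
Proof.
move=> nW; prelude nW dW nzZ A B.
move=> /and3P[/andP[sA nsA] /andP[sB _] /andP[sZ _]] /andP[/andP[_ nA] /andP[dZ _]] _.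
have DA := Poly_size sA; have DB := Poly_size sB; rewrite /mkseq /= in DA DB.
move: A`_0 A`_1 A`_2 B`_0 B`_1 B`_2 B`_3 DA DB => a0 a1 a2 b0 b1 b2 b3 DA DB; subst A B.
have /= {nsA}nza2 := Poly_lead (erefl : size [:: a0; a1; a2] = 3) nsA.
have nza0 := Poly_ndvdX nA; rewrite Poly_jdiscl in dZ sZ nzZ.
have Z_ := Poly_dvdXn dZ; have Zoo := Poly_size_le sZ.
have [s nzs [Da Db]] : exists2 s, s != 0 & a0 = s ^+ 2 /\ b0 = s ^+ 3.
  by apply: nodal0 nza0 _; from_coef (1 : k) (Z_ 0%N isT).
subst a0 b0.
have Db1 : b1 = 3%:R / 2%:R * s * a1 by from_coef (- 1 / (2%:R * s ^+ 3)) (Z_ 1%N isT).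
subst b1.
have Db2 : b2 = 3%:R / 2%:R * s * a2 + 3%:R / 8%:R / s * a1 ^+ 2.
  by from_coef (- 1 / (2%:R * s ^+ 3)) (Z_ 2%N isT).
subst b2.
have Db3 : b3 = a1 * (12%:R * s ^+ 2 * a2 - a1 ^+ 2) / (16%:R * s ^+ 3).
  by from_coef (- 1 / (2%:R * s ^+ 3)) (Z_ 3%N isT).
subst b3.
have : (4%:R * s ^+ 2 * a2 - a1 ^+ 2) ^+ 2 * (16%:R * s ^+ 2 * a2 - a1 ^+ 2) = 0.
  by from_coef (256%:R * s ^+ 6) (Zoo 6%N isT).
move/eqP; rewrite mulf_eq0 expf_eq0 /= => /orP[] /eqP/subr0_eq e.
  case/eqP: nzZ; apply: Poly_eq0; have -> : a2 = a1 ^+ 2 / (4%:R * s ^+ 2).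
    by rewrite -e; field; nonzero.
  by rewrite /jdiscl /=; do 7?case => //=; move=> _; field; nonzero.
have Da2 : a2 = a1 ^+ 2 / (16%:R * s ^+ 2) by rewrite -e; field; nonzero.
have nza1 : a1 != 0 by apply: contraNneq nza2 => a10; rewrite Da2 a10 expr0n mul0r.
subst a2.
apply: (@affine_equivalent_Poly _ _ _ _ _ (- 16%:R * s ^+ 2 / a1) 0 (- s)).
- nonzero.
- by rewrite oppr_eq0.
- seq_field.
- seq_field.
Qed.

(** The curve y^2 = x^3 - 3 A x + 2 B, equivalent to the one with invariants A and B, has at c a node
    with x = s. The last relation comes from the vanishing of the derivative of the discriminant. *)
Lemma node (A B : {poly k}) (c : k) n : ord_eq c 0 A -> ord_ge c n.+2 (jdisc A B) ->
  exists2 s, s != 0 & [/\ A.[c] = s ^+ 2, B.[c] = s ^+ 3 &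
    2%:R * (B^`()).[c] = 3%:R * s * (A^`()).[c]].
Proof.
move=> /andP[_]; rewrite /ord_ge expr1 -root_factor_theorem => nA.
case/dvdpP=> q; rewrite exprSr exprSr !mulrA -mulrA; move: (q * _) => {}q DZ.
have Z0 : A.[c] ^+ 3 - B.[c] ^+ 2 = 0.
  have := congr1 (fun p => p.[c]) DZ; rewrite /jdisc hornerD hornerN !horner_exp => ->.
  by rewrite !hornerM hornerXsubC subrr !mulr0.
have Z1 : 3%:R * A.[c] ^+ 2 * A^`().[c] - 2%:R * B.[c] * B^`().[c] = 0.
  have := congr1 (fun p => p^`().[c]) DZ.
  rewrite /jdisc derivB !exprSr expr0 !mul1r !derivM !(hornerD, hornerN, hornerM, hornerX, hornerC) subrr.
  by rewrite !(mulr0, mul0r, addr0) => e; rewrite -e; ring.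
have [s nzs [DA DB]] := nodal0 (nA : A.[c] != 0) (subr0_eq Z0).
exists s => //; split=> //; apply: (mulfI (expf_neq0 3 nzs)).
by rewrite DA DB in Z1; apply: (eq_lin (c := -1) Z1); ring.
Qed.

Lemma third_point (T1 T2 : kodaira) n Ts W : normalized W T1 T2 (I_ n.+2 :: Ts) ->
  exists c, [/\ c != 0, ord_eq c 0 (c4 W) & ord_ge c n.+2 (jdisc (c4 W) (c6 W))].
Proof.
case=> dW _ _ _ [[|c cs] //]; rewrite /= inE negb_or -andbA => /and3P[nzc _ _].
case/andP=> /andP[kA /andP[kZ _]] _; exists c.
by rewrite eq_sym nzc -ord_disc.
Qed.

(** The contact conditions at 0 and infinity determine c6 from c4 = s^2 + a1 X + p^2 X^2. The node at a
    third point c gives an equation for its coordinate t, one of whose factors is excluded because it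
    would make the discriminant zero or c equal to 0. *)
Lemma unique_X222 W : normalized W (Istar 2) (I_ 2) [:: I_ 2] ->
  affine_equivalent (c4 W) (c6 W) (c4 (model X222 k)) (c6 (model X222 k)).
Proof.
move=> nW; have [c [nzc ]] := third_point nW; prelude nW dW nzZ A B.
move=> /and3P[/andP[sA nsA] /andP[sB _] /andP[sZ _]] /andP[/andP[_ nA] /andP[dZ _]] _ cA cZ.
have [t nzt] := node cA cZ.
have DA := Poly_size sA; have DB := Poly_size sB; rewrite /mkseq /= in DA DB.
move: A`_0 A`_1 A`_2 B`_0 B`_1 B`_2 B`_3 DA DB => a0 a1 a2 b0 b1 b2 b3 DA DB; subst A B.
have /= {nsA}nza2 := Poly_lead (erefl : size [:: a0; a1; a2] = 3) nsA.
have nza0 := Poly_ndvdX nA; rewrite Poly_jdiscl in dZ sZ nzZ.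
have Z_ := Poly_dvdXn dZ; have Zoo := Poly_size_le sZ.
have [s nzs [Da Db]] : exists2 s, s != 0 & a0 = s ^+ 2 /\ b0 = s ^+ 3.
  by apply: nodal0 nza0 _; from_coef (1 : k) (Z_ 0%N isT).
subst a0 b0.
have [p nzp [Da Db]] : exists2 p, p != 0 & a2 = p ^+ 2 /\ b3 = p ^+ 3.
  by apply: nodal0 nza2 _; from_coef (1 : k) (Zoo 6%N isT).
subst a2 b3.
have Db1 : b1 = 3%:R / 2%:R * s * a1 by from_coef (- 1 / (2%:R * s ^+ 3)) (Z_ 1%N isT).
have Db2 : b2 = 3%:R / 2%:R * p * a1 by from_coef (- 1 / (2%:R * p ^+ 3)) (Zoo 5%N isT).
subst b1 b2; pose m := a1 - 2%:R * s * p.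
have Da1 : a1 = m + 2%:R * s * p by rewrite /m; ring.
move: m Da1 => m Da1; subst a1.
have nzm : m != 0.
  apply: contraNneq nzZ => ->; apply/eqP/Poly_eq0; rewrite /jdiscl /=.
  by do 7?case => //=; move=> _; field; nonzero.
case=> E1 E2 E3; rewrite !Poly_cons !(derivD, derivM, derivX, derivC) in E1 E2 E3.
rewrite !(hornerD, hornerM, hornerX, hornerC) in E1 E2 E3.
have : (t - (s + p * c)) ^+ 2 * (2%:R * t + s + p * c) = 0.
  by apply: (eq_lin2 (c1 := 3%:R * (s + p * c)) (c2 := - 2%:R) (subr_eq0_of E1) (subr_eq0_of E2)); field; nonzero.
move/eqP; rewrite mulf_eq0 expf_eq0 /= => /orP[/eqP/subr0_eq Dt|/eqP Dt].
  case/eqP: (mulf_neq0 nzm nzc).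
  by apply: (eq_lin (c := 1) (subr_eq0_of E1)); rewrite Dt; ring.
have {}Dt : s = - 2%:R * t - p * c by apply: (eq_lin (c := 1) Dt); ring.
subst s.
have mc : m * c = - 3%:R * t ^+ 2 by apply: (eq_lin (c := 1) (subr_eq0_of E1)); ring.
have nzt' : t != 0.
  by apply: contraNneq (mulf_neq0 nzm nzc) => t0; rewrite mc t0 expr0n mulr0.
have Dm : m = 3%:R * p * t.
  apply: (mulfI (mulf_neq0 (nz 2) nzt')).
  by apply: (eq_lin2 (c1 := - 1 / 3%:R) (c2 := p) (subr_eq0_of E3) (subr_eq0_of mc)); field; nonzero.
have Dc : c = - t / p.
  apply: (mulfI (mulf_neq0 (mulf_neq0 (nz 2) nzp) nzt')).
  by apply: (eq_lin (c := 1) (subr_eq0_of mc)); rewrite Dm; field; nonzero.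
subst m c; have nzs1 : - t != 0 by rewrite oppr_eq0.
apply: (@affine_equivalent_Poly _ _ _ _ _ (16%:R * t / p) 0 t) => //.
- nonzero.
- seq_field.
- seq_field.
Qed.

(** The pair A = S^2 + l, B = S^3 + (3/2) S l + kap with S = p X^2 + q X + r, l = m X + n and kap
    constant: the general solution of deg (A^3 - B^2) <= 6 with deg A = 4. *)
Definition six_c4 (p q r m n : k) : seq k :=
  [:: r ^+ 2 + n; 2%:R * q * r + m; q ^+ 2 + 2%:R * p * r; 2%:R * p * q; p ^+ 2].
Definition six_c6 (p q r m n kap : k) : seq k :=
  [:: r ^+ 3 + 3%:R / 2%:R * r * n + kap; 3%:R * q * r ^+ 2 + 3%:R / 2%:R * (q * n + r * m);
      3%:R * p * r ^+ 2 + 3%:R * q ^+ 2 * r + 3%:R / 2%:R * (p * n + q * m);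
      6%:R * p * q * r + q ^+ 3 + 3%:R / 2%:R * p * m;
      3%:R * p ^+ 2 * r + 3%:R * p * q ^+ 2; 3%:R * p ^+ 2 * q; p ^+ 3].

Lemma six_at_oo (A B : {poly k}) : (size A <= 5)%N -> ~~ (size A <= 4)%N -> (size B <= 7)%N ->
  (size (jdisc A B) <= 7)%N -> exists p q r m n kap,
  [/\ p != 0, A = Poly (six_c4 p q r m n) & B = Poly (six_c6 p q r m n kap)].
Proof.
move=> sA nsA sB sZ.
have DA := Poly_size sA; have DB := Poly_size sB; rewrite /mkseq /= in DA DB.
move: A`_0 A`_1 A`_2 A`_3 A`_4 B`_0 B`_1 B`_2 B`_3 B`_4 B`_5 B`_6 DA DB.
move=> a0 a1 a2 a3 a4 b0 b1 b2 b3 b4 b5 b6 DA DB; subst A B.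
have /= {nsA}nza4 := Poly_lead (erefl : size [:: a0; a1; a2; a3; a4] = 5) nsA.
rewrite Poly_jdiscl in sZ; have Zoo := Poly_size_le sZ.
have [p nzp [Da Db]] : exists2 p, p != 0 & a4 = p ^+ 2 /\ b6 = p ^+ 3.
  by apply: nodal0 nza4 _; from_coef (1 : k) (Zoo 12%N isT).
subst a4 b6; pose q := a3 / (2%:R * p); pose r := (a2 - q ^+ 2) / (2%:R * p).
pose m := a1 - 2%:R * q * r; pose n := a0 - r ^+ 2.
have Da3 : a3 = 2%:R * p * q by rewrite /q; field; nonzero.
have Da2 : a2 = q ^+ 2 + 2%:R * p * r by rewrite /r; field; nonzero.
have Da1 : a1 = 2%:R * q * r + m by rewrite /m; ring.
have Da0 : a0 = r ^+ 2 + n by rewrite /n; ring.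
move: q r m n Da3 Da2 Da1 Da0 => q r m n Da3 Da2 Da1 Da0; subst a3 a2 a1 a0.
have Db5 : b5 = 3%:R * p ^+ 2 * q by from_coef (- 1 / (2%:R * p ^+ 3)) (Zoo 11%N isT).
subst b5.
have Db4 : b4 = 3%:R * p ^+ 2 * r + 3%:R * p * q ^+ 2.
  by from_coef (- 1 / (2%:R * p ^+ 3)) (Zoo 10%N isT).
subst b4.
have Db3 : b3 = 6%:R * p * q * r + q ^+ 3 + 3%:R / 2%:R * p * m.
  by from_coef (- 1 / (2%:R * p ^+ 3)) (Zoo 9%N isT).
subst b3.
have Db2 : b2 = 3%:R * p * r ^+ 2 + 3%:R * q ^+ 2 * r + 3%:R / 2%:R * (p * n + q * m).
  by from_coef (- 1 / (2%:R * p ^+ 3)) (Zoo 8%N isT).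
subst b2.
have Db1 : b1 = 3%:R * q * r ^+ 2 + 3%:R / 2%:R * (q * n + r * m).
  by from_coef (- 1 / (2%:R * p ^+ 3)) (Zoo 7%N isT).
subst b1.
exists p, q, r, m, n, (b0 - (r ^+ 3 + 3%:R / 2%:R * r * n)); split=> //.
by congr (Poly (_ :: _)); ring.
Qed.

(** The three further coefficients that have to vanish at infinity give kap and, after excluding
    a zero discriminant, n and r; the remaining parameters are absorbed by an affine substitution. *)
Lemma unique_X9111 W : normalized W (I_ 9) (I_ 1) [:: I_ 1; I_ 1] ->
  affine_equivalent (c4 W) (c6 W) (c4 (model X9111 k)) (c6 (model X9111 k)).
Proof.
move=> nW; have [sA sB _] := normalized_sizes char0 nW; move: sA sB; prelude nW dW nzZ A B.
move=> /andP[/andP[_ nsA] /andP[sZ _]] _ _ sA sB.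
have sZ7 : (size (jdisc A B) <= 7)%N by apply: leq_trans sZ _.
have [p [q [r [m [n [kap [nzp DA DB]]]]]]] := six_at_oo sA nsA sB sZ7.
subst A B; clear sZ7; rewrite /six_c4 /six_c6 Poly_jdiscl in sZ nzZ; have Zoo := Poly_size_le sZ.
have Dkap : kap = 3%:R / 8%:R / p * m ^+ 2 by from_coef (- 1 / (2%:R * p ^+ 3)) (Zoo 6%N isT).
subst kap.
have : m * (2%:R * p * n - q * m) = 0 by from_coef (4%:R / (3%:R * p)) (Zoo 5%N isT).
move/eqP; rewrite mulf_eq0 => /orP[] /eqP Dm.
  subst m; have /eqP : n ^+ 2 = 0 by from_coef (4%:R / (3%:R * p ^+ 2)) (Zoo 4%N isT).
  rewrite expf_eq0 /= => /eqP n0; subst n; case/eqP: nzZ; apply: Poly_eq0; rewrite /jdiscl /=.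
  by do 13?case => //=; move=> _; field; nonzero.
have nzm : m != 0.
  apply: contraNneq nzZ => m0; subst m; apply/eqP/Poly_eq0.
  have n0 : n = 0.
    by apply: (mulfI (mulf_neq0 (nz 1) nzp)); rewrite mulr0; apply: (eq_lin (c := 1) Dm); ring.
  by subst n; rewrite /jdiscl /=; do 13?case => //=; move=> _; field; nonzero.
have Dn : n = q * m / (2%:R * p).
  by apply: (eq_lin (c := 1 / (2%:R * p)) Dm); field; nonzero.
subst n.
have Dr : r = q ^+ 2 / (4%:R * p).
  by from_coef (- 4%:R / (3%:R * p * m ^+ 2)) (Zoo 4%N isT).
subst r.
have [al Dal] := closed_root (- m / (24%:R * p ^+ 2)) (isT : 0 < 3)%N.
have Dm' : m = - 24%:R * p ^+ 2 * al ^+ 3 by rewrite Dal; field; nonzero.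
have nzal : al != 0 by apply: contraNneq nzm => al0; rewrite Dm' al0 expr0n mulr0.
subst m.
apply: (@affine_equivalent_Poly _ _ _ _ _ al (- q / (2%:R * p)) (- p * al ^+ 2)).
- nonzero.
- nonzero.
- seq_field.
- seq_field.
Qed.

(** The vanishing of two more coefficients at infinity gives kap and m (2 p n - q m) = 0. If m = 0, then
    the node at 0 gives the model. Otherwise the coordinate s of the node satisfies
    (s - r) (q (s - r) - m) = 0, and either factor leads to a contradiction. *)
Lemma unique_X8211 W : normalized W (I_ 8) (I_ 2) [:: I_ 1; I_ 1] ->
  affine_equivalent (c4 W) (c6 W) (c4 (model X8211 k)) (c6 (model X8211 k)).
Proof.
move=> nW; have [sA sB _] := normalized_sizes char0 nW; move: sA sB; prelude nW dW nzZ A B.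
move=> /andP[/andP[_ nsA] /andP[sZ _]] /andP[/andP[_ nA] /andP[dZ _]] _ sA sB.
have sZ7 : (size (jdisc A B) <= 7)%N by apply: leq_trans sZ _.
have [p [q [r [m [n [kap [nzp DA DB]]]]]]] := six_at_oo sA nsA sB sZ7.
subst A B; clear sZ7; rewrite /six_c4 /six_c6 Poly_jdiscl in sZ dZ nzZ.
have Zoo := Poly_size_le sZ; have Z_ := Poly_dvdXn dZ; have nza0 := Poly_ndvdX nA.
have Dkap : kap = 3%:R / 8%:R / p * m ^+ 2 by from_coef (- 1 / (2%:R * p ^+ 3)) (Zoo 6%N isT).
subst kap.
have : m * (2%:R * p * n - q * m) = 0 by from_coef (4%:R / (3%:R * p)) (Zoo 5%N isT).
move/eqP; rewrite mulf_eq0 => /orP[] /eqP Dm.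
  subst m.
  have nzn : n != 0.
    apply: contraNneq nzZ => n0; subst n; apply/eqP/Poly_eq0; rewrite /jdiscl /=.
    by do 13?case => //=; move=> _; field; nonzero.
  have Dn : n = - 3%:R / 4%:R * r ^+ 2 by from_coef (1 / n ^+ 2) (Z_ 0%N isT).
  have nzr : r != 0 by apply: contraNneq nzn => r0; rewrite Dn r0 expr0n mulr0.
  have q0 : q = 0 by from_coef (2%:R / (3%:R * r * n ^+ 2)) (Z_ 1%N isT).
  subst n q.
  have [al Dal] := closed_root (- 32%:R * r / p) (isT : 0 < 2)%N.
  have Dp : r = - p * al ^+ 2 / 32%:R by rewrite Dal; field; nonzero.
  have nzal : al != 0 by apply: contraNneq nzr => al0; rewrite Dp al0 expr0n mulr0 mul0r.
  subst r.
  apply: (@affine_equivalent_Poly _ _ _ _ _ al 0 (- p * al ^+ 2 / 64%:R)).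
  - nonzero.
  - nonzero.
  - seq_field.
  - seq_field.
have nzm : m != 0.
  apply: contraNneq nzZ => m0; subst m; apply/eqP/Poly_eq0.
  have n0 : n = 0.
    by apply: (mulfI (mulf_neq0 (nz 1) nzp)); rewrite mulr0; apply: (eq_lin (c := 1) Dm); ring.
  by subst n; rewrite /jdiscl /=; do 13?case => //=; move=> _; field; nonzero.
have Dn : n = q * m / (2%:R * p).
  by apply: (eq_lin (c := 1 / (2%:R * p)) Dm); field; nonzero.
subst n; set a0 := (X in X != 0) in nza0.
set b0 := r ^+ 3 + 3%:R / 2%:R * r * (q * m / (2%:R * p)) + 3%:R / 8%:R / p * m ^+ 2.
have [s nzs [Da Db]] : exists2 s, s != 0 & a0 = s ^+ 2 /\ b0 = s ^+ 3.
  by apply: nodal0 nza0 _; rewrite /a0 /b0; from_coef (1 : k) (Z_ 0%N isT).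
have D1 : 2%:R * (3%:R * q * r ^+ 2 + 3%:R / 2%:R * (q * (q * m / (2%:R * p)) + r * m)) =
          3%:R * s * (2%:R * q * r + m).
  apply: (mulfI (expf_neq0 3 nzs)); rewrite -{1}Db.
  rewrite (_ : s ^+ 3 * (3%:R * s * (2%:R * q * r + m)) = 3%:R * (s ^+ 2) ^+ 2 * (2%:R * q * r + m)); last by ring.
  by rewrite -Da /a0 /b0; from_coef (- 1 : k) (Z_ 1%N isT).
rewrite {}/a0 in nza0 Da; rewrite {}/b0 in Db.
have : (s - r) * (q * (s - r) - m) = 0.
  by apply: (eq_lin2 (c1 := 1 / 3%:R) (c2 := - q) (subr_eq0_of D1) (subr_eq0_of Da)); field; nonzero.
move/eqP; rewrite mulf_eq0 => /orP[] /eqP/subr0_eq Ds.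
  subst s; case/eqP: (expf_neq0 2 nzm).
  apply: (eq_lin2 (c1 := 8%:R * p / 3%:R) (c2 := - 4%:R * p * r) (subr_eq0_of Db) (subr_eq0_of Da)).
  by field; nonzero.
have nzx : s - r != 0 by apply: contraNneq nzm => x0; rewrite -Ds x0 mulr0.
case/eqP: (expf_neq0 3 nzx); subst m.
apply: (eq_lin2 (c1 := - 4%:R) (c2 := 6%:R * s - 3%:R * (s - r)) (subr_eq0_of Db) (subr_eq0_of Da)).
by field; nonzero.
Qed.

Definition node_at (A B : {poly k}) (c s : k) : Prop :=
  [/\ A.[c] = s ^+ 2, B.[c] = s ^+ 3 & 2%:R * (B^`()).[c] = 3%:R * s * (A^`()).[c]].

Lemma second_node (T1 : kodaira) n Ts W : normalized W T1 (I_ n.+2) Ts ->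
  exists s, node_at (c4 W) (c6 W) 0 s.
Proof.
case=> dW _ _ /andP[kA /andP[kZ _]] _; rewrite /= ord_disc // in kA kZ.
by have [s _ N] := node kA kZ; exists s.
Qed.

Lemma third_node (T1 T2 : kodaira) n Ts W : normalized W T1 T2 (I_ n.+2 :: Ts) ->
  exists2 c, c != 0 & exists s, node_at (c4 W) (c6 W) c s.
Proof.
move=> nW; have [c [nzc kA kZ]] := third_point nW; exists c => //.
by have [s _ N] := node kA kZ; exists s.
Qed.

(** For kap nonzero, the difference x between the coordinate s of a node over tau and the value of S at
    tau is a nonzero common root of two polynomials that do not depend on tau. *)
Lemma six_node (p q r m n kap tau s : k) (A := Poly (six_c4 p q r m n))
    (B := Poly (six_c6 p q r m n kap)) (x := s - (p * tau ^+ 2 + q * tau + r)) :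
  p != 0 ->
  node_at A B tau s -> kap != 0 ->
  [/\ x != 0, m = (2%:R * p * tau + q) * x,
   4%:R * p * (x ^+ 3 + 3%:R * r * x ^+ 2 - 3%:R * n * x + 2%:R * kap) - 3%:R * (m - q * x) ^+ 2 = 0 &
   2%:R * p * (x ^+ 2 + 2%:R * r * x - n) + q * (m - q * x) = 0].
Proof.
move=> nzp; rewrite /node_at /A /B /six_c4 /six_c6 !Poly_cons !(derivD, derivM, derivX, derivC).
rewrite !(hornerD, hornerM, hornerX, hornerC).
case=> E1 E2 E3 nzk; have Ds : s = x + (p * tau ^+ 2 + q * tau + r) by rewrite /x; ring.
move: x Ds => x Ds; subst s.
have H1 : x ^+ 2 + 2%:R * (p * tau ^+ 2 + q * tau + r) * x - (m * tau + n) = 0.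
  by apply: (eq_lin (c := - 1) (subr_eq0_of E1)); field; nonzero.
have H2 : x ^+ 3 + 3%:R * (p * tau ^+ 2 + q * tau + r) * x ^+ 2 - 3%:R * (m * tau + n) * x
          + 2%:R * kap = 0.
  apply: (eq_lin2 (c1 := 2%:R) (c2 := 3%:R * (x + (p * tau ^+ 2 + q * tau + r))) (subr_eq0_of E2) H1).
  by field; nonzero.
have : x * (m - (2%:R * p * tau + q) * x) = 0.
  apply: (eq_lin2 (c1 := - 1 / 3%:R) (c2 := - (2%:R * p * tau + q)) (subr_eq0_of E3) H1).
  by field; nonzero.
have nzx : x != 0.
  apply: contraNneq nzk => x0; move: H2; rewrite x0 => H2.
  by apply/eqP; apply: (eq_lin (c := 1 / 2%:R) H2); field; nonzero.
move/eqP; rewrite mulf_eq0 (negPf nzx) /= => /eqP/subr0_eq Dm; subst m; split=> //.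
- by apply: (eq_lin (c := 4%:R * p) H2); ring.
- by apply: (eq_lin (c := 2%:R * p) H1); ring.
Qed.

(** If kap were nonzero, the nodes over 0 and c would yield the same x by [six_node], and then m
    would determine tau, contradicting the choice of c. With kap = 0 the contact conditions at 0 can be solved. *)
Lemma unique_X6321 W : normalized W (I_ 6) (I_ 3) [:: I_ 2; I_ 1] ->
  affine_equivalent (c4 W) (c6 W) (c4 (model X6321 k)) (c6 (model X6321 k)).
Proof.
move=> nW; have [sA sB _] := normalized_sizes char0 nW; move: sA sB.
have [c nzc [s1]] := third_node nW; have [s0] := second_node nW; prelude nW dW nzZ A B.
move=> /andP[/andP[_ nsA] /andP[sZ _]] /andP[/andP[_ nA] /andP[dZ _]] _ N0 N1 sA sB.
have [p [q [r [m [n [kap [nzp DA DB]]]]]]] := six_at_oo sA nsA sB sZ.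
have {sA nsA sB sZ} k0 : kap = 0.
  apply/eqP; apply: contraT => nzk; subst A B.
  have [nzx0 M0 F0 H0] := six_node nzp N0 nzk; have [nzx1 M1 F1 H1] := six_node nzp N1 nzk.
  move: (s0 - _) (s1 - _) nzx0 M0 F0 H0 nzx1 M1 F1 H1 => x0 x1 nzx0 M0 F0 H0 nzx1 M1 F1 H1.
  have e01 : x0 = x1.
    have /eqP : (x0 - x1) ^+ 3 = 0.
      apply: (eq_lin3 (c1 := - 1 / (2%:R * p)) (c2 := 1 / (2%:R * p))
        (c3 := 3%:R / (2%:R * p) * (x0 - x1)) F0 F1 (_ : 
        2%:R * p * (x0 ^+ 2 + 2%:R * r * x0 - n) + q * (m - q * x0) +
        (2%:R * p * (x1 ^+ 2 + 2%:R * r * x1 - n) + q * (m - q * x1)) = 0)).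
        by rewrite H0 H1 addr0.
      by field; nonzero.
    by rewrite expf_eq0 /= => /eqP/subr0_eq.
  subst x1; case/eqP: (mulf_neq0 (mulf_neq0 (mulf_neq0 (nz 1) nzp) nzc) nzx0).
  by apply: (eq_lin (c := - 1) (subr_eq0_of (etrans (esym M0) M1))) => //; ring.
subst kap A B; rewrite /six_c4 /six_c6 Poly_jdiscl in dZ nzZ nA *.
have Z_ := Poly_dvdXn dZ; have nza0 := Poly_ndvdX nA.
have nzn : n != 0.
  apply: contraNneq nzZ => n0; subst n; apply/eqP/Poly_eq0.
  have nzr : r != 0 by apply: contraNneq nza0 => ->; rewrite expr0n addr0.
  have /eqP : m ^+ 2 = 0 by from_coef (4%:R / (3%:R * r ^+ 2)) (Z_ 2%N isT).
  rewrite expf_eq0 /= => /eqP m0; subst m; rewrite /jdiscl /=.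
  by do 13?case => //=; move=> _; field; nonzero.
have Dn : n = - 3%:R / 4%:R * r ^+ 2 by from_coef (1 / n ^+ 2) (Z_ 0%N isT).
have nzr : r != 0 by apply: contraNneq nzn => r0; rewrite Dn r0 expr0n mulr0.
have Dm : m = - 3%:R / 2%:R * q * r.
  apply: (eq_lin2 (c1 := 1 / n ^+ 2) (c2 := - 2%:R * m / n ^+ 3) (Z_ 1%N isT) (Z_ 0%N isT)).
  by rewrite /jdiscl /=; field; nonzero.
subst n m.
have Dr : r = - q ^+ 2 / (2%:R * p) by from_coef (32%:R / (27%:R * r ^+ 4 * p)) (Z_ 2%N isT).
have nzq : q != 0 by apply: contraNneq nzr => q0; rewrite Dr q0 expr0n oppr0 mul0r.
subst r.
apply: (@affine_equivalent_Poly _ _ _ _ _ (q / (4%:R * p)) 0 (- q ^+ 2 / (16%:R * p))).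
- by rewrite mulf_neq0 ?invr_eq0 ?mulf_neq0 ?nz.
- by rewrite mulf_neq0 ?oppr_eq0 ?invr_eq0 ?mulf_neq0 ?expf_neq0 ?nz.
- seq_field.
- seq_field.
Qed.

(** After scaling, c4 is 1 + x1 X + x2 X^2 + x3 X^3 + X^4 up to constants. The contact
    conditions at 0 and at infinity each determine c6; comparing the two answers gives x3 = x1, which is
    excluded, or x3 = - x1 and x1 = 12 or -12. *)
Lemma unique_X5511 W : normalized W (I_ 5) (I_ 5) [:: I_ 1; I_ 1] ->
  affine_equivalent (c4 W) (c6 W) (c4 (model X5511 k)) (c6 (model X5511 k)).
Proof.
move=> nW; have [sA sB _] := normalized_sizes char0 nW; move: sA sB; prelude nW dW nzZ A B.
move=> /andP[/andP[_ nsA] /andP[sZ _]] /andP[/andP[_ nA] /andP[dZ _]] _ sA sB.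
have DA := Poly_size sA; have DB := Poly_size sB; rewrite /mkseq /= in DA DB.
move: A`_0 A`_1 A`_2 A`_3 A`_4 B`_0 B`_1 B`_2 B`_3 B`_4 B`_5 B`_6 DA DB.
move=> a0 a1 a2 a3 a4 b0 b1 b2 b3 b4 b5 b6 DA DB; subst A B.
have /= {nsA}nza4 := Poly_lead (erefl : size [:: a0; a1; a2; a3; a4] = 5) nsA.
have nza0 := Poly_ndvdX nA; rewrite Poly_jdiscl in sZ dZ nzZ.
have Zoo := Poly_size_le sZ; have Z_ := Poly_dvdXn dZ; clear sA sB nA sZ dZ dW.
have [s nzs [Da Db]] : exists2 s, s != 0 & a0 = s ^+ 2 /\ b0 = s ^+ 3.
  by apply: nodal0 nza0 _; from_coef (1 : k) (Z_ 0%N isT).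
have [p nzp [Da4 Db6]] : exists2 p, p != 0 & a4 = p ^+ 2 /\ b6 = p ^+ 3.
  by apply: nodal0 nza4 _; from_coef (1 : k) (Zoo 12%N isT).
have [al Dal] := closed_root (s / p) (isT : 0 < 2)%N.
have Dp : p = s / al ^+ 2 by rewrite Dal; field; nonzero.
have nzal : al != 0.
  apply: contraNneq nzs => al0; move/eqP: Dal; rewrite al0 expr0n /= eq_sym.
  by rewrite mulf_eq0 invr_eq0 (negPf nzp) orbF.
subst a0 b0 a4 b6 p.
pose x1 := a1 * al / s ^+ 2; pose x2 := a2 * al ^+ 2 / s ^+ 2; pose x3 := a3 * al ^+ 3 / s ^+ 2.
have Da1 : a1 = s ^+ 2 * x1 / al by rewrite /x1; field; nonzero.
have Da2 : a2 = s ^+ 2 * x2 / al ^+ 2 by rewrite /x2; field; nonzero.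
have Da3 : a3 = s ^+ 2 * x3 / al ^+ 3 by rewrite /x3; field; nonzero.
move: x1 x2 x3 Da1 Da2 Da3 => x1 x2 x3 Da1 Da2 Da3; subst a1 a2 a3.
have Db1 : b1 = s ^+ 3 / al * (3%:R / 2%:R * x1) by from_coef (- 1 / (2%:R * s ^+ 3)) (Z_ 1%N isT).
subst b1.
have Db2 : b2 = s ^+ 3 / al ^+ 2 * (3%:R / 2%:R * x2 + 3%:R / 8%:R * x1 ^+ 2).
  by from_coef (- 1 / (2%:R * s ^+ 3)) (Z_ 2%N isT).
subst b2.
have Db3 : b3 = s ^+ 3 / al ^+ 3 * (3%:R / 2%:R * x3 + 3%:R / 4%:R * x1 * x2 - 1 / 16%:R * x1 ^+ 3).
  by from_coef (- 1 / (2%:R * s ^+ 3)) (Z_ 3%N isT).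
subst b3.
pose y4 := 3%:R / 2%:R + 3%:R / 8%:R * (x2 ^+ 2 + 2%:R * x1 * x3) - 3%:R / 16%:R * x1 ^+ 2 * x2
  + 3%:R / 128%:R * x1 ^+ 4.
have Db4 : b4 = s ^+ 3 / al ^+ 4 * y4.
  by rewrite /y4; from_coef (- 1 / (2%:R * s ^+ 3)) (Z_ 4%N isT).
subst b4.
have Db5 : b5 = s ^+ 3 / al ^+ 5 * (3%:R / 2%:R * x3).
  by from_coef (- al ^+ 6 / (2%:R * s ^+ 3)) (Zoo 11%N isT).
subst b5.
have E10 : 3%:R / 2%:R * x2 + 3%:R / 8%:R * x3 ^+ 2 - y4 = 0.
  by from_coef (al ^+ 10 / (2%:R * s ^+ 6)) (Zoo 10%N isT).
have E9 : (x3 - x1) * (24%:R - 12%:R * x2 + x3 ^+ 2 + x1 * x3 + x1 ^+ 2) = 0.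
  apply: (eq_lin2 (c1 := - 8%:R * al ^+ 9 / s ^+ 6) (c2 := 24%:R * x3) (Zoo 9%N isT) E10).
  by rewrite /jdiscl /=; field; nonzero.
have E8 : 3%:R / 2%:R + 3%:R / 8%:R * (x2 ^+ 2 + 2%:R * x1 * x3) - 3%:R / 16%:R * x3 ^+ 2 * x2
  + 3%:R / 128%:R * x3 ^+ 4 - (3%:R / 2%:R * x2 + 3%:R / 8%:R * x1 ^+ 2) = 0.
  apply: (eq_lin3 (c1 := al ^+ 8 / (2%:R * s ^+ 6))
    (c2 := - (3%:R / 2%:R * x2 + 3%:R / 8%:R * x3 ^+ 2 + y4) / 2%:R)
    (c3 := - (3%:R / 2%:R * x3) * (- 1 / 16%:R))
    (Zoo 8%N isT) E10 E9).
  by rewrite /jdiscl /=; field; nonzero.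
rewrite {}/y4 in E10 Zoo Z_ nzZ *.
have ne13 : x3 - x1 != 0.
  apply: contraNneq nzZ => /subr0_eq e13; subst x3.
  have /eqP : (x1 ^+ 2 - 4%:R * x2 + 8%:R) ^+ 2 = 0.
    by apply: (eq_lin (c := - 128%:R / 3%:R) E10); field; nonzero.
  rewrite expf_eq0 /= => /eqP e2.
  have Dx2 : x2 = (x1 ^+ 2 + 8%:R) / 4%:R by apply: (eq_lin (c := - 1 / 4%:R) e2); field; nonzero.
  subst x2; apply/eqP/Poly_eq0; rewrite /jdiscl /=.
  by do 13?case => //=; move=> _; field; nonzero.
move/eqP: E9; rewrite mulf_eq0 (negPf ne13) /= => /eqP E9.
have : (x3 - x1) * (x3 + x1) * (16%:R - 8%:R * x2 + x1 ^+ 2 + x3 ^+ 2) = 0.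
  apply: (eq_lin2 (c1 := 128%:R / 3%:R) (c2 := 128%:R / 3%:R) E8 E10).
  by field; nonzero.
move/eqP; rewrite !mulf_eq0 (negPf ne13) /= => /orP[] /eqP e13; last first.
  case/eqP: (expf_neq0 2 ne13).
  by apply: (eq_lin2 (c1 := - 2%:R) (c2 := 3%:R) E9 e13); field; nonzero.
have D3 : x3 = - x1 by apply/eqP; rewrite -addr_eq0 e13.
subst x3; have Dx2 : x2 = 2%:R + x1 ^+ 2 / 12%:R.
  by apply: (eq_lin (c := - 1 / 12%:R) E9); field; nonzero.
subst x2.
have nzx1 : x1 != 0 by apply: contraNneq ne13 => ->; rewrite !oppr0 addr0.
have : (x1 - 12%:R) * (x1 + 12%:R) = 0.
  by apply: (eq_lin (c := - 96%:R / x1 ^+ 2) E10); field; nonzero.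
rewrite -[12%:R in X in _ * X]opprK => /eqP; rewrite mulf_eq0 => /orP[] /eqP/subr0_eq Dx1; subst x1.
  apply: (@affine_equivalent_Poly _ _ _ _ _ (- al) 0 (- s)).
  - by rewrite oppr_eq0.
  - by rewrite oppr_eq0.
  - seq_field.
  - seq_field.
apply: (@affine_equivalent_Poly _ _ _ _ _ al 0 (- s)).
- by [].
- by rewrite oppr_eq0.
- seq_field.
- seq_field.
Qed.

(** In k[X] units are (n+1)st powers, so that coprime factors of an (n+1)st power are
    (n+1)st powers themselves; the roots of r are distributed one at a time. *)
Lemma coprime_power (p q r : {poly k}) n : coprimep p q -> p * q = r ^+ n.+1 ->
  exists f, p = f ^+ n.+1.
Proof.
have [m] := ubnP (size r); elim: m => // m IH in p q r * => lt_m cpq Dpq.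
have [/size1_polyC Dr|gt1] := leqP (size r) 1.
  have [r0|nzr] := eqVneq (r`_0) 0.
    move/eqP: Dpq; rewrite Dr r0 polyC0 expr0n mulf_eq0 => /orP[/eqP->|/eqP q0].
      by exists 0; rewrite expr0n.
    move: cpq; rewrite q0 coprimep0 -size_poly_eq1 => /size_poly1P[c nzc ->].
    by have [y Dy] := closed_root c (ltn0Sn n); exists y%:P; rewrite -rmorphXn /= Dy.
  have : size (p * q) == 1 by rewrite Dpq Dr -rmorphXn /= size_polyC expf_neq0.
  rewrite size_mul_eq1 => /andP[/size_poly1P[c nzc ->] _].
  by have [y Dy] := closed_root c (ltn0Sn n); exists y%:P; rewrite -rmorphXn /= Dy.
have /closed_rootP[c rc] : size r != 1 by rewrite gtn_eqF.
have [r' Dr] := factor_theorem _ _ rc.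
have nzr : r != 0 by rewrite -size_poly_gt0 ltnW.
have nzX : ('X - c%:P) ^+ n.+1 != 0 by rewrite expf_neq0 // polyXsubC_eq0.
have lt_r' : (size r' < m)%N.
  have nzr' : r' != 0 by apply: contraNneq nzr => r'0; rewrite Dr r'0 mul0r.
  by move: lt_m; rewrite Dr size_mul ?polyXsubC_eq0 // size_XsubC addn2.
have: root (p * q) c by rewrite Dpq /root horner_exp (eqP rc) expr0n.
have dX (a b : {poly k}) : coprimep a b -> a * b = r ^+ n.+1 -> root a c ->
    exists2 a', a = a' * ('X - c%:P) ^+ n.+1 & a' * b = r' ^+ n.+1.
  move=> cab Dab ra; have : ('X - c%:P) ^+ n.+1 %| a.
    have : ('X - c%:P) ^+ n.+1 %| a * b by rewrite Dab Dr exprMn dvdp_mull.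
    rewrite Gauss_dvdpl // coprimep_pexpl // coprimep_sym coprimep_XsubC.
    exact: coprimep_root cab ra.
  case/dvdpP=> a' Da; exists a' => //; apply: (mulIf nzX).
  by rewrite -exprMn -Dr -Dab Da; ring.
rewrite rootM => /orP[] rpq.
  have [p' Dp Dp'q] := dX p q cpq Dpq rpq.
  have [|f Df] := IH p' q r' lt_r' _ Dp'q.
    by apply: coprimep_dvdr cpq; rewrite Dp dvdp_mulr.
  by exists (f * ('X - c%:P)); rewrite Dp Df exprMn.
have cqp : coprimep q p by rewrite coprimep_sym.
have [q' Dq Dq'p] := dX q p cqp (etrans (mulrC q p) Dpq) rpq.
have [|f Df] := IH p q' r' lt_r' _ (etrans (mulrC p q') Dq'p); last by exists f.
by apply: coprimep_dvdl cpq; rewrite Dq dvdp_mulr.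
Qed.

Lemma cube_root_unity : exists om : k, om ^+ 2 + om + 1 = 0.
Proof.
have [t Dt] := closed_root (- 3%:R : k) (isT : 0 < 2)%N.
exists ((t - 1) / 2%:R); apply: (eq_lin (c := 1 / 4%:R) (subr_eq0_of Dt)); field; nonzero.
Qed.

Lemma jdisc_two_points (A B : {poly k}) (c d : k) m n : c != 0 -> d != 0 -> c != d ->
  'X^m %| jdisc A B -> ord_ge c n (jdisc A B) -> ord_ge d n (jdisc A B) ->
  (size (jdisc A B) <= (m + 2 * n).+1)%N ->
  exists de : k, jdisc A B = de%:P * ('X^m * (('X - c%:P) * ('X - d%:P)) ^+ n).
Proof.
move: (jdisc A B) => Z nzc nzd ncd d0 dc dd szZ.
have cX (a : k) : a != 0 -> coprimep 'X ('X - a%:P).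
  by move=> nza; rewrite coprimep_XsubC /root hornerX.
have cE : coprimep 'X^m (('X - c%:P) ^+ n * ('X - d%:P) ^+ n).
  by rewrite coprimepMr !(coprimep_expl, coprimep_expr) ?cX.
have cE2 : coprimep (('X - c%:P) ^+ n) (('X - d%:P) ^+ n).
  by rewrite coprimep_expl // coprimep_expr // coprimep_XsubC2 // subr_eq0 eq_sym.
have /dvdpP[q Dq] : 'X^m * (('X - c%:P) ^+ n * ('X - d%:P) ^+ n) %| Z.
  by rewrite Gauss_dvdp // d0 Gauss_dvdp // [_ %| Z]dc.
have [q0|nzq] := eqVneq q 0; first by exists 0; rewrite Dq q0 polyC0 !mul0r.
exists q`_0; rewrite -size1_polyC ?Dq ?exprMn //.
have nzE (a : k) : ('X - a%:P) ^+ n != 0 by rewrite expf_neq0 // polyXsubC_eq0.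
have nzX : 'X^m != 0 :> {poly k} by rewrite -size_poly_eq0 size_polyXn.
move: szZ; rewrite Dq !size_mul ?mulf_neq0 // !size_exp_XsubC size_polyXn.
by move: (size q) => sq; lia.
Qed.

Lemma four_points (T1 T2 : kodaira) n W : normalized W T1 T2 [:: I_ n.+2; I_ n.+2] ->
  exists c d : k, [/\ c != 0, d != 0, c != d &
  [/\ (c4 W).[c] != 0, ord_ge c n.+2 (jdisc (c4 W) (c6 W)),
      (c4 W).[d] != 0 & ord_ge d n.+2 (jdisc (c4 W) (c6 W))]].
Proof.
case=> dW _ _ _ [[|c [|d [|]]] //]; rewrite /= ?andbF // !inE !negb_or.
rewrite andbT => /andP[/andP[]]; rewrite ![0 == _]eq_sym => nzc nzd ncd.
have nA (a : k) : ~~ ord_ge a 1 (c4 W) -> (c4 W).[a] != 0 by rewrite /ord_ge expr1 -root_factor_theorem.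
rewrite !andbT /= => /andP[/andP[/andP[_ cA] /andP[cZ _]] /andP[/andP[_ dA] /andP[dZ _]]].
by exists c, d; split=> //; split; rewrite ?nA -?ord_disc.
Qed.

Lemma cubes_equal (x y : k) : x ^+ 3 = y ^+ 3 -> x != 0 -> exists2 z, z ^+ 3 = 1 & y = z * x.
Proof.
move=> e nzx; exists (y / x); last by rewrite divfK.
by rewrite expr_div_n -e divff // expf_neq0.
Qed.

(** When c4 is known only through its cube, the cube root of unity is absorbed by lam. *)
Lemma affine_equivalent_unity (z : k) (T B A' B' : {poly k}) : z ^+ 3 = 1 ->
  affine_equivalent T B A' B' -> affine_equivalent (z%:P * T) B A' B'.
Proof.
move=> z3; apply: affine_equivalent_trans.
exists 1, 0, (z ^+ 2); rewrite scale1r polyC0 addr0 !comp_polyXr; split.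
- exact: oner_neq0.
- by rewrite expf_neq0 //; apply: contraNneq (oner_neq0 k) => e0; rewrite -z3 e0 expr0n.
- have -> : (z ^+ 2) ^+ 2 = z by rewrite -[RHS]mul1r -z3; ring.
  by rewrite mul_polyC.
- have -> : (z ^+ 2) ^+ 3 = 1 by rewrite -[RHS](expr1n _ 2) -z3; ring.
  by rewrite scale1r.
Qed.

Lemma size_cube_root (Q : {poly k}) : Q ^+ 3 \in degle 6 -> (size Q <= 3)%N.
Proof.
rewrite degleE; have := size_exp Q 3; move: (size (Q ^+ 3)) (size Q) => a b; clear; lia.
Qed.

Definition cubel (s : seq k) := mull s (mull s s).

Lemma Poly_cubel s : Poly (cubel s) = Poly s ^+ 3.
Proof. by rewrite !Poly_mull; ring. Qed.

(** The condition on Q1^3 - Q2^3 says that it is X^2 times a quadratic polynomial. Comparing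
    the two extreme coefficients at each end shows that Q2 arises from Q1 = u0 + u2 X^2
    by multiplying the coefficients by two distinct cube roots of unity. *)
Lemma two_quadratics (u0 u1 u2 v0 v1 v2 : k)
    (Q1 := Poly [:: u0; u1; u2]) (Q2 := Poly [:: v0; v1; v2]) :
  (Q1 * Q2)`_0 != 0 -> (Q1 * Q2)`_4 != 0 ->
  (forall j, (j < 2)%N || (4 < j)%N -> (Q1 ^+ 3 - Q2 ^+ 3)`_j = 0) -> Q1 ^+ 3 - Q2 ^+ 3 != 0 ->
  affine_equivalent (Q1 * Q2) (2%:R^-1%:P * (Q1 ^+ 3 + Q2 ^+ 3))
    (Poly (model_c4 X4422 k)) (Poly (model_c6 X4422 k)).
Proof.
rewrite /Q1 /Q2 => nz0 nz4; rewrite -Poly_mull !coef_Poly /= in nz0 nz4.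
have nzu0 : u0 != 0 by apply: contraNneq nz0 => ->; rewrite !mul0r addr0.
have nzv0 : v0 != 0 by apply: contraNneq nz0 => ->; rewrite mulr0 addr0.
have nzu2 : u2 != 0 by apply: contraNneq nz4 => ->; apply/eqP; ring.
have nzv2 : v2 != 0 by apply: contraNneq nz4 => ->; apply/eqP; ring.
have -> : Poly [:: u0; u1; u2] ^+ 3 - Poly [:: v0; v1; v2] ^+ 3 =
  Poly (addl (cubel [:: u0; u1; u2]) (scl (-1) (cubel [:: v0; v1; v2]))).
  by rewrite Poly_addl Poly_scl !Poly_cubel polyCN polyC1 mulN1r.
move=> EQ nzD; have E_ j : (j < 2)%N || (4 < j)%N ->
    (addl (cubel [:: u0; u1; u2]) (scl (-1) (cubel [:: v0; v1; v2])))`_j = 0.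
  by move=> hj; rewrite -coef_Poly; apply: EQ hj.
have [z0 z03 Dv0] : exists2 z, z ^+ 3 = 1 & v0 = z * u0.
  by apply: cubes_equal nzu0; apply: (eq_lin (c := 1) (E_ 0%N isT)); rewrite /=; ring.
have [z2 z23 Dv2] : exists2 z, z ^+ 3 = 1 & v2 = z * u2.
  by apply: cubes_equal nzu2; apply: (eq_lin (c := 1) (E_ 6%N isT)); rewrite /=; ring.
have nzz0 : z0 != 0 by apply: contraNneq nzv0 => e0; rewrite Dv0 e0 mul0r.
have nzz2 : z2 != 0 by apply: contraNneq nzv2 => e0; rewrite Dv2 e0 mul0r.
subst v0 v2.
have Dv1 : v1 = z0 * u1.
  apply: (eq_lin2 (c1 := - z0 / (3%:R * u0 ^+ 2)) (c2 := - v1) (E_ 1%N isT) (subr_eq0_of z03)).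
  by rewrite /=; field; nonzero.
subst v1.
have : (z0 - z2) * u1 = 0.
  apply: (eq_lin2 (c1 := - z2 / (3%:R * u2 ^+ 2)) (c2 := - z0 * u1) (E_ 5%N isT) (subr_eq0_of z23)).
  by rewrite /=; field; nonzero.
move/eqP; rewrite mulf_eq0 => /orP[/eqP/subr0_eq e02|/eqP e1].
  case/eqP: nzD; rewrite Poly_addl Poly_scl !Poly_cubel polyCN polyC1 mulN1r.
  have -> : Poly [:: z0 * u0; z0 * u1; z2 * u2] = z0%:P * Poly [:: u0; u1; u2].
    by rewrite -e02 -Poly_scl.
  by rewrite exprMn -rmorphXn /= z03 polyC1 mul1r subrr.
subst u1; have [e02|ne02] := eqVneq z0 z2.
  case/eqP: nzD; rewrite Poly_addl Poly_scl !Poly_cubel polyCN polyC1 mulN1r.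
  have -> : Poly [:: z0 * u0; z0 * 0; z2 * u2] = z0%:P * Poly [:: u0; 0; u2].
    by rewrite -e02 -Poly_scl.
  by rewrite exprMn -rmorphXn /= z03 polyC1 mul1r subrr.
pose et := z2 / z0; have Dz2 : z2 = et * z0 by rewrite divfK.
have et0 : et ^+ 2 + et + 1 = 0.
  have ne1 : (et - 1) * z0 ^+ 3 != 0.
    rewrite mulf_neq0 ?expf_neq0 //; apply: contraNneq ne02 => /subr0_eq e.
    by rewrite Dz2 e mul1r.
  apply: (mulfI ne1); rewrite mulr0.
  by apply: (eq_lin2 (c1 := 1) (c2 := - 1) (subr_eq0_of z23) (subr_eq0_of z03)); rewrite Dz2; ring.
have nzet : et != 0 by rewrite mulf_neq0 ?invr_eq0.
move: et Dz2 et0 nzet => et Dz2 et0 nzet; subst z2.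
have [al Dal] := closed_root (16%:R * et * u0 / u2) (isT : 0 < 2)%N.
have nzal : al != 0.
  apply: contraTneq (isT : true) => al0; move/eqP: Dal; rewrite al0 expr0n /= eq_sym.
  by rewrite !mulf_eq0 invr_eq0 (negPf nzu0) (negPf nzu2) (negPf nzet) (negPf (nz 15)).
have Du2 : u2 = 16%:R * et * u0 / al ^+ 2 by rewrite Dal; field; nonzero.
subst u2.
have -> : Poly [:: z0 * u0; z0 * 0; et * z0 * (16%:R * et * u0 / al ^+ 2)] =
  z0%:P * Poly [:: u0; 0; et * (16%:R * et * u0 / al ^+ 2)].
  rewrite -Poly_scl; congr Poly; rewrite /=; congr [:: _; _; _]; ring.
rewrite mulrCA exprMn -rmorphXn /= z03 polyC1 mul1r; apply: affine_equivalent_unity z03 _.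
rewrite -Poly_mull -!Poly_cubel -Poly_addl -Poly_scl.
apply: (@affine_equivalent_Poly _ _ _ _ _ al 0 (- u0)) => //; first by rewrite oppr_eq0.
  rewrite /affl /scl /=; repeat (congr (_ :: _)).
  - by field; nonzero.
  - by field; nonzero.
  - by apply: (eq_lin (c := 16%:R * u0 ^+ 2) et0); field; nonzero.
  - by field; nonzero.
  - by apply: (eq_lin (c := 256%:R * u0 ^+ 2 * (et - 1)) et0); field; nonzero.
rewrite /affl /scl /=; repeat (congr (_ :: _)).
- by field; nonzero.
- by field; nonzero.
- by apply: (eq_lin (c := 24%:R * u0 ^+ 3) et0); field; nonzero.
- by field; nonzero.
- by apply: (eq_lin (c := 384%:R * u0 ^+ 3 * (et ^+ 2 - et + 1)) et0); field; nonzero.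
- by field; nonzero.
- apply: (eq_lin (c := 2048%:R * u0 ^+ 3 * (et - 1) * (et ^+ 3 + 2%:R)) et0); field; nonzero.
Qed.

(** The discriminant is a constant times a square, so c4^3 = (c6 - E) (c6 + E) for some E; both factors
    are coprime since c4 does not vanish at the zeros of E. They are therefore cubes of quadratic
    polynomials Q1 and Q2, and c4 = Q1 Q2 up to a cube root of unity, 2 c6 = Q1^3 + Q2^3. *)
Lemma unique_X4422 W : normalized W (I_ 4) (I_ 4) [:: I_ 2; I_ 2] ->
  affine_equivalent (c4 W) (c6 W) (c4 (model X4422 k)) (c6 (model X4422 k)).
Proof.
move=> nW; have [sA sB _] := normalized_sizes char0 nW; move: sA sB.
have [c [d [nzc nzd ncd []]]] := four_points nW; prelude nW dW nzZ A B.
move=> /andP[/andP[_ nsA] /andP[sZ _]] /andP[/andP[_ nA] /andP[dZ0 _]] _ cA cZ dA dZ sA sB.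
have [de DZ] := jdisc_two_points nzc nzd ncd dZ0 cZ dZ sZ.
have [ep Dep] := closed_root (- de) (isT : 0 < 2)%N.
pose E := ep%:P * ('X^2 * (('X - c%:P) * ('X - d%:P))).
have jE : jdisc A B = - E ^+ 2.
  by rewrite DZ /E -[de]opprK -Dep rmorphN rmorphXn /=; ring.
have DE : A ^+ 3 = (B - E) * (B + E).
  by transitivity (jdisc A B + B ^+ 2); [rewrite /jdisc subrK | rewrite jE; ring].
have nzA0 : A.[0] != 0 by move: nA; rewrite expr1 -['X]subr0 -polyC0 -root_factor_theorem.
have nzE : E != 0 by apply: contraNneq nzZ => E0; rewrite jE E0 expr0n oppr0.
have cop : coprimep (B - E) (B + E).
  apply/Pdiv.ClosedField.coprimepP => x; rewrite rootE hornerD hornerN subr_eq0 => /eqP BE.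
  rewrite hornerD BE -mulr2n -mulr_natl mulf_eq0 negb_or nz /=.
  apply/negP => E0; have: (A ^+ 3).[x] = 0.
    by rewrite DE hornerM hornerD hornerN BE subrr mul0r.
  rewrite horner_exp => /eqP; rewrite expf_eq0 /= => /eqP Ax.
  move: E0; rewrite /E !(hornerM, hornerC, hornerX, hornerXsubC) !mulf_eq0 !subr_eq0 -!orbA.
  case/orP=> [/eqP e0|]; last case/or4P=> /eqP e0.
  - by case/eqP: nzE; rewrite /E e0 polyC0 mul0r.
  - by move: Ax nzA0; rewrite e0 => ->; rewrite eqxx.
  - by move: Ax nzA0; rewrite e0 => ->; rewrite eqxx.
  - by rewrite -e0 Ax eqxx in cA.
  - by rewrite -e0 Ax eqxx in dA.
have [Q1 DQ1] := coprime_power cop (esym DE).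
have cop' : coprimep (B + E) (B - E) by rewrite coprimep_sym.
have DE' : (B + E) * (B - E) = A ^+ 3 by rewrite DE mulrC.
have [Q2 DQ2] := coprime_power cop' DE'; clear cop cop' DE'.
have [om om0] := cube_root_unity.
have om0P : om%:P ^+ 2 + om%:P + 1 = 0 by rewrite -rmorphXn -polyC1 -!rmorphD /= om0.
have om3 : om ^+ 3 = 1 by apply: (eq_lin (c := om - 1) om0); ring.
have [ze ze3 DA] : exists2 ze : k, ze ^+ 3 = 1 & A = ze%:P * (Q1 * Q2).
  have : (A - Q1 * Q2) * (A - om%:P * (Q1 * Q2)) * (A - om%:P ^+ 2 * (Q1 * Q2)) = 0.
    transitivity (A ^+ 3 - (Q1 * Q2) ^+ 3 + (om%:P ^+ 2 + om%:P + 1) *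
      (om%:P * A * (Q1 * Q2) ^+ 2 - A ^+ 2 * (Q1 * Q2) - (om%:P - 1) * (Q1 * Q2) ^+ 3)); first by ring.
    by rewrite om0P mul0r addr0 exprMn -DQ1 -DQ2 -DE subrr.
  move/eqP; rewrite !mulf_eq0 -orbA => /or3P[] /eqP/subr0_eq DA.
  - by exists 1; rewrite ?expr1n // polyC1 mul1r.
  - by exists om.
  - by exists (om ^+ 2); rewrite ?rmorphXn // -exprM mulnC exprM om3 expr1n.
rewrite DA; apply: affine_equivalent_unity ze3 _.
have DB : B = 2%:R^-1%:P * (Q1 ^+ 3 + Q2 ^+ 3).
  rewrite -DQ1 -DQ2 (_ : B - E + (B + E) = 2%:R%:P * B); last by rewrite polyC_nat; ring.
  by rewrite mulrA -polyCM mulVf ?polyC1 ?mul1r // nz.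
have d1 (a : k) : 'X - a%:P \in degle 1 by rewrite degleE size_XsubC.
have d2 : ('X^2 : {poly k}) \in degle 2 by rewrite degleE size_polyXn.
have d0 : ep%:P \in degle 0 by rewrite degleE size_polyC_leq1.
have sE : (size E <= 5)%N := degleM d0 (degleM d2 (degleM (d1 c) (d1 d))).
have dB : B \in degle 6 by []. have dE : E \in degle 6 by apply: leq_trans sE _.
have sQ1 : (size Q1 <= 3)%N by apply: size_cube_root; rewrite -DQ1; exact: degleB dB dE.
have sQ2 : (size Q2 <= 3)%N by apply: size_cube_root; rewrite -DQ2; exact: degleD dB dE.
have nzQ0 : (Q1 * Q2)`_0 != 0.
  by move: nzA0; rewrite horner_coef0 DA coefCM mulf_eq0 negb_or => /andP[].
have nzQ4 : (Q1 * Q2)`_4 != 0.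
  have : A`_4 != 0.
    apply: contraNneq nsA => e4; apply/leq_sizeP => j; rewrite leq_eqVlt => /predU1P[<- //|lt4].
    by rewrite nth_default // (leq_trans sA).
  by rewrite DA coefCM mulf_eq0 negb_or => /andP[].
have EQ j : (j < 2)%N || (4 < j)%N -> (Q1 ^+ 3 - Q2 ^+ 3)`_j = 0.
  move=> hj; rewrite -DQ1 -DQ2 (_ : B - E - (B + E) = (- 2%:R)%:P * E); last first.
    by rewrite polyCN polyC_nat; ring.
  rewrite coefCM [E`_j](_ : _ = 0) ?mulr0 //; case/orP: hj => hj.
    by rewrite /E mulrCA coefXnM hj.
  by rewrite nth_default // (leq_trans sE).
have DQ1' := Poly_size sQ1; have DQ2' := Poly_size sQ2; rewrite /mkseq /= in DQ1' DQ2'.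
have nzD : Q1 ^+ 3 - Q2 ^+ 3 != 0.
  rewrite -DQ1 -DQ2 (_ : B - E - (B + E) = (- 2%:R)%:P * E); last by rewrite polyCN polyC_nat; ring.
  by rewrite mulf_neq0 // polyC_eq0 oppr_eq0 nz.
rewrite DB; move: DQ1' DQ2' nzQ0 nzQ4 EQ nzD; clear -char0 nz.
move: Q1`_0 Q1`_1 Q1`_2 Q2`_0 Q2`_1 Q2`_2 => u0 u1 u2 v0 v1 v2 -> ->.
exact: two_quadratics.
Qed.

(** Writing Q1 - Q0 = g X + g0, the relation between the squares gives Q0, Q1 and Q2 in terms of g, g0
    and one more parameter h, and an affine substitution removes g and g0. *)
Lemma three_quadratics (om x0 y0 x1 y1 x2 y2 p : k) (B : {poly k})
    (Q0 := Poly [:: x0; y0; p]) (Q1 := Poly [:: x1; y1; p]) (Q2 := Poly [:: x2; y2; p]) :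
  om ^+ 2 + om + 1 = 0 -> p != 0 -> Q1 != Q0 ->
  Q0 ^+ 2 + om%:P * Q1 ^+ 2 + (om ^+ 2)%:P * Q2 ^+ 2 = 0 ->
  B ^+ 2 = (Q0 * Q1 * Q2) ^+ 2 ->
  affine_equivalent (3%:R^-1%:P * (Q0 ^+ 2 + Q1 ^+ 2 + Q2 ^+ 2)) B
    (Poly (model_c4 X3333 k)) (Poly (model_c6 X3333 k)).
Proof.
move=> e nzp; rewrite /Q0 /Q1 /Q2 => ne01 EQ DB.
have R_ j : (addl (mull [:: x0; y0; p] [:: x0; y0; p])
    (addl (scl om (mull [:: x1; y1; p] [:: x1; y1; p]))
    (scl (om ^+ 2) (mull [:: x2; y2; p] [:: x2; y2; p]))))`_j = 0.
  by rewrite -coef_Poly Poly_addl Poly_mull Poly_addl !Poly_scl !Poly_mull -!expr2 addrA EQ coef0.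
have nzom : om != 0.
  apply: contraNneq (oner_neq0 k) => om0; apply/eqP; move: e; rewrite om0 => <-; ring.
have nzom1 : om - 1 != 0.
  apply: contraNneq (nz 2) => om1; apply/eqP; apply: (eq_lin2 (c1 := 1) (c2 := - (om + 2%:R)) e om1); ring.
pose g := y1 - y0; pose g0 := x1 - x0; pose h := om * (x1 - x0) + om ^+ 2 * (x2 - x0).
have Dy1 : y1 = y0 + g by rewrite /g; ring.
have Dx1 : x1 = x0 + g0 by rewrite /g0; ring.
have Dx2 : x2 = x0 + om * h - om ^+ 2 * g0.
  by apply: (eq_lin (c := - (x2 - x0) * (om - 1)) e); rewrite /h /g0; ring.
have Dy2 : y2 = y0 - om ^+ 2 * g.
  apply: (eq_lin2 (c1 := om / (2%:R * p)) (c2 := - (om - 1) * y2 - y0) (R_ 3%N) e).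
  by rewrite /g /=; field; nonzero.
move: g g0 h Dy1 Dx1 Dx2 Dy2 => g g0 h Dy1 Dx1 Dx2 Dy2; subst x1 y1 x2 y2.
have F2 : 2%:R * h * p = om ^+ 2 * g ^+ 2.
  apply: (eq_lin2 (c1 := 1) (c2 := - (y0 ^+ 2 - 2%:R * y0 * g * om * (om - 1) +
    g ^+ 2 * (1 + (om - 1) * (om ^+ 3 + 1)) + 2%:R * p * x0 + 2%:R * p * (om - 1) * (h - om * g0))) (R_ 2%N) e).
  by rewrite /=; ring.
have F1 : h * y0 = om ^+ 2 * g * (g0 + h).
  apply: (eq_lin2 (c1 := 1 / 2%:R) (c2 := - (x0 * y0 - om * (om - 1) * (x0 * g + g0 * y0) +
    g0 * g * (1 + (om - 1) * (om ^+ 3 + 1)) + (om - 1) * h * y0 - (om - 1) * om ^+ 2 * h * g)) (R_ 1%N) e).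
  by rewrite /=; field; nonzero.
have F0 : 2%:R * h * x0 = om ^+ 2 * g0 ^+ 2 + 2%:R * om ^+ 2 * h * g0 - om * h ^+ 2.
  apply: (eq_lin2 (c1 := 1) (c2 := - (x0 ^+ 2 - 2%:R * om * (om - 1) * x0 * g0 +
    g0 ^+ 2 * (1 + (om - 1) * (om ^+ 3 + 1)) +
    (om - 1) * (om * h ^+ 2 + 2%:R * x0 * h - 2%:R * om ^+ 2 * h * g0))) (R_ 0%N) e).
  by rewrite /=; ring.
have nzh : h != 0.
  apply: contraNneq ne01 => h0; subst h; move: F2 F0; rewrite !(mulr0, mul0r, expr0n, subr0, addr0) /=.
  move=> /esym/eqP; rewrite mulf_eq0 !expf_eq0 (negPf nzom) /= => /eqP ->.
  by move=> /esym/eqP; rewrite mulf_eq0 !expf_eq0 (negPf nzom) /= => /eqP ->; rewrite !addr0.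
have Dp : p = om ^+ 2 * g ^+ 2 / (2%:R * h) by rewrite -F2; field; nonzero.
have nzg : g != 0 by apply: contraNneq nzp => g_0; rewrite Dp g_0 expr0n mulr0 mul0r.
have Dy0 : y0 = om ^+ 2 * g * (g0 + h) / h by rewrite -F1; field; nonzero.
have Dx0 : x0 = (om ^+ 2 * g0 ^+ 2 + 2%:R * om ^+ 2 * h * g0 - om * h ^+ 2) / (2%:R * h).
  by rewrite -F0; field; nonzero.
clear F2 F1 F0 R_ EQ ne01 nzp; subst p y0 x0.
pose al := 3%:R * h * (om - 1) / g; pose be := (- h - g0) / g.
have nzal : al != 0 by rewrite !mulf_neq0 ?invr_eq0 ?nz.
move: DB; set Q_0 := Poly [:: _ / _; _; _]; set Q_1 := Poly [:: _ / _ + g0; _; _]; set Q_2 := Poly _.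
have C0 : Q_0 \Po (al *: 'X + be%:P) = Poly [:: h / 2%:R; 0; - 27%:R * h / 2%:R].
  rewrite -Poly_affl; congr Poly; rewrite /affl /al /be /=; repeat (congr (_ :: _)).
  - by apply: (eq_lin (c := - h / 2%:R) e); field; nonzero.
  - by field; nonzero.
  - by apply: (eq_lin (c := 9%:R * h / 2%:R * (om ^+ 2 - 3%:R * om + 3%:R)) e); field; nonzero.
have C1 : Q_1 \Po (al *: 'X + be%:P) = Poly [:: - h / 2%:R; 3%:R * h * (om - 1); - 27%:R * h / 2%:R].
  rewrite -Poly_affl; congr Poly; rewrite /affl /al /be /=; repeat (congr (_ :: _)).
  - by apply: (eq_lin (c := - h / 2%:R) e); field; nonzero.
  - by field; nonzero.
  - by apply: (eq_lin (c := 9%:R * h / 2%:R * (om ^+ 2 - 3%:R * om + 3%:R)) e); field; nonzero.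
have C2 : Q_2 \Po (al *: 'X + be%:P) = Poly [:: - h / 2%:R; 3%:R * h * (om ^+ 2 - 1); - 27%:R * h / 2%:R].
  rewrite -Poly_affl; congr Poly; rewrite /affl /al /be /=; repeat (congr (_ :: _)).
  - by apply: (eq_lin (c := h / 2%:R) e); field; nonzero.
  - by apply: (eq_lin (c := - 3%:R * h * (om - 1)) e); field; nonzero.
  - by apply: (eq_lin (c := 9%:R * h / 2%:R * (om ^+ 2 - 3%:R * om + 3%:R)) e); field; nonzero.
move: Q_0 Q_1 Q_2 al be nzal C0 C1 C2 => P0 P1 P2 al be nzal C0 C1 C2 DB.
have CA : (3%:R^-1%:P * (P0 ^+ 2 + P1 ^+ 2 + P2 ^+ 2)) \Po (al *: 'X + be%:P) =
    (h / 2%:R) ^+ 2 *: Poly (model_c4 X3333 k).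
  rewrite !expr2 !(comp_polyM, comp_polyD) comp_polyC C0 C1 C2.
  rewrite -!Poly_mull -!Poly_addl -Poly_scl -mul_polyC -Poly_scl.
  congr Poly; rewrite /=; repeat (congr (_ :: _)).
  - by field; nonzero.
  - by apply: (eq_lin (c := - h ^+ 2) e); field; nonzero.
  - by apply: (eq_lin (c := 3%:R * h ^+ 2 * (om ^+ 2 - om - 1)) e); field; nonzero.
  - by apply: (eq_lin (c := - 27%:R * h ^+ 2) e); field; nonzero.
  - by field; nonzero.
have CB : (P0 * P1 * P2) \Po (al *: 'X + be%:P) = (- (h / 2%:R)) ^+ 3 *: Poly (model_c6 X3333 k).
  rewrite !comp_polyM C0 C1 C2 -!Poly_mull -mul_polyC -Poly_scl.
  congr Poly; rewrite /=; repeat (congr (_ :: _)).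
  - by field; nonzero.
  - by apply: (eq_lin (c := - 3%:R / 4%:R * h ^+ 3) e); field; nonzero.
  - by apply: (eq_lin (c := 9%:R / 2%:R * h ^+ 3 * (om - 2%:R)) e); field; nonzero.
  - by field; nonzero.
  - by apply: (eq_lin (c := - 27%:R * 9%:R / 2%:R * h ^+ 3 * (om - 2%:R)) e); field; nonzero.
  - by apply: (eq_lin (c := 27%:R * 81%:R / 4%:R * h ^+ 3) e); field; nonzero.
  - by field; nonzero.
have nzh2 : h / 2%:R != 0 by rewrite mulf_neq0 ?invr_eq0 ?nz.
move/eqP: DB; rewrite eqf_sqr => /orP[] /eqP ->.
  by exists al, be, (- (h / 2%:R)); split; rewrite ?oppr_eq0 ?CA ?sqrrN.
exists al, be, (h / 2%:R); split; rewrite ?CA //.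
by rewrite linearN /= CB -scaleNr; congr (_ *: _); ring.
Qed.

Lemma size_square_root (Q : {poly k}) : Q ^+ 2 \in degle 4 -> (size Q <= 3)%N.
Proof.
rewrite degleE; have := size_exp Q 2; move: (size (Q ^+ 2)) (size Q) => a b; clear; lia.
Qed.

Lemma square_root_lead (Q : {poly k}) (p : k) : Q ^+ 2 \in degle 4 -> (Q ^+ 2)`_4 = p ^+ 2 ->
  exists2 R, R ^+ 2 = Q ^+ 2 & exists x y, R = Poly [:: x; y; p].
Proof.
move=> dQ; have sQ := size_square_root dQ; have DQ := Poly_size sQ; rewrite /mkseq /= in DQ.
move: Q`_0 Q`_1 Q`_2 DQ {dQ sQ} => x y z ->; rewrite {1}expr2 -Poly_mull coef_Poly /=.
rewrite -expr2 => /eqP; rewrite eqf_sqr => /orP[]/eqP ->.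
  by exists (Poly [:: x; y; p]) => //; exists x, y.
exists (Poly [:: - x; - y; p]); last by exists (- x), (- y).
rewrite -(sqrrN (Poly _)); congr (_ ^+ 2); rewrite -mulN1r -polyC1 -polyCN -Poly_scl /scl /=.
by congr Poly; congr [:: _; _; _]; ring.
Qed.

(** The discriminant is a constant times a cube, so c6^2 is the product of the c4 - om^i E for some
    E, where om is a primitive cube root of unity. These factors are pairwise coprime, hence squares of
    quadratic polynomials, whose weighted sum with weights 1, om, om^2 vanishes. *)
Lemma unique_X3333 W : normalized W (I_ 3) (I_ 3) [:: I_ 3; I_ 3] ->
  affine_equivalent (c4 W) (c6 W) (c4 (model X3333 k)) (c6 (model X3333 k)).
Proof.
move=> nW; have [sA sB _] := normalized_sizes char0 nW; move: sA sB.
have [c [d [nzc nzd ncd []]]] := four_points nW; prelude nW dW nzZ A B.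
move=> /andP[/andP[_ nsA] /andP[sZ _]] /andP[/andP[_ nA] /andP[dZ0 _]] _ cA cZ dA dZ sA sB.
have [de DZ] := jdisc_two_points nzc nzd ncd dZ0 cZ dZ sZ.
have [ep Dep] := closed_root de (isT : 0 < 3)%N.
pose R := 'X * (('X - c%:P) * ('X - d%:P)) : {poly k}; pose E := ep%:P * R.
have jE : jdisc A B = E ^+ 3.
  by rewrite DZ /E -Dep rmorphXn /R !exprMn.
have nzA0 : A.[0] != 0 by move: nA; rewrite expr1 -['X]subr0 -polyC0 -root_factor_theorem.
have nzE : E != 0 by apply: contraNneq nzZ => E0; rewrite jE E0 expr0n.
have noroot x : E.[x] = 0 -> A.[x] != 0.
  move/eqP; rewrite /E /R !(hornerM, hornerC, hornerX, hornerXsubC) !mulf_eq0 !subr_eq0.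
  case/or4P=> /eqP e0; rewrite ?e0 //.
  by case/eqP: nzE; rewrite /E e0 polyC0 mul0r.
have sE : (size E <= 4)%N.
  have d1 (a : k) : 'X - a%:P \in degle 1 by rewrite degleE size_XsubC.
  have dX : ('X : {poly k}) \in degle 1 by rewrite degleE size_polyX.
  have d0 : ep%:P \in degle 0 by rewrite degleE size_polyC_leq1.
  exact: degleM d0 (degleM dX (degleM (d1 c) (d1 d))).
have nzA4 : A`_4 != 0.
  apply: contraNneq nsA => e4; apply/leq_sizeP => j; rewrite leq_eqVlt => /predU1P[<- //|lt4].
  by rewrite nth_default // (leq_trans sA).
clear DZ Dep nzA0 sB sZ dZ0 cZ dZ cA dA nsA nA nzc nzd ncd dW.
move: (E) jE nzE noroot sE => {R}{}E jE nzE noroot sE.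
pose f (a : k) := A - a%:P * E.
have cop a b : a != b -> coprimep (f a) (f b).
  move=> nab; apply/Pdiv.ClosedField.coprimepP => x; rewrite rootE /f !hornerD !hornerN !hornerM !hornerC.
  rewrite subr_eq0 => /eqP Ax; rewrite Ax -mulrBl mulf_neq0 ?subr_eq0 //.
  by apply/eqP => Ex; have := noroot x Ex; rewrite Ax Ex mulr0 eqxx.
have [om om0] := cube_root_unity.
have om0P : om%:P ^+ 2 + om%:P + 1 = 0 by rewrite -rmorphXn -polyC1 -!rmorphD /= om0.
have nzom : om != 0.
  apply: contraNneq (oner_neq0 k) => e; apply/eqP; move: om0; rewrite e => <-; ring.
have ne1 : om != 1.
  apply: contraNneq (nz 2) => om1; apply/eqP.
  by apply: (eq_lin2 (c1 := 1) (c2 := - (om + 2%:R)) om0 (subr_eq0_of om1)); ring.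
have ne2 : om ^+ 2 != 1.
  apply: contraNneq (nz 2) => e; apply/eqP.
  apply: (eq_lin2 (c1 := 2%:R - om) (c2 := om - 1) om0 (subr_eq0_of e)); ring.
have ne12 : om ^+ 2 != om.
  by apply: contraNneq ne1 => e; apply/eqP/(mulfI nzom); rewrite mulr1 -expr2.
have DB : f 1 * f om * f (om ^+ 2) = B ^+ 2.
  transitivity (A ^+ 3 - E ^+ 3); last by rewrite -jE /jdisc; ring.
  transitivity (A ^+ 3 - E ^+ 3 + (om%:P ^+ 2 + om%:P + 1) *
      (om%:P * A * E ^+ 2 - A ^+ 2 * E - (om%:P - 1) * E ^+ 3)).
    by rewrite /f rmorphXn polyC1 /=; ring.
  by rewrite om0P mul0r addr0.
have sq a b e : a != b -> a != e -> f a * (f b * f e) = B ^+ 2 -> exists Q, f a = Q ^+ 2.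
  move=> nab nae; apply: coprime_power; by rewrite coprimepMr !cop.
have df a : f a \in degle 4.
  apply: degleB => //; rewrite mul_polyC; apply: degleZ; exact: leq_trans sE _.
have f4 a : (f a)`_4 = A`_4.
  by rewrite /f coefB coefCM [E`_4]nth_default ?mulr0 ?subr0.
have [p Dp] := closed_root A`_4 (isT : 0 < 2)%N.
have nzp : p != 0 by apply: contraNneq nzA4 => p0; rewrite -Dp p0 expr0n.
have root a b e : a != b -> a != e -> f a * (f b * f e) = B ^+ 2 ->
    exists2 Q, f a = Q ^+ 2 & exists x y, Q = Poly [:: x; y; p].
  move=> nab nae De; have [Q DQ] := sq a b e nab nae De.
  have [||Q' DQ' xy] := @square_root_lead Q p; rewrite -?DQ ?f4 //.
  by exists Q'; rewrite // DQ'.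
have [ne1' ne2' ne12'] : [/\ 1 != om, 1 != om ^+ 2 & om != om ^+ 2].
  by rewrite ![1 == _]eq_sym [om == _]eq_sym.
have DB0 : f 1 * (f om * f (om ^+ 2)) = B ^+ 2 by rewrite mulrA.
have DB1 : f om * (f 1 * f (om ^+ 2)) = B ^+ 2 by rewrite mulrCA mulrA.
have DB2 : f (om ^+ 2) * (f 1 * f om) = B ^+ 2 by rewrite mulrC.
have [Q0 D0 [x0 [y0 DQ0]]] := root 1 om (om ^+ 2) ne1' ne2' DB0.
have [Q1 D1 [x1 [y1 DQ1]]] := root om 1 (om ^+ 2) ne1 ne12' DB1.
have [Q2 D2 [x2 [y2 DQ2]]] := root (om ^+ 2) 1 om ne2 ne12 DB2.
have DA : A = 3%:R^-1%:P * (Q0 ^+ 2 + Q1 ^+ 2 + Q2 ^+ 2).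
  rewrite -D0 -D1 -D2 /f polyC1 rmorphXn /=.
  transitivity (3%:R^-1%:P * (3%:R%:P * A - (om%:P ^+ 2 + om%:P + 1) * E)).
    by rewrite om0P mul0r subr0 mulrA -polyCM mulVf ?polyC1 ?mul1r // nz.
  by rewrite polyC_nat; ring.
rewrite DA; subst Q0 Q1 Q2; apply: (three_quadratics om0 nzp).
- apply: contraNneq nzE => e01; have : (om - 1)%:P * E = 0.
    by transitivity (f 1 - f om); [rewrite /f rmorphB polyC1 /=; ring | rewrite D0 D1 e01 subrr].
  by move/eqP; rewrite mulf_eq0 polyC_eq0 subr_eq0 (negPf ne1).
- rewrite -D0 -D1 -D2 /f polyC1 rmorphXn /=.
  transitivity ((om%:P ^+ 2 + om%:P + 1) * (A - (om%:P ^+ 2 - om%:P + 1) * E)); first by ring.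
  by rewrite om0P mul0r.
- by rewrite -DB D0 D1 D2 !exprMn.
Qed.

(** Here c4 = 0, and c6 is a nonzero multiple of X, while that of the model is a multiple of
    another linear polynomial. *)
Lemma unique_X22 W (q c : k) : q ^+ 4 = 3%:R -> c ^+ 3 = 2%:R ->
  normalized W IIstar II [::] ->
  affine_equivalent (c4 W) (c6 W) (c4 (model22 q c)) (c6 (model22 q c)).
Proof.
move=> q4 c3 nW; rewrite c4_model22 // c6_model22 //.
have [_ _ nzZ] := normalized_sizes char0 nW; case: nW => dW _; unfold_kodaira dW.
move: (c4 W) (c6 W) nzZ => A B nzZ /and3P[sA /andP[sB nsB] _] /and3P[dA /andP[dB _] _] _.
have DA := Poly_size sA; have DB := Poly_size sB; rewrite /mkseq /= in DA DB.
move: A`_0 B`_0 B`_1 DA DB => a0 b0 b1 DA DB; subst A B.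
have /= {nsB}nzb1 := Poly_lead (erefl : size [:: b0; b1] = 2) nsB.
have /= a00 := Poly_dvdXn dA (isT : 0 < 1)%N.
have /= b00 := Poly_dvdXn dB (isT : 0 < 1)%N; subst a0 b0.
have PA : Poly [:: 0] = 0 :> {poly k} by rewrite Poly_cons mul0r add0r.
have nzq : q != 0.
  by apply/eqP=> q0; have := nz 2; rewrite -q4 q0 expr0n eqxx.
rewrite -PA.
apply: (@affine_equivalent_Poly _ _ _ _ _ (- 864%:R / b1) (- 24%:R * q ^+ 2 / b1) 1) => //.
- nonzero.
- exact: oner_neq0.
- by seq_field.
- by seq_field.
Qed.

(** Here c4 = 0, and c6 is a nonzero multiple of X^2, while that of the model is a multiple of
    (1 + 3 q^2 X)^2. *)
Lemma unique_X44 W (q c : k) : q ^+ 4 = 3%:R -> c ^+ 3 = 2%:R ->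
  normalized W IVstar IV [::] ->
  affine_equivalent (c4 W) (c6 W) (c4 (model44 q c)) (c6 (model44 q c)).
Proof.
move=> q4 c3 nW; rewrite c4_model44 // c6_model44 //.
have [_ _ nzZ] := normalized_sizes char0 nW; case: nW => dW _; unfold_kodaira dW.
move: (c4 W) (c6 W) nzZ => A B nzZ /and3P[sA /andP[sB nsB] _] /and3P[dA /andP[dB _] _] _.
have DA := Poly_size sA; have DB := Poly_size sB; rewrite /mkseq /= in DA DB.
move: A`_0 A`_1 B`_0 B`_1 B`_2 DA DB => a0 a1 b0 b1 b2 DA DB; subst A B.
have /= {nsB}nzb2 := Poly_lead (erefl : size [:: b0; b1; b2] = 3) nsB.
have /= a00 := Poly_dvdXn dA (isT : 0 < 2)%N.
have /= a10 := Poly_dvdXn dA (isT : 1 < 2)%N.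
have /= b00 := Poly_dvdXn dB (isT : 0 < 2)%N.
have /= b10 := Poly_dvdXn dB (isT : 1 < 2)%N; subst a0 a1 b0 b1.
have PA : Poly [:: 0; 0] = 0 :> {poly k} by apply: Poly_eq0 => -[|[|j]].
have nzq : q != 0.
  by apply/eqP=> q0; have := nz 2; rewrite -q4 q0 expr0n eqxx.
have [be Dbe] := closed_root (- 24%:R * q ^+ 2 / b2) (isT : 0 < 2)%N.
have nzbe : be != 0.
  by apply/eqP=> be0; move: Dbe; rewrite be0 expr0n => /esym/eqP; apply/negP; nonzero.
have {Dbe} Db2 : b2 = - 24%:R * q ^+ 2 / be ^+ 2 by rewrite Dbe; field; nonzero.
subst b2; rewrite -PA.
apply: (@affine_equivalent_Poly _ _ _ _ _ (3%:R * q ^+ 2 * be) be 1) => //.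
- nonzero.
- exact: oner_neq0.
- by seq_field.
- by seq_field.
Qed.

(** Here c6 = 0, and c4 is a nonzero multiple of X. *)
Lemma unique_X33 W (a e : k) :
  a ^+ 2 = 6%:R -> a * e = e ^+ 2 + 1 -> e ^+ 4 = 4%:R * e ^+ 2 - 1 ->
  normalized W IIIstar III [::] ->
  affine_equivalent (c4 W) (c6 W) (c4 (model33 a e)) (c6 (model33 a e)).
Proof.
move=> a2 ae e4 nW; rewrite c4_model33 // c6_model33 //.
have [_ _ nzZ] := normalized_sizes char0 nW; case: nW => dW _; unfold_kodaira dW.
move: (c4 W) (c6 W) nzZ => A B nzZ /and3P[/andP[sA nsA] sB _] /and3P[/andP[dA _] dB _] _.
have DA := Poly_size sA; have DB := Poly_size sB; rewrite /mkseq /= in DA DB.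
move: A`_0 A`_1 B`_0 B`_1 DA DB => a0 a1 b0 b1 DA DB; subst A B.
have /= {nsA}nza1 := Poly_lead (erefl : size [:: a0; a1] = 2) nsA.
have /= a00 := Poly_dvdXn dA (isT : 0 < 1)%N.
have /= b00 := Poly_dvdXn dB (isT : 0 < 2)%N.
have /= b10 := Poly_dvdXn dB (isT : 1 < 2)%N; subst a0 b0 b1.
have PB : Poly [:: 0; 0] = 0 :> {poly k} by apply: Poly_eq0 => -[|[|j]].
rewrite -PB.
apply: (@affine_equivalent_Poly _ _ _ _ _ (- 96%:R / a1) ((12%:R - 24%:R * e ^+ 2) / a1) 1) => //.
- nonzero.
- exact: oner_neq0.
- by seq_field.
- by seq_field.
Qed.

End Uniqueness.

(** * Vanishing of invariants is preserved by isomorphism *)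

Section IsomorphismInvariants.
Variable k : closedFieldType.
Hypothesis char0 : [pchar k] =i pred0.
Implicit Types W S : weierstrass {poly k}.

Lemma singular_fibres_swap S T1 T2 :
  singular_fibres S [:: T1; T2] -> singular_fibres S [:: T2; T1].
Proof.
case=> [[|P1 [|P2 [|P3 ps]]]] [] //=; rewrite ?andbF // inE andbT => ne /and3P[k1 k2 _] others.
exists [:: P2; P1]; split; rewrite /= ?inE ?andbT 1?eq_sym ?k1 ?k2 // => P.
by rewrite !inE orbC => nP; apply: others; rewrite !inE.
Qed.

Lemma homog_lin_eq0 i (p : {poly k}) a b c d : p \in degle i -> a * d - b * c != 0 ->
  homog i p (lin a b) (lin c d) = 0 -> p = 0.
Proof.
move=> hp nzd e0; have := homog_adj a b c d hp; rewrite e0 homog0 => /esym/eqP.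
by rewrite scaler_eq0 expf_eq0 (negPf nzd) andbF => /eqP.
Qed.

Lemma isomorphic_c4_c6_eq0 W S : has_degrees W -> isomorphic W S ->
  (c4 S = 0 <-> c4 W = 0) /\ (c6 S = 0 <-> c6 W = 0).
Proof.
move=> dW [a [b [c [d [u [r [s [w [nzd nzu _ /admissible_changeP E]]]]]]]]].
have := congr1 (@c4 _) E; have := congr1 (@c6 _) E.
rewrite c6_rescale c6_shift c4_rescale c4_shift !pullbackE homog_c4 // homog_c6 // => E6 E4.
have nzU n : u%:P ^+ n != 0 :> {poly k} by rewrite expf_neq0 // polyC_eq0.
split; split=> e0; rewrite e0 ?mulr0 ?homog0 in E4 E6.
- exact: homog_lin_eq0 (degle_c4 dW) nzd (esym E4).
- by move/eqP: E4; rewrite mulf_eq0 (negPf (nzU _)) => /eqP.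
- exact: homog_lin_eq0 (degle_c6 dW) nzd (esym E6).
- by move/eqP: E6; rewrite mulf_eq0 (negPf (nzU _)) => /eqP.
Qed.
End IsomorphismInvariants.

(** * The obstruction over the integers at 3 and 2 *)

Section ReductionModPrimes.

Lemma closed_field_of_pchar (p : nat) : prime p -> exists F : closedFieldType, p \in [pchar F].
Proof.
move=> p_pr; have [F [FtoK _]] := countable_algebraic_closure 'F_p.
by exists F; rewrite (fmorph_pchar FtoK) pchar_Fp.
Qed.

Lemma poly_int_dvd (F : closedFieldType) (n : nat) (p : {poly int}) : n \in [pchar F] ->
  map_poly (intr : int -> F) p = 0 -> exists q, p = n%:R * q.
Proof.
move=> chF p0; exists (map_poly (fun x => x %/ n)%Z p); apply/polyP=> i.
rewrite mulr_natl coefMn coef_map_id0 ?div0z // -mulr_natr natz.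
have /eqP := congr1 (fun q : {poly F} => q`_i) p0.
by rewrite coef_map /= coef0 -(dvdz_pcharf chF) => /divzK.
Qed.

Variable W : weierstrass {poly int}.
Hypothesis elliptic : forall F : closedFieldType, elliptic_surface (base_change (intr : int -> F) W).

Let disc_neq0 (F : closedFieldType) : disc (base_change (intr : int -> F) W) != 0.
Proof. by have [_ + _] := elliptic F. Qed.

Let mapped (F : closedFieldType) :
  [/\ b2 (base_change (intr : int -> F) W) = map_poly (intr : int -> F) (b2 W),
      b4 (base_change (intr : int -> F) W) = map_poly (intr : int -> F) (b4 W) &
      b6 (base_change (intr : int -> F) W) = map_poly (intr : int -> F) (b6 W)].
Proof. by split; rewrite /b2 /b4 /b6 /=; ring. Qed.

(** If b2^2 = 24 b4, then 3 divides b2, hence also b4, and then the discriminant. *)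
Lemma c4_neq0_of_elliptic_over_int : c4 W != 0.
Proof.
apply/eqP=> c40; have [F ch3] := closed_field_of_pchar (isT : prime 3).
have n3 : 3%:R = 0 :> {poly F} by rewrite -(rmorph_nat (@polyC F)) (pcharf0 ch3) rmorph0.
have e4 : b2 W ^+ 2 = 24%:R * b4 W by apply/subr0_eq.
have b20 : map_poly (intr : int -> F) (b2 W) = 0.
  have /eqP := congr1 (map_poly (intr : int -> F)) e4.
  by rewrite rmorphXn rmorphM rmorph_nat (natrM _ 8 3) n3 mulr0 mul0r expf_eq0 => /eqP.
have [be Dbe] := poly_int_dvd ch3 b20.
have e4' : 3%:R * be ^+ 2 = 8%:R * b4 W.
  apply: (@mulfI _ (3%:R : {poly int})); first by rewrite -(rmorph_nat (@polyC int)) polyC_eq0.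
  have -> : 3%:R * (3%:R * be ^+ 2) = (3%:R * be) ^+ 2 by ring.
  by rewrite -Dbe e4; ring.
have b40 : map_poly (intr : int -> F) (b4 W) = 0.
  have /(congr1 (map_poly (intr : int -> F))) := e4'; rewrite !rmorphM !rmorph_nat n3 mul0r.
  rewrite (_ : 8 = 3 + 3 + 3 - 1)%N // natrB // !natrD n3 !addr0 sub0r mulN1r.
  by move=> /esym/eqP; rewrite oppr_eq0 => /eqP.
have [m2 m4 _] := mapped F; have /eqP[] := disc_neq0 F.
by rewrite /disc m2 m4 b20 b40 (natrM _ 3 9) n3; ring.
Qed.

(** If c6 = 0, then 2 divides b2, hence a1, so that b2 = 4 be and b4 = 2 ga; dividing the relation by 8
    shows that 2 divides b6, and then the discriminant. *)
Lemma c6_neq0_of_elliptic_over_int : c6 W != 0.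
Proof.
apply/eqP=> c60; have [F ch2] := closed_field_of_pchar (isT : prime 2).
have n2 : 2%:R = 0 :> {poly F} by rewrite -(rmorph_nat (@polyC F)) (pcharf0 ch2) rmorph0.
have b20 : map_poly (intr : int -> F) (b2 W) = 0.
  have /eqP := congr1 (map_poly (intr : int -> F)) c60; rewrite rmorph0 /c6.
  move: (b2 W) (b4 W) (b6 W) => x y z; rewrite [X in X == _](_ : _ =
    - map_poly intr x ^+ 3 + 2%:R * map_poly (intr : int -> F) (18%:R * x * y - 108%:R * z)).
    by rewrite n2 mul0r addr0 oppr_eq0 expf_eq0 => /eqP.
  by ring.
have a10 : map_poly (intr : int -> F) (a1 W) = 0.
  have /eqP := b20; rewrite /b2; move: (a1 W) (a2 W) => x y; rewrite [X in X == _](_ : _ =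
    map_poly intr x ^+ 2 + 2%:R * map_poly (intr : int -> F) (2%:R * y)); last by ring.
  by rewrite n2 mul0r addr0 expf_eq0 => /eqP.
have [al Dal] := poly_int_dvd ch2 a10.
pose be := al ^+ 2 + a2 W; have Dbe : b2 W = 4%:R * be by rewrite /b2 Dal /be; ring.
pose ga := al * a3 W + a4 W; have Dga : b4 W = 2%:R * ga by rewrite /b4 Dal /ga; ring.
have e6 : 27%:R * b6 W = 2%:R * (18%:R * be * ga - 4%:R * be ^+ 3).
  apply: (@mulfI _ (8%:R : {poly int})); first by rewrite -(rmorph_nat (@polyC int)) polyC_eq0.
  apply/eqP; rewrite -subr_eq0 -oppr_eq0 -c60 /c6 Dbe Dga; apply/eqP; ring.
have b60 : map_poly (intr : int -> F) (b6 W) = 0.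
  have /(congr1 (map_poly (intr : int -> F))) := e6; rewrite !(rmorphM, rmorph_nat) n2 mul0r.
  by rewrite (_ : 27 = 2 * 13 + 1)%N // natrD natrM n2 mul0r add0r mul1r.
have [m2 _ m6] := mapped F; have /eqP[] := disc_neq0 F.
by rewrite /disc m2 m6 b20 b60 (natrM _ 2 4) n2; ring.
Qed.

End ReductionModPrimes.

(** * Rings of integers inside an algebraically closed field *)

Section CharacteristicZero.
Variable k : fieldType.
Hypothesis char0 : [pchar k] =i pred0.

Lemma intr_char0_eq0 (n : int) : (n%:~R == 0 :> k) = (n == 0).
Proof.
have /pcharf0P nat0 := char0; case: n => n.
  by rewrite -pmulrn nat0.
by rewrite NegzE mulrNz oppr_eq0 oppr_eq0 -pmulrn nat0.
Qed.

Lemma intr_char0_inj : injective (intr : int -> k).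
Proof.
by move=> m n /eqP; rewrite -subr_eq0 -rmorphB intr_char0_eq0 subr_eq0 => /eqP.
Qed.

(** The value of [ratr] does not depend on the reduced form of a fraction, which makes it compatible
    with sums and products. *)
Lemma ratr_div (n d : int) : d != 0 -> @ratr k (n%:~R / d%:~R) = n%:~R / d%:~R.
Proof.
move=> nzd; pose x : rat := n%:~R / d%:~R.
have E : numq x * d = n * denq x.
  apply: (@intr_inj rat); rewrite !rmorphM /= numqE.
  by rewrite mulrAC /x divfK ?intr_eq0.
rewrite /ratr -/x; apply/eqP; rewrite eqr_div ?intr_char0_eq0 ?denq_eq0 //.
by rewrite -!rmorphM /= E.
Qed.

Lemma rat_embedding : exists iota : {rmorphism rat -> k}, forall n, iota n%:~R = n%:~R.
Proof.
have nz_den x : (denq x)%:~R != 0 :> rat by rewrite intr_eq0 denq_eq0.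
have nz_denk x : (denq x)%:~R != 0 :> k by rewrite intr_char0_eq0 denq_eq0.
have zm : zmod_morphism (@ratr k).
  move=> x y; have -> : x - y = (numq x * denq y - numq y * denq x)%:~R / (denq x * denq y)%:~R.
    rewrite -{1}[x]divq_num_den -{1}[y]divq_num_den rmorphB !rmorphM /=; field.
    by rewrite !nz_den.
  rewrite ratr_div ?mulf_neq0 ?denq_eq0 // /ratr rmorphB !rmorphM /=; field.
  by rewrite !nz_denk.
have mm : monoid_morphism (@ratr k).
  split=> [|x y]; first by rewrite -[1 in LHS](divr1 1) (ratr_div 1 (oner_neq0 _)) divr1.
  have -> : x * y = (numq x * numq y)%:~R / (denq x * denq y)%:~R.
    rewrite -{1}[x]divq_num_den -{1}[y]divq_num_den !rmorphM /=; field.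
    by rewrite !nz_den.
  rewrite ratr_div ?mulf_neq0 ?denq_eq0 // /ratr !rmorphM /=; field.
  by rewrite !nz_denk.
pose zm_mixin := GRing.isZmodMorphism.Build rat k (@ratr k) zm.
pose mm_mixin := GRing.isMonoidMorphism.Build rat k (@ratr k) mm.
pose iota : {rmorphism rat -> k} := HB.pack (@ratr k) zm_mixin mm_mixin.
by exists iota => n; apply: rmorph_int.
Qed.

(** The field Q(z), as the quotient of Q[X] by a polynomial of least degree vanishing
    at z, together with its inclusion in k. *)
Lemma number_field_embedding (iota : {rmorphism rat -> k}) (z : k) : algebraicOver iota z ->
  exists K : fieldExtType rat, exists f : {rmorphism K -> k},
    forall q : {poly rat}, exists x, f x = (map_poly iota q).[z].
Proof.
move=> [p0 nz0 p0z].
pose P n := `[< exists p : {poly rat}, [/\ p != 0, root (map_poly iota p) z & size p = n] >].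
have exP : exists n, P n by exists (size p0); apply/asboolP; exists p0.
case: (ex_minnP exP) => n /asboolP[p [nzp pz Dn]] min_n.
have irr_p : irreducible_poly p.
  apply/(subfx_irreducibleP pz nzp) => q qz nzq; rewrite Dn; apply: min_n.
  by apply/asboolP; exists q.
exists (SubFieldExtType pz irr_p), (@subfx_inj _ _ iota z p) => q.
by exists (subfx_eval iota z p q); apply: subfx_inj_eval.
Qed.

Lemma integralOver_embedding (K : fieldExtType rat) (f : {rmorphism K -> k}) x :
  integralOver (intr : int -> k) (f x) -> integralOver (intr : int -> K) x.
Proof.
move=> [p mon_p px]; exists p => //; rewrite -(fmorph_root f) -map_poly_comp.
by rewrite (@eq_map_poly _ _ _ (intr : int -> k)) // => n /=; rewrite rmorph_int.
Qed.

(** The ring of integers of Q(z) contains the elements of Q(z) that are integral in k. *)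
Lemma number_ring_embedding (z : k) : integralOver (intr : int -> k) z ->
  exists (K : fieldExtType rat) (phi : {rmorphism ring_of_integers K -> k}),
  exists iota : {rmorphism rat -> k}, injective phi /\
    forall q : {poly rat}, integralOver (intr : int -> k) (map_poly iota q).[z] ->
      exists x, phi x = (map_poly iota q).[z].
Proof.
move=> [p mon_p pz]; have [iota iotaZ] := rat_embedding.
have alg : algebraicOver iota z.
  exists (map_poly intr p); first by rewrite monic_neq0 // monic_map.
  by rewrite -map_poly_comp (@eq_map_poly _ _ _ (intr : int -> k)).
have [K [f fE]] := number_field_embedding alg.
exists K, (f \o (\val : ring_of_integers K -> K)), iota; split.
  by move=> x y /fmorph_inj /val_inj.
move=> q intq; have [x Dx] := fE q.
have ix : x \in @algebraic_integer K.
  by apply/asboolP; apply: (@integralOver_embedding _ f); rewrite Dx.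
by exists (RingOfIntegers ix).
Qed.
End CharacteristicZero.

(** * Existence and non-existence of strong models *)

Section StrongModels.
Variable k : closedFieldType.
Implicit Types (S : weierstrass {poly k}).

Lemma isomorphic_model c S : has_model c -> surface_of_type c S -> isomorphic (model c k) S.
Proof.
move=> hc [char0 [[dS nzD _] _] fib].
case: c hc fib => // _ fib; have [W nW] := normalize char0 dS nzD fib;
  apply; try exact: has_degrees_model.
- exact: unique_X211.
- exact: unique_X321.
- exact: unique_X431.
- exact: unique_X411.
- exact: unique_X141.
- exact: unique_X222.
- exact: unique_X9111.
- exact: unique_X8211.
- exact: unique_X5511.
- exact: unique_X6321.
- exact: unique_X4422.
- exact: unique_X3333.
Qed.

(** The equations have integer coefficients, hence make sense over any R. *)
Lemma has_strong_model_of_model c S (R : comNzRingType) (phi : {rmorphism R -> k}) :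
  injective phi -> has_model c -> surface_of_type c S -> has_strong_model R S.
Proof.
move=> inj_phi hc cS; exists (model c R); split; last first.
  by move=> F psi; rewrite base_change_model; apply: elliptic_surface_model.
split; first exact: has_degrees_model.
by exists phi; split=> //; rewrite base_change_model; apply: isomorphic_model.
Qed.

Lemma isomorphic_X22 S (q c : k) : q ^+ 4 = 3%:R -> c ^+ 3 = 2%:R ->
  surface_of_type X22 S -> isomorphic (model22 q c) S.
Proof.
move=> q4 c3 [char0 [[dS nzD _] _] /singular_fibres_swap fib].
have [W nW] := normalize char0 dS nzD fib; apply; first exact: has_degrees_model22.
exact: unique_X22.
Qed.

Lemma isomorphic_X44 S (q c : k) : q ^+ 4 = 3%:R -> c ^+ 3 = 2%:R ->
  surface_of_type X44 S -> isomorphic (model44 q c) S.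
Proof.
move=> q4 c3 [char0 [[dS nzD _] _] /singular_fibres_swap fib].
have [W nW] := normalize char0 dS nzD fib; apply; first exact: has_degrees_model44.
exact: unique_X44.
Qed.

Lemma isomorphic_X33 S (a e : k) :
  a ^+ 2 = 6%:R -> a * e = e ^+ 2 + 1 -> e ^+ 4 = 4%:R * e ^+ 2 - 1 ->
  surface_of_type X33 S -> isomorphic (model33 a e) S.
Proof.
move=> a2 ae e4 [char0 [[dS nzD _] _] /singular_fibres_swap fib].
have [W nW] := normalize char0 dS nzD fib; apply; first exact: has_degrees_model33.
exact: unique_X33.
Qed.

Lemma exists_q_c : exists q c : k, q ^+ 4 = 3%:R /\ c ^+ 3 = 2%:R.
Proof.
have [q Dq] := closed_root (3%:R : k) (isT : 0 < 4)%N.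
by have [c Dc] := closed_root (2%:R : k) (isT : 0 < 3)%N; exists q, c.
Qed.

(** The solution e is a square root of 2 + sqrt 3, and a = (e^2 + 1) / e. *)
Lemma exists_a_e : exists a e : k,
  [/\ a ^+ 2 = 6%:R, a * e = e ^+ 2 + 1, e ^+ 4 = 4%:R * e ^+ 2 - 1 & a = 5%:R * e - e ^+ 3].
Proof.
have [t Dt] := closed_root (3%:R : k) (isT : 0 < 2)%N.
have [e De] := closed_root (2%:R + t) (isT : 0 < 2)%N.
have e4 : e ^+ 4 = 4%:R * e ^+ 2 - 1.
  rewrite (exprM e 2 2) De; apply: (eq_lin (c := 1) (e := t ^+ 2 - 3%:R)); first by rewrite Dt subrr.
  ring.
have {}e4' : e ^+ 4 - (4%:R * e ^+ 2 - 1) = 0 by rewrite e4 subrr.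
exists (5%:R * e - e ^+ 3), e; split=> //.
  by apply: (eq_lin (c := e ^+ 2 - 6%:R) e4'); ring.
by apply: (eq_lin (c := -1) e4'); ring.
Qed.

Lemma integral_radical n m (x : k) : (0 < n)%N -> x ^+ n = m%:R -> integralOver (intr : int -> k) x.
Proof.
move=> n_gt0 Dx; exists ('X^n - (m%:Z)%:P); first exact: monicXnsubC.
by rewrite rmorphB /= map_polyXn map_polyC /root !hornerE Dx subrr.
Qed.

(** The product z = q c generates both: z^4 = 3 c^4 = 6 c and z^9 = c^9 q^9 = 72 q. *)
Lemma number_ring_q_c (q c : k) : [pchar k] =i pred0 -> q ^+ 4 = 3%:R -> c ^+ 3 = 2%:R ->
  exists (K : fieldExtType rat) (phi : {rmorphism ring_of_integers K -> k}),
    injective phi /\ exists q' c', [/\ phi q' = q, phi c' = c, q' ^+ 4 = 3%:R & c' ^+ 3 = 2%:R].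
Proof.
move=> char0 q4 c3.
have iq : integralOver (intr : int -> k) q by apply: (@integral_radical 4 3).
have ic : integralOver (intr : int -> k) c by apply: (@integral_radical 3 2).
have [K [phi [iota [inj_phi onto]]]] := number_ring_embedding char0 (integral_mul iq ic).
have ev m n : (map_poly iota (m%:R^-1 *: 'X^n)).[q * c] = m%:R^-1 * (q * c) ^+ n.
  by rewrite map_polyZ map_polyXn !hornerE /= fmorphV rmorph_nat.
have Eq : (map_poly iota (72%:R^-1 *: 'X^9)).[q * c] = q.
  rewrite ev exprMn (exprM c 3 3) c3 (exprD q 1 8) (exprM q 4 2) q4.
  by field; apply: (nat_neq0 char0).
have Ec : (map_poly iota (6%:R^-1 *: 'X^4)).[q * c] = c.
  by rewrite ev exprMn (exprD c 3 1) c3 q4; field; apply: (nat_neq0 char0).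
have [|q' Dq] := onto (72%:R^-1 *: 'X^9); first by rewrite Eq.
have [|c' Dc] := onto (6%:R^-1 *: 'X^4); first by rewrite Ec.
exists K, phi; split=> //; exists q', c'; split.
- by rewrite Dq Eq.
- by rewrite Dc Ec.
- by apply: inj_phi; rewrite rmorphXn Dq Eq q4 rmorph_nat.
by apply: inj_phi; rewrite rmorphXn Dc Ec c3 rmorph_nat.
Qed.

Lemma number_ring_a_e (a e : k) : [pchar k] =i pred0 ->
  a ^+ 2 = 6%:R -> a * e = e ^+ 2 + 1 -> e ^+ 4 = 4%:R * e ^+ 2 - 1 -> a = 5%:R * e - e ^+ 3 ->
  exists (K : fieldExtType rat) (phi : {rmorphism ring_of_integers K -> k}),
    injective phi /\ exists a' e', [/\ phi a' = a, phi e' = e &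
      [/\ a' ^+ 2 = 6%:R, a' * e' = e' ^+ 2 + 1 & e' ^+ 4 = 4%:R * e' ^+ 2 - 1]].
Proof.
move=> char0 a2 ae e4 Da.
have ie : integralOver (intr : int -> k) e.
  exists ('X^4 + (- (4%:R *: 'X^2) + 1)).
    have lt_size : (size ((- (4%:R *: 'X^2) + 1)%R : {poly int}) < size ('X^4 : {poly int}))%N.
      rewrite size_polyXn ltnS; apply: leq_trans (size_polyD _ _) _.
      by rewrite geq_max size_polyN size_poly1 andbT (leq_trans (size_scale_leq _ _)) ?size_polyXn.
    by rewrite monicE lead_coefDl ?lead_coefXn.
  rewrite !rmorphD rmorphN /= map_polyZ !map_polyXn rmorph1 /root !hornerE /= e4.
  by rewrite rmorph_nat; apply/eqP; ring.
have [K [phi [iota [inj_phi onto]]]] := number_ring_embedding char0 ie.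
have [|e'] := onto 'X; first by rewrite map_polyX hornerX.
rewrite map_polyX hornerX => De.
have Da' : phi (5%:R * e' - e' ^+ 3) = a by rewrite rmorphB rmorphM rmorphXn rmorph_nat De.
exists K, phi; split=> //; exists (5%:R * e' - e' ^+ 3), e'; split=> //.
move: (5%:R * _ - _) Da' => a' Da'; split; apply: inj_phi.
- by rewrite rmorphXn Da' a2 rmorph_nat.
- by rewrite rmorphM rmorphD rmorph1 rmorphXn Da' De.
- by rewrite rmorphXn rmorphB rmorphM rmorph_nat rmorph1 rmorphXn De.
Qed.

Lemma has_strong_model_X22 S : surface_of_type X22 S ->
  exists K : fieldExtType rat, has_strong_model (ring_of_integers K) S.
Proof.
move=> tS; have [char0 _ _] := tS; have [q [c [q4 c3]]] := exists_q_c.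
have [K [phi [inj_phi [q' [c' [Dq Dc q4' c3']]]]]] := number_ring_q_c char0 q4 c3.
exists K, (model22 q' c'); split.
  split; first exact: has_degrees_model22.
  by exists phi; rewrite base_change_model22 Dq Dc; split=> //; apply: isomorphic_X22.
move=> F psi; rewrite base_change_model22.
by apply: elliptic_surface_model22; rewrite -rmorphXn (q4', c3') rmorph_nat.
Qed.

Lemma has_strong_model_X44 S : surface_of_type X44 S ->
  exists K : fieldExtType rat, has_strong_model (ring_of_integers K) S.
Proof.
move=> tS; have [char0 _ _] := tS; have [q [c [q4 c3]]] := exists_q_c.
have [K [phi [inj_phi [q' [c' [Dq Dc q4' c3']]]]]] := number_ring_q_c char0 q4 c3.
exists K, (model44 q' c'); split.
  split; first exact: has_degrees_model44.
  by exists phi; rewrite base_change_model44 Dq Dc; split=> //; apply: isomorphic_X44.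
move=> F psi; rewrite base_change_model44.
by apply: elliptic_surface_model44; rewrite -rmorphXn (q4', c3') rmorph_nat.
Qed.

Lemma has_strong_model_X33 S : surface_of_type X33 S ->
  exists K : fieldExtType rat, has_strong_model (ring_of_integers K) S.
Proof.
move=> tS; have [char0 _ _] := tS; have [a [e [a2 ae e4 Da]]] := exists_a_e.
have [K [phi [inj_phi [a' [e' [Da' De [a2' ae' e4']]]]]]] := number_ring_a_e char0 a2 ae e4 Da.
exists K, (model33 a' e'); split.
  split; first exact: has_degrees_model33.
  by exists phi; rewrite base_change_model33 Da' De; split=> //; apply: isomorphic_X33.
move=> F psi; rewrite base_change_model33; apply: elliptic_surface_model33.
- by rewrite -rmorphXn a2' rmorph_nat.
- by rewrite -rmorphM ae' rmorphD rmorph1 rmorphXn.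
- by rewrite -rmorphXn e4' rmorphB rmorphM rmorph_nat rmorph1 rmorphXn.
Qed.

Lemma additive_c4_c6 c S : List.In c [:: X22; X33; X44] -> surface_of_type c S ->
  c4 S = 0 \/ c6 S = 0.
Proof.
have [q [c' [q4 c3]]] := exists_q_c; have [a [e [a2 ae e4 _]]] := exists_a_e.
case=> [<-|[<-|[<-|//]]] tS.
- have [[_ E] _] := isomorphic_c4_c6_eq0 (has_degrees_model22 q c') (isomorphic_X22 q4 c3 tS).
  by left; apply/E/c4_model22.
- have [_ [_ E]] := isomorphic_c4_c6_eq0 (has_degrees_model33 a e) (isomorphic_X33 a2 ae e4 tS).
  by right; apply/E/c6_model33.
have [[_ E] _] := isomorphic_c4_c6_eq0 (has_degrees_model44 q c') (isomorphic_X44 q4 c3 tS).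
by left; apply/E/c4_model44.
Qed.

(** The vanishing of c4 or c6 passes from S to the equation over the integers. *)
Lemma no_strong_model_over_int S : [pchar k] =i pred0 -> c4 S = 0 \/ c6 S = 0 ->
  ~ has_strong_model int S.
Proof.
move=> char0 c46 [W [[dW [phi [inj_phi iso]]] ell]].
have ellW (F : closedFieldType) : elliptic_surface (base_change (intr : int -> F) W).
  exact: ell F (intr : {rmorphism int -> F}).
have dphi : has_degrees (base_change phi W).
  by case: dW => *; split; apply: leq_trans (size_poly _ _) _.
have [[E4 _] [E6 _]] := isomorphic_c4_c6_eq0 dphi iso.
have inj_map : injective (map_poly phi) by apply: map_inj_poly => //; apply: rmorph0.
case: c46 => [/E4|/E6] e0.
  have /eqP[] := c4_neq0_of_elliptic_over_int ellW.
  by apply: inj_map; rewrite rmorph0 -map_c4.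
have /eqP[] := c6_neq0_of_elliptic_over_int ellW.
by apply: inj_map; rewrite rmorph0 -map_c6.
Qed.

End StrongModels.

Theorem mainTheorem1 :
  (forall (c : miranda_persson) (k : closedFieldType) (S : weierstrass {poly k}),
     List.In c [:: X211; X321; X431; X411; X141; X222;
                   X9111; X8211; X5511; X6321; X4422; X3333] ->
     surface_of_type c S ->
     has_strong_model int S)
  /\
  (forall (c : miranda_persson) (k : closedFieldType) (S : weierstrass {poly k}),
     List.In c [:: X22; X33; X44] ->
     surface_of_type c S ->
     ~ has_strong_model int S /\
     exists K : fieldExtType rat, has_strong_model (ring_of_integers K) S)
  /\
  (forall (c : miranda_persson) (k : closedFieldType) (S : weierstrass {poly k}),
     c <> X11 ->
     surface_of_type c S ->
     exists K : fieldExtType rat, has_strong_model (ring_of_integers K) S).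
Proof.
have part1 (c : miranda_persson) (k : closedFieldType) (S : weierstrass {poly k}) :
  has_model c -> surface_of_type c S -> has_strong_model int S.
  move=> hc tS; have [char0 _ _] := tS.
  exact: (@has_strong_model_of_model k c S int intr (intr_char0_inj char0)).
have part2 (c : miranda_persson) (k : closedFieldType) (S : weierstrass {poly k}) :
  List.In c [:: X22; X33; X44] -> surface_of_type c S ->
  exists K : fieldExtType rat, has_strong_model (ring_of_integers K) S.
  case=> [<-|[<-|[<-|//]]].
  - exact: has_strong_model_X22.
  - exact: has_strong_model_X33.
  - exact: has_strong_model_X44.
split=> [c k S hc|]; first by apply: part1; do 12?[case: hc => [<- //|hc]].
split=> [c k S hc tS|c k S nX11 tS].
  split; last exact: part2 tS.
  by have [char0 _ _] := tS; apply: no_strong_model_over_int (additive_c4_c6 hc tS).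
have [hc|nhc] := boolP (has_model c); last first.
  by apply: (part2 c) => //; case: c nhc nX11 {tS} => //= _ _; tauto.
have [char0 _ _] := tS.
have [K [phi [iota [inj_phi _]]]] := number_ring_embedding char0 (integral1 (intr : int -> k)).
by exists K; apply: has_strong_model_of_model inj_phi hc tS.
Qed.
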